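(* Let $n\ge 1$ and let $Q(z)=(z-a_1)(z-a_2)\cdots(z-a_n)\in\mathbb{C}[z]$ be a monic strong uniqueness polynomial with pairwise distinct roots $a_1,\dots,a_n$, and put $S=\{a_1,\dots,a_n\}$. Let $m_1$ and $m_2$ denote, respectively, the number of distinct simple zeros and the number of distinct multiple zeros of the polynomial $Q(z)-Q(0)$, and let $k$ denote the number of distinct zeros of $Q'(z)$. Suppose that $n>\max\{2k+2,\, m_1+m_2\}$, $m_1+m_2>2$ and $k\ge 2$. Let $\mathfrak{f}$ be a transcendental entire function with hyper-order $\rho_2(\mathfrak{f})<1$, and let $c\in\mathbb{C}\setminus\{0\}$. If $\mathfrak{f}(z)$ and $\mathfrak{f}(z+c)$ share the set $S$ with weight $2$, i.e. $E_{\mathfrak{f}(z)}(S,2)=E_{\mathfrak{f}(z+c)}(S,2)$, then $\mathfrak{f}(z)\equiv\mathfrak{f}(z+c)$.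
   Context: A non-constant monic polynomial $P(z)$ is called a strong uniqueness polynomial (for meromorphic functions) if, whenever $\mathfrak{f},\mathfrak{g}$ are non-constant meromorphic functions on $\mathbb{C}$ and $\alpha$ is a non-zero constant with $P(\mathfrak{f})\equiv\alpha P(\mathfrak{g})$, it follows that $\mathfrak{f}\equiv\mathfrak{g}$. The hyper-order of a meromorphic function $\mathfrak{f}$ is $\rho_2(\mathfrak{f})=\limsup_{r\to\infty}\frac{\log\log T(r,\mathfrak{f})}{\log r}$, where $T(r,\mathfrak{f})$ is the Nevanlinna characteristic function. Weighted sharing: for a non-negative integer $l$ (or $\infty$) and $a\in\mathbb{C}$, $E_l(a;\mathfrak{f})$ denotes the set of $a$-points of $\mathfrak{f}$, where an $a$-point of multiplicity $m$ is counted $m$ times if $m\le l$ and $l+1$ times if $m>l$. For a set $S\subset\mathbb{C}$, $E_{\mathfrak{f}}(S,l)=\bigcup_{a\in S}E_l(a;\mathfrak{f})$ (as a multiset of points), and $\mathfrak{f}$, $\mathfrak{g}$ share $S$ with weight $l$ if $E_{\mathfrak{f}}(S,l)=E_{\mathfrak{g}}(S,l)$. *)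

(* Defs.v *)
From HB Require Import structures.
From mathcomp Require Import all_boot all_order all_algebra.
From mathcomp Require Import all_classical all_reals all_analysis.
From mathcomp Require Import complex.
Set Implicit Arguments. Unset Strict Implicit. Unset Printing Implicit Defensive.
Import Order.TTheory GRing.Theory Num.Theory.
Import numFieldNormedType.Exports.
Local Open Scope ring_scope.
Local Open Scope complex_scope.

Section Defs.
Variable R : realType.
Local Notation C := R[i].

Definition cmod (z : C) : R := Num.sqrt (complex.Re z ^+ 2 + complex.Im z ^+ 2).

Definition has_cderiv (f : C -> C) (z l : C) : Prop :=
  forall eps : R, 0 < eps -> exists2 d : R, 0 < d &
    forall w : C, 0 < cmod (w - z) < d -> cmod ((f w - f z) / (w - z) - l) < eps.

Definition entire (f : C -> C) : Prop := forall z, exists l, has_cderiv f z l.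

Definition transcendental_entire (f : C -> C) : Prop :=
  entire f /\ ~ exists p : {poly C}, forall z, f z = p.[z].

Definition is_pole (f : C -> C) (z0 : C) : Prop :=
  forall M : R, exists2 d : R, 0 < d &
    forall w : C, 0 < cmod (w - z0) < d -> M < cmod (f w).

(* meromorphic on C: poles are isolated (no accumulation point in C) and f is
   complex differentiable at every non-pole.  The values of f at poles are
   irrelevant. *)
Definition meromorphic (f : C -> C) : Prop :=
  (forall z, exists2 d : R, 0 < d &
     forall w : C, 0 < cmod (w - z) < d -> ~ is_pole f w) /\
  (forall z, ~ is_pole f z -> exists l, has_cderiv f z l).

Definition mero_eq (f g : C -> C) : Prop :=
  forall z, ~ is_pole f z -> ~ is_pole g z -> f z = g z.

Definition mero_nonconstant (f : C -> C) : Prop :=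
  ~ exists c : C, forall z, ~ is_pole f z -> f z = c.

Definition strong_uniqueness_poly (P : {poly C}) : Prop :=
  [/\ P \is monic, (1 < size P)%N &
   forall (f g : C -> C) (alpha : C),
     meromorphic f -> meromorphic g -> mero_nonconstant f ->
     mero_nonconstant g -> alpha != 0 ->
     mero_eq (fun z => P.[f z]) (fun z => alpha * P.[g z]) -> mero_eq f g].

Definition mult_ge (f : C -> C) (a z : C) (j : nat) : Prop :=
  exists h : C -> C, entire h /\ forall w, f w - a = (w - z) ^+ j * h w.

(* E_f(S,l) = E_g(S,l): at every point z, the weighted count min(m, l+1) of
   the S-point z (0 if f z \notin S) is the same for f and g; equivalently for
   each 1 <= j <= l+1, "z is an S-point of multiplicity >= j" agrees. *)
Definition share_set_weight (f g : C -> C) (S : C -> Prop) (l : nat) : Prop :=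
  forall (z : C) (j : nat), (1 <= j <= l.+1)%N ->
    ((exists2 a, S a & mult_ge f a z j) <-> (exists2 a, S a & mult_ge g a z j)).

Definition log_plus (x : R) : R := Num.max 0 (ln x).

(* Nevanlinna characteristic of an ENTIRE function (N(r,f) = 0):
   T(r,f) = m(r,f) = 1/(2 pi) int_0^{2 pi} log^+ |f(r e^{i t})| dt *)
Definition nevanlinna_T_entire (f : C -> C) (r : R) : R :=
  (2 * pi)^-1 * \int[lebesgue_measure]_(t in `[0, 2 * pi]%classic)
                   log_plus (cmod (f (Complex (r * cos t) (r * sin t)))).

Definition hyper_order_entire (f : C -> C) : \bar R :=
  limf_esup (fun r : R => (ln (ln (nevanlinna_T_entire f r)) / ln r)%:E)
            (+oo%R : set_system R).

Definition num_distinct (P : C -> bool) (n : nat) : Prop :=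
  exists s : seq C, [/\ uniq s, forall z, (z \in s) = P z & size s = n].

End Defs.

(* Main.v *)
(* Put g(z) = f(z + c), A = Q(f), B = Q(g), let q be the product of the z - b over the
   distinct zeros b of Q', and Phi = A''/A' - B''/B' - 2 (A'/A - B'/B).  Sharing S with
   weight 2 is exactly what makes E = (q(f) f' q(g) g' Phi)^2 / (A B) entire: at a common zero
   of A and B of orders p, p' the function Phi has at most a simple pole, no pole if p = p', and
   a zero if p = p' = 1.  Since n >= 2k + 3, |E| (1 + |f| + |g|) is bounded by a power of the
   logarithmic derivatives of f - a_i, g - a_i, A, A', B, B'.

   Such a bound forces E = 0.  For suitable r, log log log (|f| + |g|) at most doubles between
   |z| = r and a slightly larger circle; on a circle in between that stays away from the zeros
   involved, the logarithmic derivatives are bounded by a power of T = log max (|f| + |g|), so by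
   the maximum principle E, E f and E g are bounded by a power of T inside, and f = (E f) / E
   gives T = O(log^2 T), hence f and g are bounded.

   Now Phi = 0 integrates to 1/A = c/B + d.  If d <> 0, then g omits all zeros of Q + c/d, of
   which there are at least two because k >= 2, contradicting Picard's theorem (another instance
   of the growth argument).  So Q(g) = c Q(f), and strong uniqueness concludes.

   Cauchy's theory is obtained without integrals: midpoint sums around a triangle tend to 0
   (Goursat), and fanning a regular polygon from an interior point gives the maximum principle. *)

(* The shape of [E] comes from counting orders. [A''/A'] has simple poles at the zeros of [Q'(f)]
   and of [f']; the factor [q(f) f'] removes them, and the radical [q] of [Q'] does so with the
   least degree. At a common zero of [A] and [B] of orders p and p' the square then has order at
   least [2(p-1) + 2(p'-1) - 2], which exceeds the order of [A B] by [p + p' - 6]. This is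
   nonnegative once both orders are at least 3, so only the orders 1 and 2 have to agree.

   The square makes it possible to divide by a single [A]: [f'^2 / A] is the square of the
   logarithmic derivative of [f - a_i] times [(f - a_i)^2 / A]. Comparing degrees in
   [q(f)^2 (1 + |f|) (f - a_i)^2 / Q(f)] asks for [2k + 3 <= n]. The spare factor [1 + |f|] is
   decisive: it makes [E f] and [E g] as small as [E], so that [f] itself can be recovered as a
   quotient.

   All estimates pass through a maximum principle whose hypothesis is a bound on a ring. Therefore
   boundary inequalities are proved on rings instead of circles, and zeros are counted with Blaschke
   factors in place of Jensen's formula. *)
Require Import Defs.
From HB Require Import structures.
From mathcomp Require Import all_boot all_order all_algebra.
From mathcomp Require Import all_classical all_reals all_analysis.
From mathcomp Require Import complex.
From mathcomp Require Import ring lra.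
Set Implicit Arguments. Unset Strict Implicit. Unset Printing Implicit Defensive.
Import Order.TTheory GRing.Theory Num.Theory.
Local Open Scope ring_scope.
Local Open Scope complex_scope.

(** * Modulus, real and imaginary parts, conjugation *)

Section ComplexModulus.
Variable R : realType.
Local Notation C := R[i].
Implicit Types (x y z w : C) (t : R).

Lemma normC_cmod z : `|z| = (cmod z)%:C.
Proof. by rewrite normc_def. Qed.

Lemma cmod_ge0 z : 0 <= cmod z.
Proof. exact: sqrtr_ge0. Qed.

Lemma cmodD x y : cmod (x + y) <= cmod x + cmod y.
Proof. by rewrite -lecR rmorphD /= -!normC_cmod ler_normD. Qed.

Lemma cmodM x y : cmod (x * y) = cmod x * cmod y.
Proof. by apply: complexI; rewrite rmorphM /= -!normC_cmod normrM. Qed.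

Lemma cmodN x : cmod (- x) = cmod x.
Proof. by apply: complexI; rewrite -!normC_cmod normrN. Qed.

Lemma cmodC x y : cmod (x - y) = cmod (y - x).
Proof. by rewrite -cmodN opprB. Qed.

Lemma cmodB x y : cmod (x - y) <= cmod x + cmod y.
Proof. by rewrite -(cmodN y) cmodD. Qed.

Lemma cmod_dist x y z : cmod (x - z) <= cmod (x - y) + cmod (y - z).
Proof. by rewrite -[x - z](subrKA y) cmodD. Qed.

Lemma cmod_leB x y : cmod x - cmod y <= cmod (x - y).
Proof. by rewrite lerBlDr; apply: le_trans (cmodD _ _); rewrite subrK. Qed.

Lemma cmodV x : cmod x^-1 = (cmod x)^-1.
Proof. by apply: complexI; rewrite -normC_cmod normfV normC_cmod fmorphV. Qed.

Lemma cmod_div x y : cmod (x / y) = cmod x / cmod y.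
Proof. by rewrite cmodM cmodV. Qed.

Lemma cmod0 : cmod (0 : C) = 0.
Proof. by apply: complexI; rewrite -normC_cmod normr0. Qed.

Lemma cmod1 : cmod (1 : C) = 1.
Proof. by apply: complexI; rewrite -normC_cmod normr1. Qed.

Lemma cmod_eq0 x : (cmod x == 0) = (x == 0).
Proof. by rewrite -(normr_eq0 x) normC_cmod -(inj_eq (@complexI R)). Qed.

Lemma cmod_gt0 x : (0 < cmod x) = (x != 0).
Proof. by rewrite lt0r cmod_eq0 cmod_ge0 andbT. Qed.

Lemma cmodX x n : cmod (x ^+ n) = cmod x ^+ n.
Proof. by elim: n => [|n IH]; rewrite ?expr0 ?cmod1 // !exprS cmodM IH. Qed.

Lemma cmodR t : cmod (t%:C) = `|t|.
Proof. by rewrite /cmod /= expr0n addr0 sqrtr_sqr. Qed.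

Lemma cmod_nat n : cmod (n%:R : C) = n%:R.
Proof. by rewrite -[n%:R : C](rmorph_nat (real_complex R)) cmodR ger0_norm. Qed.

Lemma cmod_sum (I : Type) (r : seq I) (F : I -> C) :
  cmod (\sum_(i <- r) F i) <= \sum_(i <- r) cmod (F i).
Proof.
elim/big_rec2: _ => [|i y1 y2 _ h]; first by rewrite cmod0.
by apply: le_trans (cmodD _ _) _; rewrite lerD2l.
Qed.

Lemma cmod_prod (I : Type) (r : seq I) (F : I -> C) :
  cmod (\prod_(i <- r) F i) = \prod_(i <- r) cmod (F i).
Proof. by elim/big_rec2: _ => [|i y1 y2 _ h]; rewrite ?cmod1 // cmodM h. Qed.

Lemma cmod_sqr z : cmod z ^+ 2 = complex.Re z ^+ 2 + complex.Im z ^+ 2.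
Proof. by rewrite sqr_sqrtr // addr_ge0 // sqr_ge0. Qed.

Lemma Re_le_cmod z : `|complex.Re z| <= cmod z.
Proof.
rewrite -(ler_pXn2r (n := 2)) ?nnegrE ?cmod_ge0 //.
by rewrite real_normK ?num_real // cmod_sqr lerDl sqr_ge0.
Qed.

Lemma Im_le_cmod z : `|complex.Im z| <= cmod z.
Proof.
rewrite -(ler_pXn2r (n := 2)) ?nnegrE ?cmod_ge0 //.
by rewrite real_normK ?num_real // cmod_sqr lerDr sqr_ge0.
Qed.

Lemma cmod_leReIm z : cmod z <= `|complex.Re z| + `|complex.Im z|.
Proof.
rewrite -(ler_pXn2r (n := 2)) ?nnegrE ?cmod_ge0 ?addr_ge0 //.
rewrite cmod_sqr sqrrD !real_normK ?num_real //.
by rewrite lerD2r lerDl mulrn_wge0 // mulr_ge0.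
Qed.

Lemma ReD x y : complex.Re (x + y) = complex.Re x + complex.Re y.
Proof. by case: x y => [a b] [c d]. Qed.
Lemma ImD x y : complex.Im (x + y) = complex.Im x + complex.Im y.
Proof. by case: x y => [a b] [c d]. Qed.
Lemma ReN x : complex.Re (- x) = - complex.Re x.
Proof. by case: x. Qed.
Lemma ImN x : complex.Im (- x) = - complex.Im x.
Proof. by case: x. Qed.
Lemma ReM x y : complex.Re (x * y) =
  complex.Re x * complex.Re y - complex.Im x * complex.Im y.
Proof. by case: x y => [a b] [c d]. Qed.
Lemma ImM x y : complex.Im (x * y) =
  complex.Re x * complex.Im y + complex.Im x * complex.Re y.
Proof. by case: x y => [a b] [c d]. Qed.

Lemma eqC x y : complex.Re x = complex.Re y -> complex.Im x = complex.Im y -> x = y.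
Proof. by case: x y => [a b] [c d] /= -> ->. Qed.


Definition cj z : C := complex.Re z -i* complex.Im z.

Lemma cj0 : cj 0 = 0.
Proof. by apply: eqC => /=; rewrite ?oppr0. Qed.

Lemma cjD x y : cj (x + y) = cj x + cj y.
Proof. by apply: eqC; rewrite ?ReD ?ImD /= ?ReD ?ImD ?opprD. Qed.

Lemma cjN x : cj (- x) = - cj x.
Proof. by apply: eqC; rewrite ?ReN ?ImN /= ?ReN ?ImN. Qed.

Lemma cjB x y : cj (x - y) = cj x - cj y.
Proof. by rewrite cjD cjN. Qed.

Lemma cmod_cj z : cmod (cj z) = cmod z.
Proof. by rewrite /cmod /= sqrrN. Qed.

Lemma mul_cj z : z * cj z = (cmod z ^+ 2)%:C.
Proof. by rewrite cmod_sqr; apply: eqC; rewrite ?ReM ?ImM /=; ring. Qed.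

End ComplexModulus.

(** * Complex differentiation and its rules *)

Section ComplexDerivative.
Variable R : realType.
Local Notation C := R[i].
Implicit Types (f g h : C -> C) (z w l a b : C) (d e : R).

(** Clearing the denominator admits [w = z], where both sides vanish; this is why the inequality is
    not strict. Estimates over segments and triangles through [z] then need no case distinction. *)
Lemma has_cderivP f z l :
  has_cderiv f z l <->
  (forall e, 0 < e -> exists2 d, 0 < d & forall w, cmod (w - z) < d ->
     cmod (f w - f z - l * (w - z)) <= e * cmod (w - z)).
Proof.
split=> H e e0.
- have [d d0 Hd] := H e e0; exists d => // w wd.
  have [->|wz] := eqVneq w z; first by rewrite !subrr mulr0 subr0 cmod0 mulr0.
  have wz0 : w - z != 0 by rewrite subr_eq0.
  have := Hd w; rewrite cmod_gt0 wz0 wd => /(_ isT) /ltW h.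
  have -> : f w - f z - l * (w - z) = ((f w - f z) / (w - z) - l) * (w - z).
    by field.
  by rewrite cmodM ler_wpM2r ?cmod_ge0.
- have [d d0 Hd] := H (e / 2) ltac:(lra); exists d => // w /andP[w0 wd].
  have wz0 : w - z != 0 by rewrite -cmod_gt0.
  have -> : (f w - f z) / (w - z) - l = (f w - f z - l * (w - z)) / (w - z).
    by field.
  rewrite cmod_div ltr_pdivrMr //; apply: le_lt_trans (Hd w wd) _.
  by rewrite ltr_pM2r //; lra.
Qed.

Definition ccont f z := forall e, 0 < e ->
  exists2 d, 0 < d & forall w, cmod (w - z) < d -> cmod (f w - f z) < e.

Definition cdiff f z := exists l, has_cderiv f z l.

(** A total function, with value 0 where there is no derivative, so that it can be iterated and
    compared with other functions. *)
Definition cder f z : C := xget 0 [set l | has_cderiv f z l]%classic.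

Lemma cderP f z : cdiff f z -> has_cderiv f z (cder f z).
Proof. by move=> [l hl]; exact: (xgetI _ hl). Qed.

Lemma has_cderiv_cont f z l : has_cderiv f z l -> ccont f z.
Proof.
move=> /has_cderivP/(_ 1 ltr01)[d d0 Hd] e e0.
have k0 : 0 < 2 + cmod l by have := cmod_ge0 l; lra.
exists (Num.min d (e / (2 + cmod l))).
  by rewrite lt_min d0 divr_gt0.
move=> w; rewrite lt_min => /andP[wd we].
have := Hd w wd; rewrite mul1r => h1.
have h2 := cmodD (f w - f z - l * (w - z)) (l * (w - z)).
rewrite subrK cmodM in h2.
move: we; rewrite ltr_pdivlMr // => we.
have := cmod_ge0 (w - z); have := cmod_ge0 l; nra.
Qed.

Lemma cdiff_cont f z : cdiff f z -> ccont f z.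
Proof. by move=> [l /has_cderiv_cont]. Qed.

Lemma has_cderiv_near f g z l d : 0 < d ->
  (forall w, cmod (w - z) < d -> g w = f w) ->
  has_cderiv f z l -> has_cderiv g z l.
Proof.
move=> d0 E H e /H[d1 d10 Hd]; exists (Num.min d d1); first by rewrite lt_min d0.
move=> w; rewrite lt_min => /andP[w0 /andP[wd wd1]].
by rewrite !E ?subrr ?cmod0 //; apply: Hd; rewrite w0.
Qed.

Lemma cmod_ex_point z d : 0 < d -> exists2 w, w != z & cmod (w - z) < d.
Proof.
move=> d0; exists (z + (d / 2)%:C).
  rewrite -subr_eq0 addrC addKr -cmod_eq0 cmodR; apply/eqP => h.
  by move: h; rewrite ger0_norm; lra.
by rewrite addrC addKr cmodR ger0_norm; lra.
Qed.

Lemma cmod_small z : (forall e, 0 < e -> cmod z <= e) -> z = 0.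
Proof.
move=> H; apply/eqP; rewrite -cmod_eq0; apply/eqP/le_anti.
rewrite cmod_ge0 andbT; apply/ler_addgt0Pr => e e0.
by rewrite add0r; exact: H.
Qed.

Lemma has_cderiv_uniq f z l l' : has_cderiv f z l -> has_cderiv f z l' -> l = l'.
Proof.
move=> H H'; apply/eqP; rewrite -subr_eq0; apply/eqP/cmod_small => e e0.
have [d d0 Hd] := H (e / 2) ltac:(lra).
have [d' d'0 Hd'] := H' (e / 2) ltac:(lra).
have [w wz] := @cmod_ex_point z (Num.min d d') ltac:(by rewrite lt_min d0).
rewrite lt_min => /andP[wd wd'].
have w0 : 0 < cmod (w - z) by rewrite cmod_gt0 subr_eq0.
have := Hd w; rewrite w0 wd => /(_ isT).
have := Hd' w; rewrite w0 wd' => /(_ isT).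
set q := (f w - f z) / (w - z).
have := cmod_dist l q l'; rewrite (cmodC l q); lra.
Qed.

Lemma cderE f z l : has_cderiv f z l -> cder f z = l.
Proof. by move=> h; apply: (has_cderiv_uniq (z := z) _ h); apply: cderP; exists l. Qed.

Lemma has_cderiv_cst a z : has_cderiv (fun _ => a) z 0.
Proof.
by apply/has_cderivP => e e0; exists 1 => // w _; rewrite subrr mul0r subr0 cmod0
  mulr_ge0 ?cmod_ge0 // ltW.
Qed.

Lemma has_cderiv_id z : has_cderiv (fun w => w) z 1.
Proof.
by apply/has_cderivP => e e0; exists 1 => // w _; rewrite mul1r subrr cmod0
  mulr_ge0 ?cmod_ge0 // ltW.
Qed.

Lemma has_cderivD f g z l m : has_cderiv f z l -> has_cderiv g z m ->
  has_cderiv (fun w => f w + g w) z (l + m).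
Proof.
move=> /has_cderivP H /has_cderivP H'; apply/has_cderivP => e e0.
have [d d0 Hd] := H (e / 2) ltac:(lra).
have [d' d'0 Hd'] := H' (e / 2) ltac:(lra).
exists (Num.min d d'); first by rewrite lt_min d0.
move=> w; rewrite lt_min => /andP[/Hd h /Hd' h'].
have -> : f w + g w - (f z + g z) - (l + m) * (w - z) =
  (f w - f z - l * (w - z)) + (g w - g z - m * (w - z)) by ring.
have := cmodD (f w - f z - l * (w - z)) (g w - g z - m * (w - z)); lra.
Qed.

Lemma has_cderivM f g z l m : has_cderiv f z l -> has_cderiv g z m ->
  has_cderiv (fun w => f w * g w) z (l * g z + f z * m).
Proof.
move=> Hf Hg; have Cg := has_cderiv_cont Hg.
move: Hf Hg => /has_cderivP H /has_cderivP H'; apply/has_cderivP => e e0.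
(* [K] dominates [l], [f z], [g z] and, since the tolerance [e'] is at most 1, also [g w]. Each of
   the three error terms below is then at most [K * e'] times the distance, which the 4 in
   [e / (4 * K)] covers. *)
pose K := 1 + cmod l + cmod (f z) + cmod (g z).
have K1 : 1 <= K.
  by have := cmod_ge0 l; have := cmod_ge0 (f z); have := cmod_ge0 (g z); rewrite /K; lra.
have K0 : 0 < K by lra.
have eK : 0 < Num.min 1 (e / (4 * K)).
  by rewrite lt_min ltr01 divr_gt0 // mulr_gt0.
set e' := Num.min _ _ in eK.
have e'1 : e' <= 1 by rewrite ge_min lexx.
have e'K : e' * (4 * K) <= e by rewrite -ler_pdivlMr ?mulr_gt0 // ge_min lexx orbT.
have [d d0 Hd] := H e' eK.
have [d' d'0 Hd'] := H' e' eK.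
have [d2 d20 Hd2] := Cg e' eK.
exists (Num.min d (Num.min d' d2)); first by rewrite !lt_min d0 d'0.
move=> w; rewrite !lt_min => /and3P[/Hd h /Hd' h' /Hd2 h2].
have -> : f w * g w - f z * g z - (l * g z + f z * m) * (w - z) =
  (f w - f z - l * (w - z)) * ((g w - g z) + g z) +
  (f z * (g w - g z - m * (w - z)) + l * (w - z) * (g w - g z)) by ring.
apply: le_trans (cmodD _ _) _; rewrite cmodM.
have := cmodD (f z * (g w - g z - m * (w - z))) (l * (w - z) * (g w - g z)).
rewrite !cmodM.
have gK : cmod (g w - g z + g z) <= K.
  apply: le_trans (cmodD _ _) _; rewrite /K; have := cmod_ge0 l.
  have := cmod_ge0 (f z); lra.
set A := cmod (f w - f z - _) in h *; set B := cmod (g w - g z - _) in h' *.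
set D := cmod (w - z) in h h' *; set G := cmod (g w - g z + g z) in gK *.
set X := cmod (_ + _) => hX.
have D0 : 0 <= D := cmod_ge0 _.
have G0 : 0 <= G := cmod_ge0 _.
have A0 : 0 <= A := cmod_ge0 _.
have lK : cmod l <= K by rewrite /K; have := cmod_ge0 (g z); have := cmod_ge0 (f z); have := cmod_ge0 (g z); lra.
have fK : cmod (f z) <= K by rewrite /K; have := cmod_ge0 l; have := cmod_ge0 (g z); lra.
have h1 : A * G <= (e' * D) * K by apply: ler_pM.
have h3 : cmod (f z) * B <= K * (e' * D) by apply: ler_pM => //; exact: cmod_ge0.
have h4 : cmod l * D * cmod (g w - g z) <= K * D * e'.
  by apply: ler_pM => //; rewrite ?mulr_ge0 ?cmod_ge0 ?ler_wpM2r // ltW.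
have : e' * (4 * K) * D <= e * D by rewrite ler_wpM2r.
have : 0 <= e' * K * D by rewrite !mulr_ge0 // ltW.
nra.
Qed.

Lemma has_cderivZ a f z l : has_cderiv f z l -> has_cderiv (fun w => a * f w) z (a * l).
Proof.
by move=> h; rewrite -[a * l]add0r -(mul0r (f z)); exact: has_cderivM (has_cderiv_cst _ _) h.
Qed.

Lemma has_cderivN f z l : has_cderiv f z l -> has_cderiv (fun w => - f w) z (- l).
Proof.
move=> /(has_cderivZ (-1)); rewrite mulN1r; apply: has_cderiv_near ltr01 _ => w _.
by rewrite mulN1r.
Qed.

Lemma has_cderivB f g z l m : has_cderiv f z l -> has_cderiv g z m ->
  has_cderiv (fun w => f w - g w) z (l - m).
Proof. by move=> h /has_cderivN; exact: has_cderivD. Qed.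

Lemma has_cderivX f z l n : has_cderiv f z l ->
  has_cderiv (fun w => f w ^+ n) z (n%:R * l * f z ^+ n.-1).
Proof.
move=> h; elim: n => [|n IH].
  by rewrite mul0r mul0r; apply: has_cderiv_near ltr01 _ (has_cderiv_cst 1 z).
have := has_cderivM h IH.
have -> : l * f z ^+ n + f z * (n%:R * l * f z ^+ n.-1) = n.+1%:R * l * f z ^+ n.
  by case: n {IH} => [|n] /=; [ring | rewrite !exprS -[in RHS]natr1; ring].
by apply: has_cderiv_near ltr01 _ => w _; rewrite exprS.
Qed.

Lemma has_cderivV f z l : f z != 0 -> has_cderiv f z l ->
  has_cderiv (fun w => (f w)^-1) z (- l / f z ^+ 2).
Proof.
move=> fz0 Hf; have Cf := has_cderiv_cont Hf.
have c0 : 0 < cmod (f z) by rewrite cmod_gt0.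
move: (Hf) => /has_cderivP H; apply/has_cderivP => e e0.
set c := cmod (f z) in c0.
pose K := 1 + cmod l.
have K0 : 0 < K by rewrite /K; have := cmod_ge0 l; lra.
have e1 : 0 < e * c ^+ 2 / 4 by rewrite !mulr_gt0 // exprn_gt0.
have [d d0 Hd] := H _ e1.
(* The first bound keeps [f w] of modulus at least [c / 2]. With the second, both terms of the
   numerator are at most [e * c ^+ 3 / 4] times the distance, against a denominator of at least
   [c ^+ 3 / 2]. *)
have m0 : 0 < Num.min (c / 2) (e * c ^+ 3 / (4 * K)).
  by rewrite lt_min !divr_gt0 // ?mulr_gt0 // exprn_gt0.
have [d' d'0 Hd'] := Cf _ m0.
exists (Num.min d d'); first by rewrite !lt_min d0 d'0.
move=> w; rewrite !lt_min => /andP[/Hd h /Hd']; rewrite lt_min => /andP[h1 h2].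
have fw2 : c / 2 <= cmod (f w).
  have := cmod_leB (f z) (f w); rewrite cmodC -/c; lra.
have fw0 : f w != 0 by rewrite -cmod_gt0; lra.
have -> : (f w)^-1 - (f z)^-1 - - l / f z ^+ 2 * (w - z) =
  (- (f w - f z - l * (w - z)) * f z + l * (w - z) * (f w - f z)) / (f w * f z ^+ 2).
  by field; rewrite fz0 fw0.
rewrite cmod_div cmodM cmodX -/c ler_pdivrMr ?mulr_gt0 ?exprn_gt0 //; last lra.
apply: le_trans (cmodD _ _) _; rewrite !cmodM cmodN -/c.
set A := cmod (f w - f z - _) in h *; set D := cmod (w - z) in h *.
have D0 : 0 <= D := cmod_ge0 _.
set G := cmod (f w - f z) in h1 h2 *.
have lK : cmod l <= K by rewrite /K; lra.
have h3 : A * c <= e * c ^+ 2 / 4 * D * c by rewrite ler_wpM2r // ltW.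
have h4 : cmod l * D * G <= K * D * G by rewrite !ler_wpM2r ?cmod_ge0.
have h5 : K * G <= e * c ^+ 3 / 4.
  move: h2; rewrite ltr_pdivlMr ?mulr_gt0 // => h2; lra.
have h6 : K * D * G <= e * c ^+ 3 / 4 * D by rewrite mulrAC ler_wpM2r.
have h7 : e * D * (c / 2 * c ^+ 2) <= e * D * (cmod (f w) * c ^+ 2).
  by rewrite ler_wpM2l ?mulr_ge0 ?ler_wpM2r ?exprn_ge0 // ltW.
move: h3 h6 h7; rewrite !exprS expr0 !mulr1; nra.
Qed.

Lemma has_cderiv_shift f z c l : has_cderiv f (z + c) l ->
  has_cderiv (fun w => f (w + c)) z l.
Proof.
move=> H e /H[d d0 Hd]; exists d => // w; have := Hd (w + c).
by rewrite (_ : w + c - (z + c) = w - z) //; ring.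
Qed.

Lemma cdiff_cst a z : cdiff (fun _ => a) z.
Proof. by exists 0; exact: has_cderiv_cst. Qed.
Lemma cdiff_id z : cdiff (fun w => w) z.
Proof. by exists 1; exact: has_cderiv_id. Qed.
Lemma cdiffD f g z : cdiff f z -> cdiff g z -> cdiff (fun w => f w + g w) z.
Proof. by move=> [l hl] [m hm]; exists (l + m); exact: has_cderivD. Qed.
Lemma cdiffN f z : cdiff f z -> cdiff (fun w => - f w) z.
Proof. by move=> [l hl]; exists (- l); exact: has_cderivN. Qed.
Lemma cdiffB f g z : cdiff f z -> cdiff g z -> cdiff (fun w => f w - g w) z.
Proof. by move=> h /cdiffN; exact: cdiffD. Qed.
Lemma cdiffM f g z : cdiff f z -> cdiff g z -> cdiff (fun w => f w * g w) z.
Proof. by move=> [l hl] [m hm]; eexists; exact: has_cderivM hl hm. Qed.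
Lemma cdiffX f z n : cdiff f z -> cdiff (fun w => f w ^+ n) z.
Proof. by move=> [l hl]; eexists; exact: has_cderivX hl. Qed.
Lemma cdiffV f z : f z != 0 -> cdiff f z -> cdiff (fun w => (f w)^-1) z.
Proof. by move=> h [l hl]; eexists; exact: has_cderivV hl. Qed.
Lemma cdiff_div f g z : g z != 0 -> cdiff f z -> cdiff g z ->
  cdiff (fun w => f w / g w) z.
Proof. by move=> h hf hg; apply: cdiffM => //; exact: cdiffV. Qed.
Lemma cdiff_shift f z c : cdiff f (z + c) -> cdiff (fun w => f (w + c)) z.
Proof. by move=> [l hl]; exists l; exact: has_cderiv_shift. Qed.
Lemma cdiff_near f g z d : 0 < d -> (forall w, cmod (w - z) < d -> g w = f w) ->
  cdiff f z -> cdiff g z.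
Proof. by move=> d0 E [l hl]; exists l; exact: has_cderiv_near d0 E hl. Qed.

Lemma cdiff_prod (I : Type) (r : seq I) (F : I -> C -> C) z :
  (forall i, cdiff (F i) z) -> cdiff (fun w => \prod_(i <- r) F i w) z.
Proof.
move=> H; elim: r => [|i r IH].
  by apply: cdiff_near ltr01 _ (cdiff_cst 1 z) => w _; rewrite big_nil.
by apply: cdiff_near ltr01 _ (cdiffM (H i) IH) => w _; rewrite big_cons.
Qed.

Lemma has_cderiv_horner (P : {poly C}) f z l : has_cderiv f z l ->
  has_cderiv (fun w => P.[f w]) z (P^`().[f z] * l).
Proof.
move=> H; elim/poly_ind: P => [|P c IH].
  rewrite linear0 horner0 mul0r; apply: has_cderiv_near ltr01 _ (has_cderiv_cst 0 z).
  by move=> w _; rewrite horner0.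
have := has_cderivD (has_cderivM IH H) (has_cderiv_cst c z).
rewrite (_ : _ + 0 = (P * 'X + c%:P)^`().[f z] * l).
  by apply: has_cderiv_near ltr01 _ => w _; rewrite !hornerE.
by rewrite derivD derivM derivX derivC !hornerE; ring.
Qed.

Lemma cdiff_horner (P : {poly C}) f z : cdiff f z -> cdiff (fun w => P.[f w]) z.
Proof. by move=> [l hl]; eexists; exact: has_cderiv_horner hl. Qed.

End ComplexDerivative.

(** * Midpoint sums, bisection of triangles, Goursat's theorem *)

Section Goursat.
Variable R : realType.
Local Notation C := R[i].
Implicit Types (f g k : C -> C) (z w a b p q s : C) (d e M : R) (X : C -> Prop).

(** The intervals around [u n] of half-width [2 * L / 2 ^+ n] are nested, and the supremum of their
    left ends lies in all of them. The explicit rate is what the later estimates use. *)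
Lemma real_lim_geom (u : nat -> R) (L : R) :
  (forall n, `|u n.+1 - u n| <= L / 2 ^+ n) ->
  exists l, forall n, `|u n - l| <= 2 * L / 2 ^+ n.
Proof.
move=> H.
have p2 n : 0 < 2 ^+ n :> R by rewrite exprn_gt0.
have L0 n : 0 <= L / 2 ^+ n by apply: le_trans (H n).
have half n : L / 2 ^+ n.+1 = L / 2 ^+ n / 2 by rewrite exprS; field; rewrite gt_eqF.
pose lo n := u n - 2 * (L / 2 ^+ n); pose hi n := u n + 2 * (L / 2 ^+ n).
have loS n : lo n <= lo n.+1.
  by rewrite /lo half; have := H n; rewrite ler_norml => /andP[]; lra.
have hiS n : hi n.+1 <= hi n.
  by rewrite /hi half; have := H n; rewrite ler_norml => /andP[]; lra.
have lomono m n : (m <= n)%N -> lo m <= lo n.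
  by move=> /subnK <-; elim: (n - m)%N => // j IH; rewrite addSn; exact: le_trans IH (loS _).
have himono m n : (m <= n)%N -> hi n <= hi m.
  by move=> /subnK <-; elim: (n - m)%N => // j IH; rewrite addSn; exact: le_trans (hiS _) IH.
have lohi m n : lo m <= hi n.
  apply: le_trans (lomono _ _ (leq_maxl m n)) _.
  apply: le_trans _ (himono _ _ (leq_maxr m n)).
  by rewrite /lo /hi; have := L0 (maxn m n); lra.
have hs : has_sup (range lo).
  by split; [exists (lo 0%N), 0%N | exists (hi 0%N) => _ [m _ <-]].
exists (sup (range lo)) => n.
have h1 : lo n <= sup (range lo) by apply: sup_upper_bound => //; exists n.
have h2 : sup (range lo) <= hi n.
  by apply: ge_sup => [|_ [m _ <-]//]; exists (lo 0%N), 0%N.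
by rewrite ler_norml -mulrA; move: h1 h2; rewrite /lo /hi; lra.
Qed.

Lemma complex_lim_geom (u : nat -> C) (L : R) :
  (forall n, cmod (u n.+1 - u n) <= L / 2 ^+ n) ->
  exists l, forall n, cmod (u n - l) <= 4 * L / 2 ^+ n.
Proof.
move=> H.
have [x Hx] := @real_lim_geom (fun n => complex.Re (u n)) L
  ltac:(by move=> n; rewrite -ReN -ReD; exact: le_trans (Re_le_cmod _) (H n)).
have [y Hy] := @real_lim_geom (fun n => complex.Im (u n)) L
  ltac:(by move=> n; rewrite -ImN -ImD; exact: le_trans (Im_le_cmod _) (H n)).
exists (x +i* y) => n; apply: le_trans (cmod_leReIm _) _.
rewrite ReD ImD ReN ImN /=; have := Hx n; have := Hy n; rewrite -!mulrA; lra.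
Qed.

Lemma geom_small (L e : R) : 0 < e -> exists n, L / 2 ^+ n < e.
Proof.
move=> e0; have := archi_boundP (normr_ge0 (L / e)); set n := Num.bound _ => h.
exists n; rewrite ltr_pdivrMr ?exprn_gt0 // -ltr_pdivrMl // mulrC.
apply: le_lt_trans (ler_norm _) _; apply: lt_le_trans h _.
by rewrite -natrX ler_nat ltnW // ltn_expl.
Qed.

Definition mid a b : C := (a + b) / 2.

Lemma midC a b : mid a b = mid b a.
Proof. by rewrite /mid addrC. Qed.

(* Midpoint Riemann sum of [k] over the segment from [a] to [b] cut into [2 ^ n] pieces. *)
Fixpoint msum n k a b : C :=
  if n is m.+1 then msum m k a (mid a b) + msum m k (mid a b) b
  else k (mid a b) * (b - a).

(** Midpoint convexity suffices for midpoint sums and bisected triangles to stay inside the set, and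
    it is immediate for discs, half-planes and intersections. *)
Definition mconv X := forall z w, X z -> X w -> X (mid z w).

Lemma mconvI X Y : mconv X -> mconv Y -> mconv (fun z => X z /\ Y z).
Proof. by move=> hX hY z w [? ?] [? ?]; split; [exact: hX | exact: hY]. Qed.

Lemma mid_sub (a b c : C) : mid a b - c = (a - c) / 2 + (b - c) / 2.
Proof. by rewrite /mid; field. Qed.

Lemma cmod_half (z : C) : cmod (z / 2) = cmod z / 2.
Proof. by rewrite cmod_div cmod_nat. Qed.

Lemma mconv_ball (c : C) M : mconv (fun z => cmod (z - c) <= M).
Proof.
move=> z w hz hw; rewrite mid_sub; apply: le_trans (cmodD _ _) _.
by rewrite !cmod_half; lra.
Qed.

Lemma msumN n k a b : msum n k b a = - msum n k a b.
Proof.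
elim: n a b => [|n IH] a b /=; rewrite (midC b a); first by ring.
by rewrite (IH a) (IH _ b); ring.
Qed.

Lemma msumB n f g a b : msum n (fun z => f z - g z) a b = msum n f a b - msum n g a b.
Proof. by elim: n a b => [|n IH] a b /=; rewrite ?IH; ring. Qed.

Lemma msumZ n c f a b : msum n (fun z => c * f z) a b = c * msum n f a b.
Proof. by elim: n a b => [|n IH] a b /=; rewrite ?IH; ring. Qed.

Lemma eq_msum n X f g a b : mconv X -> X a -> X b -> (forall z, X z -> f z = g z) ->
  msum n f a b = msum n g a b.
Proof.
move=> cX Xa Xb E; elim: n a b Xa Xb => [|n IH] a b Xa Xb /=.
  by rewrite E //; exact: cX.
by rewrite !IH //; exact: cX.
Qed.

(** The midpoint rule is exact on affine functions at every level [n], not only in the limit. Hence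
    the affine part of a differentiable function can be removed from a triangle sum without
    error. *)
Lemma msum_affine n (c m a b : C) :
  msum n (fun z => c + m * z) a b = c * (b - a) + m * (b ^+ 2 - a ^+ 2) / 2.
Proof. by elim: n a b => [|n IH] a b /=; rewrite ?IH /mid; field. Qed.

Lemma msum_bound X n k M a b : mconv X -> X a -> X b ->
  (forall z, X z -> cmod (k z) <= M) -> cmod (msum n k a b) <= M * cmod (b - a).
Proof.
move=> cX Xa Xb H; elim: n a b Xa Xb => [|n IH] a b Xa Xb /=.
  by rewrite cmodM ler_wpM2r ?cmod_ge0 // H //; exact: cX.
have Xm := cX _ _ Xa Xb.
have := IH _ _ Xa Xm; have := IH _ _ Xm Xb.
have -> : b - mid a b = (b - a) / 2 by rewrite /mid; field.
have -> : mid a b - a = (b - a) / 2 by rewrite /mid; field.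
rewrite cmod_half; have := cmodD (msum n k a (mid a b)) (msum n k (mid a b) b); lra.
Qed.

(** Every piece of the segment is the same nonnegative multiple of [e], so the pointwise lower bound
    adds up. It serves to keep the winding sum of a polygon away from 0. *)
Lemma msum_Im_ge X n k (c t : R) (e a b : C) : mconv X -> X a -> X b ->
  (forall z, X z -> c <= complex.Im (k z * e)) -> 0 <= t -> b - a = t%:C * e ->
  t * c <= complex.Im (msum n k a b).
Proof.
move=> cX Xa Xb H; elim: n a b t Xa Xb => [|n IH] a b t Xa Xb t0 E /=.
  rewrite E mulrCA ImM /= mul0r addr0 ler_wpM2l // H //; exact: cX.
have Xm := cX _ _ Xa Xb.
have t2 : 0 <= t / 2 by lra.
have tE : (t / 2)%:C * e = (b - a) / 2.
  by rewrite E rmorphM /= fmorphV rmorph_nat; ring.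
have := IH _ _ _ Xa Xm t2; have := IH _ _ _ Xm Xb t2.
have -> : b - mid a b = (b - a) / 2 by rewrite /mid; field.
have -> : mid a b - a = (b - a) / 2 by rewrite /mid; field.
rewrite tE ImD => /(_ erefl) + /(_ erefl); lra.
Qed.

Definition tsum n k p q s := msum n k p q + msum n k q s + msum n k s p.

Definition tper p q s := cmod (q - p) + cmod (s - q) + cmod (p - s).

Lemma tper_ge0 p q s : 0 <= tper p q s.
Proof. by rewrite /tper !addr_ge0 ?cmod_ge0. Qed.

(** The sides of the middle triangle are traversed once in each direction and cancel. *)
Lemma tsumS n k p q s : tsum n.+1 k p q s =
  tsum n k p (mid p q) (mid p s) + tsum n k (mid p q) q (mid q s)
  + tsum n k (mid p s) (mid q s) s + tsum n k (mid q s) (mid p s) (mid p q).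
Proof.
rewrite /tsum /= (midC s p) (msumN n k (mid p q) (mid p s)).
rewrite (msumN n k (mid p q) (mid q s)) (msumN n k (mid p s) (mid q s)).
by ring.
Qed.

Lemma tper_sub p q s :
  [/\ tper p (mid p q) (mid p s) = tper p q s / 2,
      tper (mid p q) q (mid q s) = tper p q s / 2,
      tper (mid p s) (mid q s) s = tper p q s / 2 &
      tper (mid q s) (mid p s) (mid p q) = tper p q s / 2].
Proof.
have H (x y t x' y' t' : C) : x = x' / 2 -> y = y' / 2 -> t = t' / 2 ->
    cmod x + cmod y + cmod t = (cmod x' + cmod y' + cmod t') / 2.
  by move=> -> -> ->; rewrite !cmod_half; field.
rewrite /tper; split.
- by apply: H; rewrite /mid; field.
- by apply: H; rewrite /mid; field.
- by apply: H; rewrite /mid; field.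
- by rewrite (cmodC q p) (cmodC s q) (cmodC p s); apply: H; rewrite /mid; field.
Qed.

Lemma tsum_bound X n k M p q s : mconv X -> X p -> X q -> X s ->
  (forall z, X z -> cmod (k z) <= M) -> cmod (tsum n k p q s) <= M * tper p q s.
Proof.
move=> cX Xp Xq Xs H; rewrite /tsum /tper !mulrDr.
have := msum_bound n cX Xp Xq H; have := msum_bound n cX Xq Xs H.
have := msum_bound n cX Xs Xp H.
have := cmodD (msum n k p q + msum n k q s) (msum n k s p).
have := cmodD (msum n k p q) (msum n k q s); lra.
Qed.

Definition cclosed X := forall z, (forall e, 0 < e -> exists2 w, X w & cmod (w - z) < e) -> X z.

Lemma cclosedI X Y : cclosed X -> cclosed Y -> cclosed (fun z => X z /\ Y z).
Proof.
move=> hX hY z H; split; [apply: hX | apply: hY] => e /H[w [? ?] ?]; by exists w.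
Qed.

Lemma cclosed_ball (c : C) M : cclosed (fun z => cmod (z - c) <= M).
Proof.
move=> z H; apply/ler_addgt0Pr => e /H[w hw hwz].
have := cmod_dist z w c; rewrite (cmodC z w); lra.
Qed.

(** Compactness as an induction principle: otherwise repeated bisection would give counterexamples
    shrinking to a point [z] of [X]. The point need not be known to lie in them; closeness relative
    to the perimeter is enough, and its factor 4 is the one in [complex_lim_geom]. Besides Goursat's
    theorem, the principle yields boundedness on discs and constancy when the derivative is 0. *)
Lemma triangle_bisection X (P : C -> C -> C -> Prop) : mconv X -> cclosed X ->
  (forall p q s, X p -> X q -> X s ->
     P p (mid p q) (mid p s) -> P (mid p q) q (mid q s) ->
     P (mid p s) (mid q s) s -> P (mid q s) (mid p s) (mid p q) -> P p q s) ->
  (forall z, X z -> exists2 d, 0 < d & forall p q s, X p -> X q -> X s ->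
     cmod (p - z) <= 4 * tper p q s -> tper p q s < d -> P p q s) ->
  forall p q s, X p -> X q -> X s -> P p q s.
Proof.
move=> cX clX Psub Ploc p0 q0 s0 Xp0 Xq0 Xs0; apply: contrapT => nP0.
pose bad (T : C * C * C) := [/\ X T.1.1, X T.1.2, X T.2 & ~ P T.1.1 T.1.2 T.2].
pose per (T : C * C * C) := tper T.1.1 T.1.2 T.2.
have step T : bad T -> exists T', [/\ bad T', per T' = per T / 2 &
    cmod (T'.1.1 - T.1.1) <= per T].
  case: T => [[p q] s] [/= Xp Xq Xs nP].
  have Xpq := cX _ _ Xp Xq; have Xps := cX _ _ Xp Xs; have Xqs := cX _ _ Xq Xs.
  have [e1 e2 e3 e4] := tper_sub p q s.
  have hd1 : cmod (mid p q - p) <= tper p q s.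
    have -> : mid p q - p = (q - p) / 2 by rewrite /mid; field.
    rewrite cmod_half /tper; have := cmod_ge0 (q - p); have := cmod_ge0 (s - q).
    have := cmod_ge0 (p - s); lra.
  have hd2 : cmod (mid p s - p) <= tper p q s.
    have -> : mid p s - p = (s - p) / 2 by rewrite /mid; field.
    rewrite cmod_half /tper (cmodC s p); have := cmod_ge0 (q - p).
    have := cmod_ge0 (s - q); have := cmod_ge0 (p - s); lra.
  have hd3 : cmod (mid q s - p) <= tper p q s.
    have -> : mid q s - p = (q - p) / 2 + (s - p) / 2 by rewrite /mid; field.
    apply: le_trans (cmodD _ _) _; rewrite !cmod_half /tper (cmodC s p).
    have := cmod_ge0 (q - p); have := cmod_ge0 (s - q); have := cmod_ge0 (p - s); lra.
  apply: contrapT => H; apply: nP; apply: Psub => //; apply: contrapT => nP; apply: H.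
  - by exists (p, mid p q, mid p s); split; rewrite //= subrr cmod0 tper_ge0.
  - by exists (mid p q, q, mid q s); split.
  - by exists (mid p s, mid q s, s); split.
  - by exists (mid q s, mid p s, mid p q); split.
pose good T T' := [/\ bad T', per T' = per T / 2 & cmod (T'.1.1 - T.1.1) <= per T].
pose next T := xget T (good T).
have nextP T : bad T -> [/\ bad (next T), per (next T) = per T / 2 &
    cmod ((next T).1.1 - T.1.1) <= per T].
  by move=> /step[T' hT']; exact: (@xgetI _ T (good T) T' hT').
pose T n := iter n next (p0, q0, s0).
have badT n : bad (T n) by elim: n => [|n /nextP[]//]; split.
have perT n : per (T n) = per (T 0%N) / 2 ^+ n.
  elim: n => [|n IH]; first by rewrite expr0 divr1.
  have [_ -> _] := nextP _ (badT n); rewrite IH exprS.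
  by field; rewrite gt_eqF // exprn_gt0.
have [z Hz] := @complex_lim_geom (fun n => (T n).1.1) (per (T 0%N))
  ltac:(by move=> n; rewrite -perT; have [] := nextP _ (badT n)).
have Xz : X z.
  apply: clX => e e0; have [n hn] := geom_small (4 * per (T 0%N)) e0.
  by exists (T n).1.1; [have [] := badT n | exact: le_lt_trans (Hz n) hn].
have [d d0 Hd] := Ploc z Xz.
have [n hn] := geom_small (per (T 0%N)) d0.
have [Xp Xq Xs] := badT n; apply; apply: Hd => //; rewrite -/(per _) perT //.
by rewrite mulrA; exact: Hz.
Qed.

Definition vanishing (u : nat -> C) :=
  forall e, 0 < e -> exists n0, forall n, (n0 <= n)%N -> cmod (u n) <= e.

Lemma vanishingD u v : vanishing u -> vanishing v -> vanishing (fun n => u n + v n).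
Proof.
move=> hu hv e e0; have [n1 h1] := hu (e / 2) ltac:(lra).
have [n2 h2] := hv (e / 2) ltac:(lra).
exists (maxn n1 n2) => n; rewrite geq_max => /andP[/h1 ? /h2 ?].
by have := cmodD (u n) (v n); lra.
Qed.

(** The bound [e * tper ^+ 2] is inherited from the four halves, since each contributes a quarter of
    it, and it holds for small triangles by affine approximation. *)
Lemma goursat X f p q s : mconv X -> cclosed X -> (forall z, X z -> cdiff f z) ->
  X p -> X q -> X s -> vanishing (fun n => tsum n f p q s).
Proof.
move=> cX clX df Xp Xq Xs e0 e0_gt0.
have t1 : 0 < 1 + tper p q s ^+ 2 by rewrite ltr_pwDl // sqr_ge0.
pose e := e0 / (1 + tper p q s ^+ 2).
have e_gt0 : 0 < e by rewrite divr_gt0.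
suff [n0 Hn0] : exists n0, forall n, (n0 <= n)%N ->
    cmod (tsum n f p q s) <= e * tper p q s ^+ 2.
  exists n0 => n /Hn0 h; apply: le_trans h _.
  by rewrite /e mulrAC ler_pdivrMr // ler_wpM2l ?lerDr // ltW.
move: p q s Xp Xq Xs {t1} @e e_gt0 => p1 q1 s1 Xp1 Xq1 Xs1 e e_gt0.
pose P p q s := exists n0, forall n, (n0 <= n)%N ->
    cmod (tsum n f p q s) <= e * tper p q s ^+ 2.
apply: (@triangle_bisection X P) => //.
- move=> p q s Xp Xq Xs [n1 h1] [n2 h2] [n3 h3] [n4 h4].
  exists (maxn (maxn n1 n2) (maxn n3 n4)).+1 => -[//|n].
  rewrite ltnS !geq_max => /andP[/andP[/h1 {}h1 /h2 {}h2] /andP[/h3 {}h3 /h4 {}h4]].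
  have [e1 e2 e3 e4] := tper_sub p q s.
  rewrite tsumS; move: h1 h2 h3 h4; rewrite e1 e2 e3 e4.
  set A := tsum _ _ _ _ _; set B := tsum _ _ _ _ _; set D := tsum _ _ _ _ _.
  set E := tsum _ _ _ _ _; set L := tper _ _ _.
  have -> : e * (L / 2) ^+ 2 = e * L ^+ 2 / 4 by field.
  have := cmodD (A + B + D) E; have := cmodD (A + B) D; have := cmodD A B; lra.
- move=> z Xz; have [l /has_cderivP/(_ (e / 5))] := df z Xz.
  case=> [|d d0 Hd]; first lra.
  exists (d / 5) => [|p q s Xp Xq Xs pz Ld]; first lra.
  exists 0%N => n _.
  have L0 := tper_ge0 p q s; set L := tper p q s in pz Ld L0 *.
  (* After the exact affine part is subtracted, the remainder is at most [e / 5] times the distance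
     to [z]. The vertices lie within [4 * L + L] of [z], whence the factors 5. *)
  have -> : tsum n f p q s = tsum n (fun w => f w - (f z - l * z + l * w)) p q s.
    by rewrite /tsum !msumB !msum_affine; field.
  have -> : e * L ^+ 2 = (e / 5 * (5 * L)) * L by field.
  apply: (@tsum_bound (fun w => X w /\ cmod (w - z) <= 5 * L)).
  + by apply: mconvI => //; exact: mconv_ball.
  + by split=> //; lra.
  + split=> //; have := cmod_dist q p z; move: pz Ld; rewrite /L /tper.
    have := cmod_ge0 (s - q); have := cmod_ge0 (p - s); lra.
  + split=> //; have := cmod_dist s p z; rewrite (cmodC s p); move: pz Ld.
    rewrite /L /tper; have := cmod_ge0 (s - q); have := cmod_ge0 (q - p); lra.
  + move=> w [Xw wz]; have := Hd w ltac:(lra).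
    have -> : f w - (f z - l * z + l * w) = f w - f z - l * (w - z) by ring.
    move=> h; apply: le_trans h _; rewrite ler_wpM2l //; lra.
Qed.

(** The integrand is only bounded near the vertex [a]. Cutting off smaller and smaller corners at
    [a] leaves triangles to which [goursat] applies, while a corner contributes at most [M] times
    its perimeter. The affine functional [v] certifies that the remaining triangles avoid [a]: it
    vanishes there and is bounded below on them. *)
Lemma goursat_vertex X k a p q d M (v : C -> R) : mconv X -> cclosed X ->
  X a -> X p -> X q -> 0 < d ->
  (forall z, X z -> z != a -> cdiff k z) ->
  (forall z, cmod (z - a) <= d -> cmod (k z) <= M) ->
  v a = 0 -> (forall z w, v (mid z w) = (v z + v w) / 2) ->
  (forall e, 0 < e -> exists2 d', 0 < d' &
     forall z w, cmod (z - w) < d' -> `|v z - v w| <= e) ->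
  0 < v p -> 0 < v q ->
  vanishing (fun n => tsum n k a p q).
Proof.
move=> cX clX Xa Xp Xq d0 dk kM va vmid vcont vp vq.
have M0 : 0 <= M by apply: le_trans (cmod_ge0 (k a)) (kM a _); rewrite subrr cmod0 ltW.
(* Here [j] counts the corner cuts. It is chosen so large that the last corner lies in the disc
   where [k] is bounded and its contribution is below [e / 2]. *)
suff H : forall j e, 0 < e -> forall p q, X p -> X q -> 0 < v p -> 0 < v q ->
    tper a p q < 2 ^+ j * d -> exists n0, forall n, (n0 <= n)%N ->
      cmod (tsum n k a p q) <= e + M * tper a p q / 2 ^+ j.
  move=> e e0; have [j1 hj1] := geom_small (tper a p q) d0.
  have [j2 hj2] := geom_small (M * tper a p q) (e := e / 2) ltac:(lra).
  have h1 (x : R) (i j : nat) : 0 <= x -> (i <= j)%N -> x / 2 ^+ j <= x / 2 ^+ i.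
    by move=> x0 ij; rewrite ler_wpM2l // lef_pV2 ?posrE ?exprn_gt0 // ler_eXn2l ?ler1n //; lra.
  pose j := maxn j1 j2.
  have [|n0 Hn0] := H j (e / 2) ltac:(lra) p q Xp Xq vp vq.
    rewrite mulrC -ltr_pdivrMr ?exprn_gt0 //; apply: le_lt_trans hj1.
    by apply: h1; [exact: tper_ge0 | exact: leq_maxl].
  exists n0 => n /Hn0 h.
  have := h1 (M * tper a p q) j2 j ltac:(by rewrite mulr_ge0 ?tper_ge0) (leq_maxr _ _).
  lra.
elim=> [|j IH] e e0 {}p {}q {}Xp {}Xq {}vp {}vq hd.
  exists 0%N => n _; move: hd; rewrite expr0 mul1r divr1 => hd.
  suff : cmod (tsum n k a p q) <= M * tper a p q by lra.
  apply: (@tsum_bound (fun z => cmod (z - a) <= d)) => //; first exact: mconv_ball.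
  - by rewrite subrr cmod0 ltW.
  - by move: hd; rewrite /tper; have := cmod_ge0 (q - p); have := cmod_ge0 (a - q); lra.
  - move: hd; rewrite /tper (cmodC a q); have := cmod_ge0 (q - p).
    have := cmod_ge0 (p - a); lra.
(* The smallest values of [v] at the vertices of the three outer triangles occur at the midpoints
   towards [a], where [v] is halved. *)
pose c := Num.min (v p) (v q) / 2.
have c0 : 0 < c by rewrite divr_gt0 // lt_min vp.
have [cp cq] : c <= v p / 2 /\ c <= v q / 2.
  by split; rewrite ler_wpM2r // ge_min lexx ?orbT.
pose Y z := X z /\ c <= v z.
have cY : mconv Y.
  by apply: mconvI => // z w hz hw; rewrite vmid; lra.
have clY : cclosed Y.
  apply: cclosedI => // z H; apply/ler_addgt0Pr => r r0.
  have [d' d'0 Hd'] := vcont r r0; have [w hw hwz] := H d' d'0.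
  by have := Hd' w z hwz; rewrite ler_norml => /andP[]; lra.
have dY z : Y z -> cdiff k z.
  move=> [Xz vz]; apply: dk => //; apply/eqP => E; move: vz; rewrite E va; lra.
have Yp : Y p by split=> //; lra.
have Yq : Y q by split=> //; lra.
have Yap : Y (mid a p) by split; [exact: cX | rewrite vmid va; lra].
have Yaq : Y (mid a q) by split; [exact: cX | rewrite vmid va; lra].
have Ypq : Y (mid p q) by exact: cY.
have [n1 h1] := goursat cY clY dY Yap Yp Ypq (e := e / 6) ltac:(lra).
have [n2 h2] := goursat cY clY dY Yaq Ypq Yq (e := e / 6) ltac:(lra).
have [n3 h3] := goursat cY clY dY Ypq Yaq Yap (e := e / 6) ltac:(lra).
have [e1 _ _ _] := tper_sub a p q.
have [|||n4 h4] := IH (e / 2) ltac:(lra) _ _ (proj1 Yap) (proj1 Yaq).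
- by rewrite vmid va; lra.
- by rewrite vmid va; lra.
- by rewrite e1; move: hd; rewrite exprS; lra.
exists (maxn (maxn n1 n2) (maxn n3 n4)).+1 => -[//|n].
rewrite ltnS !geq_max => /andP[/andP[/h1 {}h1 /h2 {}h2] /andP[/h3 {}h3 /h4]].
rewrite e1 tsumS.
have -> : M * (tper a p q / 2) / 2 ^+ j = M * tper a p q / 2 ^+ j.+1.
  by rewrite exprS; field; rewrite gt_eqF // exprn_gt0.
set A := tsum _ _ a _ _; set B := tsum _ _ _ p _ in h1 *.
set D := tsum _ _ _ _ q in h2 *; set E := tsum _ _ _ _ _ in h3 *.
have := cmodD (A + B + D) E; have := cmodD (A + B) D; have := cmodD A B; lra.
Qed.

End Goursat.

(** * Cauchy's estimate on polygons and the maximum principle *)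

Section MaximumPrinciple.
Variable R : realType.
Local Notation C := R[i].
Implicit Types (f g k : C -> C) (z w a b : C) (r d e M : R).

(** Square roots are extracted repeatedly from ['i] by the half-angle formulas; each one at least
    halves [2 - 2 * Re u], which is the square of [cmod (u - 1)]. The last clause, a consequence of
    [Im u ^ 2 = D ^ 2 * (1 - D ^ 2 / 4)] with [D = cmod (u - 1)], ensures that interior points lie
    on the inner side of all edges of the polygon. *)
Lemma unity_root_near e : 0 < e -> exists N (u : C),
  [/\ (0 < N)%N, u ^+ N = 1, cmod u = 1, 0 < cmod (u - 1) < e &
      cmod (u - 1) * (1 - cmod (u - 1)) <= complex.Im u].
Proof.
move=> e0.
have step m : exists N (u : C), [/\ (0 < N)%N, u ^+ N = 1,
    complex.Re u ^+ 2 + complex.Im u ^+ 2 = 1,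
    0 <= complex.Re u /\ 0 < complex.Im u & 2 - 2 * complex.Re u <= 2 / 2 ^+ m].
  elim: m => [|m [N [u [N0 uN u1 [x0 y0] hu]]]].
    exists 4%N, 'i; split => //=; last by rewrite expr0; lra.
      by rewrite (exprM _ 2 2) sqr_i sqrrN expr1n.
    by rewrite expr0n expr1n add0r.
  set x := complex.Re u in u1 x0 hu *; set y := complex.Im u in u1 y0 *.
  have x1 : x < 1 by rewrite -subr_gt0; nra.
  pose x' := Num.sqrt ((1 + x) / 2); pose y' := Num.sqrt ((1 - x) / 2).
  have xx : x' ^+ 2 = (1 + x) / 2 by rewrite sqr_sqrtr //; lra.
  have yy : y' ^+ 2 = (1 - x) / 2 by rewrite sqr_sqrtr //; lra.
  have y'0 : 0 < y' by rewrite sqrtr_gt0; lra.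
  have x'0 : 0 < x' by rewrite sqrtr_gt0; lra.
  have xy : 2 * (x' * y') = y.
    have h : (2 * (x' * y')) ^+ 2 = y ^+ 2 by rewrite !exprMn xx yy; nra.
    by move/eqP: h; rewrite eqrXn2 // ?mulr_ge0 ?ltW // => /eqP.
  exists (2 * N)%N, (x' +i* y'); split => /=; rewrite ?muln_gt0 //; last 2 first.
  - by split=> //; exact: ltW.
  - have -> : 2 / 2 ^+ m.+1 = 2 / 2 ^+ m / 2 :> R.
      by rewrite exprS; field; rewrite gt_eqF // exprn_gt0.
    have : x' <= 1 by rewrite -subr_ge0; nra.
    nra.
  - rewrite exprM (_ : _ ^+ 2 = u) //; apply: eqC; rewrite expr2 ?ReM ?ImM /=.
    + by rewrite -!expr2 xx yy -/x; field.
    + by rewrite -/y -xy; ring.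
  - by rewrite xx yy; field.
have [m hm] := geom_small (2 : R) (e := e ^+ 2) ltac:(by rewrite exprn_gt0).
have [N [u [N0 uN u1 [x0 y0] hu]]] := step m.
exists N, u.
have d2 : cmod (u - 1) ^+ 2 = 2 - 2 * complex.Re u.
  rewrite cmod_sqr ReD ImD ReN ImN /= oppr0 addr0; nra.
have d0 : 0 < cmod (u - 1).
  rewrite cmod_gt0 subr_eq0; apply/eqP => E; move: y0; rewrite E /=; lra.
split=> //.
- by apply/eqP; rewrite -(eqrXn2 (n := 2)) ?cmod_ge0 // cmod_sqr u1 expr1n.
- rewrite d0 /= -(ltr_pXn2r (n := 2)) ?nnegrE ?cmod_ge0 ?ltW // d2.
  exact: le_lt_trans hu hm.
- set D := cmod (u - 1) in d0 d2 *.
  have [D1|D1] := lerP 1 D; first by have := ltW y0; nra.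
  rewrite -(ler_pXn2r (n := 2)) ?nnegrE ?(ltW y0) //; last by rewrite mulr_ge0 //; lra.
  have E : complex.Im u ^+ 2 = D ^+ 2 * (1 - D ^+ 2 / 4) by rewrite d2; lra.
  rewrite E exprMn ler_wpM2l ?sqr_ge0 //; nra.
Qed.

(** Neighbouring triangles share a spoke from [a], traversed in opposite directions; in the closed
    polygon all spokes cancel. *)
Lemma fan_sum n k a (v : nat -> C) N : v N = v 0%N ->
  \sum_(0 <= j < N) tsum n k a (v j) (v j.+1) = \sum_(0 <= j < N) msum n k (v j) (v j.+1).
Proof.
move=> vN; rewrite /tsum.
rewrite (eq_bigr (fun j => msum n k (v j) (v j.+1) -
   (msum n k a (v j.+1) - msum n k a (v j)))); last first.
  by move=> j _; rewrite (msumN n k a (v j.+1)); ring.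
by rewrite sumrB telescope_sumr // vN subrr subr0.
Qed.

Lemma vanishing_sum (u : nat -> nat -> C) N : (forall j, vanishing (u j)) ->
  vanishing (fun n => \sum_(0 <= j < N) u j n).
Proof.
move=> H; elim: N => [|N IH] e e0.
  by exists 0%N => n _; rewrite big_geq // cmod0 ltW.
have [n0 h] := vanishingD IH (H N) e0; exists n0 => n /h.
by rewrite big_nat_recr.
Qed.

Lemma Im_inv_mul (x y : C) : x != 0 ->
  complex.Im (x^-1 * y) = complex.Im (y * cj x) / cmod x ^+ 2.
Proof.
move=> x0; have c0 : cmod x ^+ 2 != 0 by rewrite expf_eq0 /= cmod_eq0.
apply: (mulIf c0); rewrite mulfVK //.
have -> : y * cj x = x^-1 * y * (x * cj x) by field.
by rewrite mul_cj [RHS]ImM /= mulr0 add0r.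
Qed.

(* Cauchy's formula for [f a] over a regular polygon inscribed in [|z| = r], kept only as an
   inequality whose constant does not depend on [f]. *)
Lemma polygon_bound r N (u a : C) : 0 < r -> (0 < N)%N -> u ^+ N = 1 -> cmod u = 1 ->
  0 < cmod (u - 1) ->
  cmod a < r * (1 - cmod (u - 1)) -> cmod a * cmod (u - 1) < r * complex.Im u ->
  exists2 K, 0 <= K & forall f M,
    (forall z, cmod z <= r -> cdiff f z) ->
    (forall z, r * (1 - cmod (u - 1)) <= cmod z <= r -> cmod (f z) <= M) ->
    cmod (f a) <= K * M.
Proof.
move=> r0 N0 uN u1 d0 hg hchi.
set d := cmod (u - 1) in d0 hg hchi *.
pose v j : C := r%:C * u ^+ j.
have vr j : cmod (v j) = r by rewrite cmodM cmodX u1 expr1n mulr1 cmodR gtr0_norm.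
have vS j : v j.+1 - v j = (u - 1) * v j by rewrite /v exprS; ring.
have vSd j : cmod (v j.+1 - v j) = r * d by rewrite vS cmodM vr mulrC.
(* A lower bound for the distance from [a] to the edges: an edge has length [r * d] and its ends
   have modulus [r], so it stays outside the disc of radius [r * (1 - d)]. *)
pose g := r * (1 - d) - cmod a.
have g0 : 0 < g by rewrite /g; lra.
pose chi := r * (r * complex.Im u - cmod a * d).
have chi0 : 0 < chi by rewrite mulr_gt0 // subr_gt0.
(* A real affine functional that vanishes at [a] and is constant on the line of the [j]-th edge,
   with value at least [chi] there. It is both the [v] of [goursat_vertex] and the numerator of the
   imaginary part of [(v j.+1 - v j) / (z - a)]. *)
pose lf j z := complex.Im ((v j.+1 - v j) * cj (z - a)).
have lf0 j : chi <= lf j (v j).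
  rewrite /lf cjB mulrBr vS ImD ImN.
  have -> : complex.Im ((u - 1) * v j * cj (v j)) = r ^+ 2 * complex.Im u.
    by rewrite -mulrA mul_cj vr ImM /= mulr0 add0r ImD ImN /= oppr0 addr0 mulrC.
  have := le_trans (ler_norm _) (Im_le_cmod ((u - 1) * v j * cj a)).
  rewrite 2!cmodM cmod_cj vr -/d /chi; nra.
have lf1 j : lf j (v j.+1) = lf j (v j).
  rewrite /lf (_ : v j.+1 - a = (v j.+1 - v j) + (v j - a)); last by ring.
  by rewrite cjD mulrDr ImD mul_cj /= add0r.
have a_r : cmod a < r by nra.
(* Each edge contributes at least [chi / (2 * r) ^+ 2] to the imaginary part of the winding sum, as
   points of the disc are at most [2 * r] from [a]. *)
pose c := N%:R * (chi / (2 * r) ^+ 2).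
have c0 : 0 < c by rewrite mulr_gt0 ?ltr0n // divr_gt0 // exprn_gt0 // mulr_gt0.
exists (N%:R * (r * d / g) / c).
  by rewrite divr_ge0 ?(ltW c0) // mulr_ge0 // divr_ge0 ?(ltW g0) // mulr_ge0 // ltW.
move=> f M df fM.
pose k z := (f z - f a) / (z - a).
have [l Hl] := df a (ltW a_r).
have [d1 d10 Hd1] := (has_cderivP f a l).1 Hl 1 ltr01.
have kb z : cmod (z - a) <= d1 / 2 -> cmod (k z) <= 1 + cmod l.
  move=> zd; have [->|za] := eqVneq z a.
    by rewrite /k !subrr mul0r cmod0; have := cmod_ge0 l; lra.
  have za0 : 0 < cmod (z - a) by rewrite cmod_gt0 subr_eq0.
  rewrite /k cmod_div ler_pdivrMr //.
  have := Hd1 z ltac:(lra); have := cmodD (f z - f a - l * (z - a)) (l * (z - a)).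
  by rewrite subrK cmodM; lra.
pose X z := cmod (z - 0) <= r.
have van j : vanishing (fun n => tsum n k a (v j) (v j.+1)).
  apply: (@goursat_vertex _ X k a _ _ (d1 / 2) (1 + cmod l) (lf j)); rewrite /X ?subr0 ?vr //.
  - exact: mconv_ball.
  - exact: cclosed_ball.
  - exact: ltW.
  - by lra.
  - move=> z; rewrite subr0 => zr za; apply: cdiff_div.
    + by rewrite subr_eq0.
    + by apply: cdiffB (cdiff_cst _ _); exact: df.
    + exact: cdiffB (cdiff_id _) (cdiff_cst _ _).
  - by rewrite /lf subrr cj0 mulr0.
  - move=> z w; rewrite /lf mid_sub.
    case: (z - a) (w - a) (v j.+1 - v j) => [x1 y1] [x2 y2] [x3 y3].
    have -> : 2^-1 = 2^-1%:C :> C by rewrite fmorphV rmorph_nat.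
    by rewrite /=; field.
  - move=> e e0; exists (e / (r * d)); first by rewrite divr_gt0 // mulr_gt0.
    move=> z w; rewrite ltr_pdivlMr ?mulr_gt0 // => h.
    rewrite /lf -ImN -ImD -mulrBr -cjB opprB addrA subrK.
    apply: le_trans (Im_le_cmod _) _; rewrite cmodM cmod_cj vSd; lra.
  - exact: lt_le_trans chi0 (lf0 j).
  - by rewrite lf1; exact: lt_le_trans chi0 (lf0 j).
have vN : v N = v 0%N by rewrite /v uN expr0.
pose S1 n := \sum_(0 <= j < N) msum n (fun z => f z / (z - a)) (v j) (v j.+1).
pose S2 n := \sum_(0 <= j < N) msum n (fun z => (z - a)^-1) (v j) (v j.+1).
(* The left side vanishes in the limit, so [f a] is approximately [S1 / S2]: Cauchy's formula with
   the winding sum [S2] bounded below instead of evaluated. *)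
have SE n : \sum_(0 <= j < N) tsum n k a (v j) (v j.+1) = S1 n - f a * S2 n.
  rewrite fan_sum // /S1 /S2 mulr_sumr -sumrB; apply: eq_bigr => j _.
  rewrite -msumZ -msumB; apply: (@eq_msum _ _ (fun=> True)) => // z _.
  by rewrite /k mulrBl.
have S1b n : cmod (S1 n) <= N%:R * (M / g * (r * d)).
  apply: le_trans (cmod_sum _ _) _.
  apply: (@le_trans _ _ (\sum_(0 <= j < N) (M / g * (r * d)))).
    apply: ler_sum => j _; rewrite -(vSd j).
    apply: (@msum_bound _ (fun z => cmod (z - 0) <= r /\ cmod (z - v j) <= r * d)).
    - by apply: mconvI; exact: mconv_ball.
    - by rewrite subr0 vr subrr cmod0 lexx mulr_ge0 // ltW.
    - by rewrite subr0 vr vSd !lexx.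
    - move=> z; rewrite subr0 => -[zr zv].
      have zg : r * (1 - d) <= cmod z.
        by have := cmod_leB (v j) z; rewrite vr cmodC; lra.
      have zga : g <= cmod (z - a) by have := cmod_leB z a; rewrite /g; lra.
      rewrite cmod_div; apply: ler_pM; rewrite ?invr_ge0 ?cmod_ge0 //.
        by apply: fM; rewrite zg.
      by rewrite lef_pV2 // posrE; lra.
  by rewrite sumr_const_nat subn0 mulr_natl.
have S2b n : c <= cmod (S2 n).
  apply: le_trans (le_trans (ler_norm _) (Im_le_cmod _)).
  rewrite /S2; have -> : complex.Im (\sum_(0 <= j < N) msum n (fun z => (z - a)^-1) (v j) (v j.+1))
     = \sum_(0 <= j < N) complex.Im (msum n (fun z => (z - a)^-1) (v j) (v j.+1)).
    by elim/big_rec2: _ => [//|i x y _ <-]; rewrite ImD.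
  rewrite /c mulr_natl -[N in X in X <= _]subn0 -sumr_const_nat; apply: ler_sum => j _.
  rewrite -[X in X <= _]mul1r.
  apply: (@msum_Im_ge _ (fun z => cmod (z - 0) <= r /\ lf j z = lf j (v j)) _ _ _ _
     (v j.+1 - v j)).
  - apply: mconvI; first exact: mconv_ball.
    move=> z w; rewrite /lf mid_sub.
    case: (z - a) (w - a) (v j.+1 - v j) => [x1 y1] [x2 y2] [x3 y3].
    have -> : 2^-1 = 2^-1%:C :> C by rewrite fmorphV rmorph_nat.
    rewrite /= => h1 h2.
    by apply: (@eq_trans _ _ ((x3 * - y1 + y3 * x1 + (x3 * - y2 + y3 * x2)) / 2));
      [field | rewrite h1 h2; field].
  - by rewrite subr0 vr lexx.
  - by rewrite subr0 vr lexx lf1.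
  - move=> z; rewrite subr0 => -[zr zl].
    have l0 : 0 < lf j z by rewrite zl; exact: lt_le_trans chi0 (lf0 j).
    have za : z - a != 0.
      by apply/eqP => E; move: l0; rewrite /lf E cj0 mulr0 /= ltxx.
    rewrite Im_inv_mul // -/(lf j z); apply: ler_pM; rewrite ?invr_ge0 ?sqr_ge0 //.
    + exact: ltW.
    + by rewrite zl; exact: lf0.
    + rewrite lef_pV2 ?posrE ?exprn_gt0 ?mulr_gt0 ?cmod_gt0 //.
      rewrite ler_pXn2r ?nnegrE ?cmod_ge0 ?mulr_ge0 ?ltW //.
      by apply: le_lt_trans (cmodB _ _) _; lra.
  - exact: ler01.
  - by rewrite mul1r.
rewrite mulrAC ler_pdivlMr //.
apply/ler_addgt0Pr => e e0.
have [n0 Hn0] := vanishing_sum N van e0.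
have := Hn0 n0 (leqnn _); rewrite SE => h.
have := cmodB (S1 n0) (S1 n0 - f a * S2 n0); rewrite subKr cmodM.
have := S1b n0; have := S2b n0; have := cmod_ge0 (f a).
have -> : N%:R * (M / g * (r * d)) = N%:R * (r * d / g) * M by field; rewrite gt_eqF.
nra.
Qed.

Lemma bernoulli (x : R) n : 0 <= x -> 1 + n%:R * x <= (1 + x) ^+ n.
Proof.
move=> x0; elim: n => [|n IH]; first by rewrite mul0r addr0 expr0.
rewrite exprS -natr1; have : 0 <= n%:R * x * x by rewrite !mulr_ge0.
have : 0 <= 1 + x by lra.
nra.
Qed.

Lemma le_of_powers (x y K : R) : 0 <= y -> (forall n, x ^+ n <= K * y ^+ n) -> x <= y.
Proof.
move=> y0 H; rewrite leNgt; apply/negP => xy.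
have [y1|yn] := eqVneq y 0.
  by have := H 1%N; rewrite y1 !expr1 mulr0; lra.
have {yn} y0' : 0 < y by rewrite lt0r yn.
pose t := x / y - 1.
have t0 : 0 < t by rewrite subr_gt0 ltr_pdivlMr // mul1r.
have Ht n : n%:R * t <= K.
  have : (x / y) ^+ n <= K by rewrite expr_div_n ler_pdivrMr ?exprn_gt0.
  have -> : x / y = 1 + t by rewrite /t; lra.
  by have := bernoulli n (ltW t0); lra.
have := archi_boundP (normr_ge0 (K / t)); set n := Num.bound _ => h.
have := Ht n; rewrite leNgt => /negP; apply.
by rewrite -ltr_pdivrMr //; exact: le_lt_trans (ler_norm _) h.
Qed.

(* Landau's trick: the crude bound applied to all powers of [f] has constant 1 in the limit. *)
Lemma ring_max f r1 r2 M : r1 < r2 -> 0 < r2 ->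
  (forall z, cmod z <= r2 -> cdiff f z) ->
  (forall z, r1 <= cmod z <= r2 -> cmod (f z) <= M) ->
  forall a, cmod a <= r2 -> cmod (f a) <= M.
Proof.
move=> r12 r20 df fM a ar; have [h|ar1] := lerP r1 (cmod a); first by apply: fM; rewrite h.
(* Edges of the polygon on the outer circle then stay beyond radius [(r1 + r2) / 2], inside the
   ring, while [a] has modulus less than [r1]. *)
pose e := (r2 - r1) / (2 * r2).
have e0 : 0 < e by rewrite divr_gt0 ?mulr_gt0 // subr_gt0.
have er : e * r2 = (r2 - r1) / 2 by rewrite /e; field; rewrite gt_eqF.
have [N [u [N0 uN u1 /andP[d0 de] hu]]] := unity_root_near e0.
set d := cmod (u - 1) in d0 de hu.
have hr : r1 < r2 * (1 - d) by nra.
have [|||K K0 HK] := @polygon_bound r2 N u a r20 N0 uN u1 => //.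
- by rewrite -/d; lra.
- by rewrite -/d; nra.
have M0 : 0 <= M.
  apply: le_trans (cmod_ge0 (f r2%:C)) _; apply: fM.
  by rewrite cmodR gtr0_norm // lexx ltW.
apply: (@le_of_powers _ _ K) => // n; rewrite -cmodX.
apply: (HK (fun z => f z ^+ n)) => [z /df/cdiffX//|z /andP[z1 z2]].
rewrite cmodX lerXn2r ?nnegrE ?cmod_ge0 //; apply: fM; rewrite z2 andbT.
by apply: le_trans (ltW hr) z1.
Qed.

End MaximumPrinciple.

(** * Schwarz lemma, Cauchy estimates, differentiability of derivatives and divided differences *)

Section Regularity.
Variable R : realType.
Local Notation C := R[i].
Implicit Types (f g k : C -> C) (z w a b h t : C) (r s d e M : R).

(** The maximum principle cannot yet be applied to [f z / z], whose singularity at 0 has not been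
    removed. It is applied to [z ^+ 2 * (f z / z) ^+ n], which has derivative 0 at the origin
    because the quotient is bounded there; the cost [r2 ^+ 2 / cmod b ^+ 2] does not depend on [n]
    and disappears in [le_of_powers]. *)
Lemma schwarz_ring f r1 r2 M : 0 < r1 < r2 ->
  (forall z, cmod z <= r2 -> cdiff f z) -> f 0 = 0 ->
  (forall z, r1 <= cmod z <= r2 -> cmod (f z) <= M) ->
  forall b, cmod b <= r2 -> cmod (f b) <= M / r1 * cmod b.
Proof.
move=> /andP[r10 r12] df f0 fM b br.
have [->|b0] := eqVneq b 0; first by rewrite f0 cmod0 mulr0.
have cb : 0 < cmod b by rewrite cmod_gt0.
have M0 : 0 <= M.
  apply: le_trans (cmod_ge0 (f r1%:C)) _; apply: fM.
  by rewrite cmodR gtr0_norm // lexx ltW.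
rewrite -ler_pdivrMr // -cmod_div.
apply: (@le_of_powers _ _ _ (r2 ^+ 2 / cmod b ^+ 2)); first by rewrite divr_ge0 // ltW.
move=> n; rewrite mulrAC ler_pdivlMr ?exprn_gt0 // -!cmodX mulrC -cmodM.
apply: (@ring_max _ (fun z => z ^+ 2 * (f z / z) ^+ n) r1 r2) => //; first lra.
- move=> z zr; have [->|z0] := eqVneq z 0; last first.
    apply: cdiffM; first exact: cdiffX (cdiff_id _).
    by apply: cdiffX; apply: cdiff_div => //; [exact: df | exact: cdiff_id].
  have [l /has_cderivP/(_ 1 ltr01)[d d0 Hd]] := df 0 ltac:(rewrite cmod0; lra).
  exists 0; apply/has_cderivP => e e0.
  pose K := (1 + cmod l) ^+ n.
  have K0 : 0 < K by rewrite exprn_gt0 // ltr_pwDl // cmod_ge0.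
  exists (Num.min d (e / K)); first by rewrite lt_min d0 divr_gt0.
  move=> w; rewrite lt_min subr0 => /andP[wd we].
  rewrite mul0r subr0 expr0n mul0r subr0.
  have [->|w0] := eqVneq w 0; first by rewrite expr0n mul0r cmod0 mulr0.
  have wc : 0 < cmod w by rewrite cmod_gt0.
  rewrite cmodM !cmodX.
  have hq : cmod (f w / w) ^+ n <= K.
    rewrite /K lerXn2r ?nnegrE ?cmod_ge0 ?addr_ge0 ?cmod_ge0 //.
    rewrite cmod_div ler_pdivrMr //.
    have := Hd w; rewrite subr0 f0 subr0 => /(_ wd).
    by have := cmodD (f w - l * w) (l * w); rewrite subrK cmodM; lra.
  move: we; rewrite ltr_pdivlMr // => we.
  have := ler_wpM2l (sqr_ge0 (cmod w)) hq.
  by rewrite expr2; nra.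
- move=> z /andP[z1 z2]; rewrite cmodM !cmodX; apply: ler_pM; rewrite ?exprn_ge0 ?cmod_ge0 //.
    by rewrite lerXn2r ?nnegrE ?cmod_ge0 //; lra.
  rewrite lerXn2r ?nnegrE ?cmod_ge0 ?divr_ge0 //; first exact: ltW.
  rewrite cmod_div; apply: ler_pM; rewrite ?invr_ge0 ?cmod_ge0 //.
    by apply: fM; rewrite z1.
  by rewrite lef_pV2 ?posrE //; lra.
Qed.

(** Schwarz's lemma for [f - f a], of modulus at most [2 * M], on the ring between [s / 2] and
    [s]. *)
Lemma lipschitz_center f a s M : 0 < s ->
  (forall z, cmod (z - a) <= s -> cdiff f z) ->
  (forall z, cmod (z - a) <= s -> cmod (f z) <= M) ->
  forall b, cmod (b - a) <= s -> cmod (f b - f a) <= 4 * M / s * cmod (b - a).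
Proof.
move=> s0 df fM b bs.
have -> : 4 * M / s = (M + M) / (s / 2) by field; rewrite gt_eqF.
have := @schwarz_ring (fun z => f (z + a) - f a) (s / 2) s (M + M) ltac:(lra).
move=> /(_ _ _ _ (b - a) bs); rewrite subrK; apply => [z zs||z /andP[_ zs]].
- by apply: cdiffB (cdiff_cst _ _); apply: cdiff_shift; apply: df; rewrite addrK.
- by rewrite add0r subrr.
- apply: le_trans (cmodB _ _) (lerD (fM _ _) (fM _ _)); rewrite ?addrK //.
  by rewrite subrr cmod0 ltW.
Qed.

Lemma has_cderiv_small f a l e : has_cderiv f a l -> 0 < e ->
  exists2 d, 0 < d & forall h, 0 < cmod h < d -> cmod ((f (a + h) - f a) / h - l) <= e.
Proof.
move=> H e0; have [d d0 Hd] := H e e0; exists d => // h hd.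
by have := Hd (a + h); rewrite (_ : a + h - a = h) => [/(_ hd)/ltW|]; last by ring.
Qed.

Lemma cder_bound f a s M : 0 < s ->
  (forall z, cmod (z - a) <= s -> cdiff f z) ->
  (forall z, cmod (z - a) <= s -> cmod (f z) <= M) -> cmod (cder f a) <= 4 * M / s.
Proof.
move=> s0 df fM; apply/ler_addgt0Pr => e e0.
have da : cdiff f a by apply: df; rewrite subrr cmod0 ltW.
have [d d0 Hd] := has_cderiv_small (cderP da) e0.
have m0 : 0 < Num.min d s by rewrite lt_min d0.
have [h h0] := cmod_ex_point 0 m0; rewrite subr0 lt_min => /andP[hd hs].
have hc : 0 < cmod h by rewrite cmod_gt0.
have := Hd h; rewrite hc hd => /(_ isT) h1.
have := @lipschitz_center f a s M s0 df fM (a + h).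
rewrite (_ : a + h - a = h); last by ring.
move=> /(_ (ltW hs)); rewrite -ler_pdivrMr // -cmod_div => h2.
have := cmodB ((f (a + h) - f a) / h) ((f (a + h) - f a) / h - cder f a).
rewrite subKr; lra.
Qed.

(** Telescoping along [h], [h / 2], [h / 4], ...: the increments are dominated by a geometric series
    of ratio 1/2, and the tail tends to 0. A comparison of two scales thus becomes a rate of
    convergence. *)
Lemma halving_bound (G : C -> C) s c m : (0 < m)%N -> 0 <= c ->
  (forall h, 0 < cmod h <= s -> cmod (G h) <= cmod (G (h / 2)) + c * cmod h ^+ m) ->
  (forall e, 0 < e -> exists2 d, 0 < d & forall h, 0 < cmod h < d -> cmod (G h) <= e) ->
  forall h, 0 < cmod h <= s -> cmod (G h) <= 2 * c * cmod h ^+ m.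
Proof.
move=> m0 c0 HG G0 h /andP[h0 hs].
have p2 n : 0 < 2 ^+ n :> R by rewrite exprn_gt0.
have hn n : cmod (h / 2 ^+ n) = cmod h / 2 ^+ n by rewrite cmod_div cmodX cmod_nat.
have p2' n : 1 <= 2 ^+ n :> R by rewrite -natrX ler1n expn_gt0.
have B n : cmod (G h) <= cmod (G (h / 2 ^+ n)) + 2 * c * cmod h ^+ m * (1 - (2 ^+ n)^-1).
  elim: n => [|n IH]; first by rewrite expr0 divr1 invr1 subrr mulr0 addr0.
  apply: le_trans IH _.
  have := HG (h / 2 ^+ n); rewrite hn divr_gt0 //= ler_pdivrMr //.
  have -> : cmod h <= s * 2 ^+ n.
    apply: (le_trans hs); have := le_trans (ltW h0) hs; have := p2' n; nra.
  have -> : h / 2 ^+ n / 2 = h / 2 ^+ n.+1.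
    by rewrite exprS; field; rewrite expf_neq0 // pnatr_eq0.
  move=> /(_ isT).
  have E : c * (cmod h / 2 ^+ n) ^+ m <= c * cmod h ^+ m / 2 ^+ n.
    rewrite expr_div_n mulrA ler_wpM2l ?mulr_ge0 ?exprn_ge0 ?cmod_ge0 //.
    rewrite lef_pV2 ?posrE ?exprn_gt0 // -exprM ler_weXn2l ?ler1n //.
    by rewrite leq_pmulr.
  have -> : (2 ^+ n.+1)^-1 = (2 ^+ n)^-1 / 2 :> R by rewrite exprS; field; rewrite gt_eqF.
  by move: E; set x := (2 ^+ n)^-1; lra.
apply/ler_addgt0Pr => e /G0[d d0 Hd].
have [n nd] := geom_small (cmod h) d0.
have := B n; have := Hd (h / 2 ^+ n); rewrite hn divr_gt0 //= nd => /(_ isT).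
have : 0 <= 2 * c * cmod h ^+ m * (2 ^+ n)^-1.
  by rewrite !mulr_ge0 ?exprn_ge0 ?cmod_ge0 ?invr_ge0 // ltW.
lra.
Qed.

(** For fixed [h] this is a differentiable function of [z], to which [lipschitz_center] applies
    again. Each application costs a factor [4 / s], the origin of [L1], [L2] and [L3] in the
    following section. *)
Definition dquo f h z := (f (z + h) - f z) / h.

Section LocalTaylor.
Variables (f : C -> C) (a : C) (s M : R).
Hypotheses (s0 : 0 < s) (df : forall z, cmod (z - a) <= 4 * s -> cdiff f z)
  (fM : forall z, cmod (z - a) <= 4 * s -> cmod (f z) <= M).

Variables (L1 L2 L3 : R).
Hypotheses (L1E : L1 * s = 4 * M) (L2E : L2 * s = 4 * L1) (L3E : L3 * s = 4 * L2).

Let M0 : 0 <= M.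
Proof. by apply: le_trans (cmod_ge0 (f a)) (fM _); rewrite subrr cmod0 mulr_ge0 // ltW. Qed.
Let L10 : 0 <= L1. Proof. by rewrite -(pmulr_lge0 _ s0) L1E mulr_ge0. Qed.
Let L20 : 0 <= L2. Proof. by rewrite -(pmulr_lge0 _ s0) L2E mulr_ge0. Qed.
Let L30 : 0 <= L3. Proof. by rewrite -(pmulr_lge0 _ s0) L3E mulr_ge0. Qed.

Let near z w (x y : R) : cmod (z - a) <= x -> cmod (w - z) <= y -> cmod (w - a) <= x + y.
Proof. by move=> h1 h2; have := cmod_dist w z a; lra. Qed.

Let shiftE z h : z + h - z = h. Proof. by ring. Qed.

Let dquo_diff h z : cmod h <= s -> cmod (z - a) <= 2 * s -> cdiff (dquo f h) z.
Proof.
have s0' := s0; have L20' := L20; have L30' := L30.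
move=> hs za; apply: cdiffM (cdiff_cst _ _); apply: cdiffB; last by apply: df; lra.
apply: cdiff_shift; apply: df; have := near za (w := z + h) (y := s).
by rewrite shiftE => /(_ hs); lra.
Qed.

Let dquo_bound h z : 0 < cmod h <= s -> cmod (z - a) <= 2 * s -> cmod (dquo f h z) <= L1.
Proof.
have s0' := s0; have L20' := L20; have L30' := L30.
move=> /andP[h0 hs] za; rewrite cmod_div ler_pdivrMr //.
have := @lipschitz_center f z s M s0; rewrite -L1E mulfK ?gt_eqF // => H.
have := H _ _ (z + h); rewrite shiftE; apply => // w wz.
  by apply: df; have := near za wz; lra.
by apply: fM; have := near za wz; lra.
Qed.

Let dquo_lip h z w : 0 < cmod h <= s -> cmod (z - a) <= s -> cmod (w - z) <= s ->
  cmod (dquo f h w - dquo f h z) <= L2 * cmod (w - z).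
Proof.
have s0' := s0; have L20' := L20; have L30' := L30.
move=> hs za wz; rewrite -[L2](mulfK (lt0r_neq0 s0)) L2E; apply: lipschitz_center => // v vz; have := near za vz => va.
  by apply: dquo_diff; [case/andP: hs | lra].
by apply: dquo_bound => //; lra.
Qed.

Let dquo_half h z : h != 0 ->
  dquo f h z - dquo f (h / 2) z = (dquo f (h / 2) (z + h / 2) - dquo f (h / 2) z) / 2.
Proof.
have s0' := s0; have L20' := L20; have L30' := L30.
move=> h0; rewrite /dquo (_ : z + h / 2 + h / 2 = z + h); last by field.
by field.
Qed.

Let dquo_cder h z : 0 < cmod h <= s -> cmod (z - a) <= s ->
  cmod (dquo f h z - cder f z) <= L2 * cmod h.
Proof.
have s0' := s0; have L20' := L20; have L30' := L30.
move=> hs za; have dz : cdiff f z by apply: df; lra.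
have := @halving_bound (fun h => dquo f h z - cder f z) s (L2 / 2) 1 isT.
rewrite mulrCA mulfV ?mulr1 // => H; have := H _ _ _ h hs; rewrite expr1; apply.
- by lra.
- move=> k /andP[k0 ks]; have kn : k != 0 by rewrite -cmod_gt0.
  have k2 : cmod (k / 2) = cmod k / 2 := cmod_half k.
  have := cmodD (dquo f k z - dquo f (k / 2) z) (dquo f (k / 2) z - cder f z).
  rewrite subrKA dquo_half // cmod_half.
  have := @dquo_lip (k / 2) z (z + k / 2); rewrite shiftE k2.
  move=> /(_ ltac:(lra) za ltac:(lra)); rewrite expr1.
  have : 0 <= L2 * cmod k by rewrite mulr_ge0 // ltW.
  lra.
- by move=> e; exact: has_cderiv_small (cderP dz).
Qed.

(** The Lipschitz estimate is applied to [dquo f h - dquo f h'], which is small because both are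
    close to [cder f]; then [h'] tends to 0 and [dquo f h'] becomes [cder f]. *)
Let dquo_cder2 h t : 0 < cmod h <= s -> cmod t <= s ->
  cmod (dquo f h (a + t) - dquo f h a - (cder f (a + t) - cder f a)) <= L3 * cmod h * cmod t.
Proof.
have s0' := s0; have L20' := L20; have L30' := L30.
move=> hs ts; apply/ler_addgt0Pr => e e0.
have aa : cmod (a - a) <= s by rewrite subrr cmod0 ltW.
have ta : cmod (a + t - a) <= s by rewrite shiftE.
have K0 : 0 < L3 * cmod t + 2 * L2 + 1.
  by have := mulr_ge0 L30 (cmod_ge0 t); lra.
have [|h' h'0] := @cmod_ex_point _ 0 (Num.min s (e / (L3 * cmod t + 2 * L2 + 1))).
  by rewrite lt_min s0 divr_gt0.
rewrite subr0 lt_min => /andP[h's]; rewrite ltr_pdivlMr // => h'e.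
have h'c : 0 < cmod h' <= s by rewrite cmod_gt0 h'0 ltW.
have H1 := dquo_cder h'c aa; have H2 := dquo_cder h'c ta.
have := @lipschitz_center (fun z => dquo f h z - dquo f h' z) a s
  (L2 * (cmod h + cmod h')) s0.
have -> : 4 * (L2 * (cmod h + cmod h')) / s = L3 * (cmod h + cmod h').
  by rewrite -[L3](mulfK (lt0r_neq0 s0)) L3E; field; rewrite gt_eqF.
move=> /(_ _ _ (a + t)); rewrite shiftE => H3.
have {}H3 := H3 _ _ ts.
have H4 : cmod (dquo f h (a + t) - dquo f h' (a + t) - (dquo f h a - dquo f h' a))
    <= L3 * (cmod h + cmod h') * cmod t.
  apply: H3 => z za.
    by apply: cdiffB; apply: dquo_diff; rewrite ?(ltW h's) //; [case/andP: hs | lra | lra].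
  have -> : dquo f h z - dquo f h' z = (dquo f h z - cder f z) - (dquo f h' z - cder f z).
    by ring.
  apply: le_trans (cmodB _ _) _; have := dquo_cder hs za; have := dquo_cder h'c za; lra.
have -> : dquo f h (a + t) - dquo f h a - (cder f (a + t) - cder f a) =
  (dquo f h (a + t) - dquo f h' (a + t) - (dquo f h a - dquo f h' a)) +
  ((dquo f h' (a + t) - cder f (a + t)) - (dquo f h' a - cder f a)) by ring.
apply: le_trans (cmodD _ _) _.
have := cmodB (dquo f h' (a + t) - cder f (a + t)) (dquo f h' a - cder f a).
have := cmod_ge0 h'; nra.
Qed.

Let cder_quot t := (cder f (a + t) - cder f a) / t.

(** The second difference [(f (a + h + t) - f (a + h) - f (a + t) + f a) / (h * t)] is symmetric in
    [h] and [t] and is close to both quotients. *)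
Let cder_quot_cauchy h t : 0 < cmod h <= s -> 0 < cmod t <= s ->
  cmod (cder_quot t - cder_quot h) <= L3 * (cmod h + cmod t).
Proof.
have s0' := s0; have L20' := L20; have L30' := L30.
move=> hs ts; have /andP[h0 h1] := hs; have /andP[t0 t1] := ts.
have hn : h != 0 by rewrite -cmod_gt0.
have tn : t != 0 by rewrite -cmod_gt0.
have H1 := dquo_cder2 hs t1; have H2 := dquo_cder2 ts h1.
have E : cder_quot t - cder_quot h =
    (dquo f t (a + h) - dquo f t a - (cder f (a + h) - cder f a)) / h -
    (dquo f h (a + t) - dquo f h a - (cder f (a + t) - cder f a)) / t.
  rewrite /cder_quot /dquo (_ : a + h + t = a + t + h); last by ring.
  by field; rewrite hn tn.
rewrite E {E}.
apply: le_trans (cmodB _ _) _; rewrite !cmod_div mulrDr addrC.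
by apply: lerD; rewrite ler_pdivrMr // mulrAC.
Qed.

Let cder_cder : exists l, forall t, 0 < cmod t <= s -> cmod (cder_quot t - l) <= L3 * cmod t.
Proof.
have s0' := s0; have L20' := L20; have L30' := L30.
pose u n := cder_quot (s%:C / 2 ^+ n).
have p2 n : 0 < 2 ^+ n :> R by rewrite exprn_gt0.
have p2' n : 1 <= 2 ^+ n :> R by rewrite -natrX ler1n expn_gt0.
have cu n : cmod (s%:C / 2 ^+ n : C) = s / 2 ^+ n.
  by rewrite cmod_div cmodX cmod_nat cmodR gtr0_norm.
have sn n : 0 < cmod (s%:C / 2 ^+ n : C) <= s.
  by rewrite cu divr_gt0 //= ler_pdivrMr // ler_peMr // ltW.
have [n|l Hl] := @complex_lim_geom _ u (2 * L3 * s).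
  apply: le_trans (cder_quot_cauchy (sn n) (sn n.+1)) _; rewrite !cu exprS.
  have -> : s / (2 * 2 ^+ n) = s / 2 ^+ n / 2 by field; rewrite gt_eqF.
  have : 0 <= L3 * (s / 2 ^+ n) by rewrite mulr_ge0 // divr_ge0 // ltW.
  lra.
exists l => t ts; apply/ler_addgt0Pr => e e0.
(* Eight parts for the distance of [u n] to its limit, one for the Cauchy estimate between [u n] and
   [cder_quot t]. *)
have [n hn] := geom_small (9 * (L3 * s)) e0.
have := Hl n; have := cder_quot_cauchy (sn n) ts; rewrite cu -/(u n).
have := cmodD (cder_quot t - u n) (u n - l); rewrite subrKA.
by move: hn; rewrite mulrDr; lra.
Qed.

Lemma cder_cdiff : cdiff (cder f) a.
Proof.
have s0' := s0; have L20' := L20; have L30' := L30.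
have [l Hl] := cder_cder; exists l => e e0.
exists (Num.min s (e / (L3 + 1))); first by rewrite lt_min s0 divr_gt0 //; have := L30; lra.
move=> w; rewrite lt_min => /and3P[w0 ws]; rewrite ltr_pdivlMr; last by have := L30; lra.
move=> we; have := Hl (w - a); rewrite w0 (ltW ws) => /(_ isT).
rewrite /cder_quot (_ : a + (w - a) = w); last by ring.
lra.
Qed.

(** [halving_bound] with [m = 2] gives [dquo f h a = cder f a + l * h / 2 + O(h ^ 2)], where [l] is
    the derivative of [cder f] at [a]. This is the removable singularity needed to split off
    zeros. *)
Lemma divided_difference_cdiff :
  cdiff (fun z => if z == a then cder f a else (f z - f a) / (z - a)) a.
Proof.
have s0' := s0; have L20' := L20; have L30' := L30.
have [l Hl] := cder_cder; exists (l / 2); apply/has_cderivP => e e0.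
have aa : cmod (a - a) <= s by rewrite subrr cmod0 ltW.
have key h : 0 < cmod h <= s ->
    cmod (dquo f h a - cder f a - l * h / 2) <= 2 * L3 * cmod h ^+ 2.
  move=> hs; have := @halving_bound (fun h => dquo f h a - cder f a - l * h / 2) s L3 2.
  move=> /(_ isT L30 _ _ h hs); apply.
    move=> k /andP[k0 ks]; have kn : k != 0 by rewrite -cmod_gt0.
    have k2 : cmod (k / 2) = cmod k / 2 := cmod_half k.
    have k2s : 0 < cmod (k / 2) <= s by rewrite k2; lra.
    have H1 := dquo_cder2 k2s (ltac:(by case/andP: k2s) : cmod (k / 2) <= s).
    have H2 := Hl _ k2s.
    have H3 : cmod (cder f (a + k / 2) - cder f a - l * (k / 2)) <= L3 * cmod (k / 2) ^+ 2.
      have -> : cder f (a + k / 2) - cder f a - l * (k / 2) =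
          (cder_quot (k / 2) - l) * (k / 2) by rewrite /cder_quot; field.
      by rewrite cmodM expr2 mulrA ler_wpM2r ?cmod_ge0.
    have := dquo_half a kn.
    set x := dquo f k a; set y := dquo f (k / 2) a; set y' := dquo f (k / 2) (a + k / 2).
    move=> xE; rewrite -/y -/y' in H1.
    have -> : x - cder f a - l * k / 2 = (y - cder f a - l * (k / 2) / 2) +
       ((y' - y - (cder f (a + k / 2) - cder f a)) +
        (cder f (a + k / 2) - cder f a - l * (k / 2))) / 2.
      by rewrite -[x](subrK y) xE; field.
    apply: le_trans (cmodD _ _) _; rewrite lerD2l cmod_half.
    have := cmodD (y' - y - (cder f (a + k / 2) - cder f a))
        (cder f (a + k / 2) - cder f a - l * (k / 2)).
    have : 0 <= L3 * cmod k ^+ 2 by rewrite mulr_ge0 // sqr_ge0.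
    move: H1 H3; rewrite k2; set y0 := cmod k; rewrite !expr2; nra.
  move=> e' e'0; have K0 : 0 < L2 + cmod l + 1 by have := L20; have := cmod_ge0 l; lra.
  exists (Num.min s (e' / (L2 + cmod l + 1))); first by rewrite lt_min s0 divr_gt0.
  move=> k; rewrite lt_min => /and3P[k0 ks]; rewrite ltr_pdivlMr // => ke.
  have ks' : 0 < cmod k <= s by rewrite k0 ltW.
  have := dquo_cder ks' aa; have := cmodB (dquo f k a - cder f a) (l * k / 2).
  rewrite cmod_half cmodM; have := mulr_ge0 (cmod_ge0 l) (ltW k0); nra.
have K0 : 0 < 2 * L3 + 1 by have := L30; lra.
exists (Num.min s (e / (2 * L3 + 1))); first by rewrite lt_min s0 divr_gt0.
move=> w; rewrite lt_min => /andP[ws]; rewrite ltr_pdivlMr // => we.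
rewrite eqxx; have [->|wa] := eqVneq w a; first by rewrite !subrr mulr0 subr0 cmod0 mulr0.
have w0 : 0 < cmod (w - a) by rewrite cmod_gt0 subr_eq0.
have := key (w - a); rewrite w0 (ltW ws) => /(_ isT).
rewrite /dquo (_ : a + (w - a) = w); last by ring.
rewrite (_ : l / 2 * (w - a) = l * (w - a) / 2); last by ring.
move=> h; apply: le_trans h _.
by rewrite expr2 mulrA ler_wpM2r ?cmod_ge0 //; have := cmod_ge0 (w - a); nra.
Qed.

End LocalTaylor.

Definition holo f a := exists2 d, 0 < d & forall z, cmod (z - a) < d -> cdiff f z.

Lemma holo_cdiff f a : holo f a -> cdiff f a.
Proof. by move=> [d d0]; apply; rewrite subrr cmod0. Qed.

Lemma holo_near f a : holo f a ->
  exists2 d, 0 < d & forall z, cmod (z - a) < d -> holo f z.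
Proof.
move=> [d d0 H]; exists (d / 2) => [|z za]; first lra.
exists (d / 2) => [|w wz]; first lra.
by apply: H; have := cmod_dist w z a; lra.
Qed.

Lemma holo_local_bound f a : holo f a -> exists s M, [/\ 0 < s,
  forall z, cmod (z - a) <= 4 * s -> cdiff f z &
  forall z, cmod (z - a) <= 4 * s -> cmod (f z) <= M].
Proof.
move=> Hf; have [d d0 H] := Hf.
have [d' d'0 H'] := cdiff_cont (holo_cdiff Hf) ltr01.
have m0 : 0 < Num.min d d' by rewrite lt_min d0.
exists (Num.min d d' / 5), (cmod (f a) + 1); split=> [|z zd|z zd]; first lra.
  apply: H; apply: lt_le_trans (_ : Num.min d d' <= _); first lra.
  by rewrite ge_min lexx.
have /H' : cmod (z - a) < d'.
  apply: lt_le_trans (_ : Num.min d d' <= _); first lra.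
  by rewrite ge_min lexx orbT.
have := cmodD (f z - f a) (f a); rewrite subrK; lra.
Qed.

Lemma holo_cder f a : holo f a -> holo (cder f) a.
Proof.
move=> /holo_near[d d0 H]; exists d => // z /H /holo_local_bound[s [M [s0 df fM]]].
have sn : s != 0 by rewrite gt_eqF.
exact: (cder_cdiff s0 df fM (divfK sn _) (divfK sn _) (divfK sn _)).
Qed.

Lemma divided_difference f a : holo f a ->
  cdiff (fun z => if z == a then cder f a else (f z - f a) / (z - a)) a.
Proof.
move=> /holo_local_bound[s [M [s0 df fM]]]; have sn : s != 0 by rewrite gt_eqF.
exact: (divided_difference_cdiff s0 df fM (divfK sn _) (divfK sn _) (divfK sn _)).
Qed.

Lemma entire_holo f a : entire f -> holo f a.
Proof. by move=> H; exists 1 => // z _; exact: H. Qed.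

Lemma entire_cder f : entire f -> entire (cder f).
Proof. by move=> H z; apply/holo_cdiff/holo_cder/entire_holo. Qed.

Lemma entire_factor f a : entire f -> f a = 0 ->
  exists2 g, entire g & forall z, f z = (z - a) * g z.
Proof.
move=> H fa; exists (fun z => if z == a then cder f a else (f z - f a) / (z - a)).
  move=> z; have [->|za] := eqVneq z a; first exact/divided_difference/entire_holo.
  have za0 : 0 < cmod (z - a) by rewrite cmod_gt0 subr_eq0.
  apply: (@cdiff_near _ (fun z => (f z - f a) / (z - a)) _ z _ za0).
    by move=> w wz; case: eqVneq => // wa; move: wz; rewrite wa cmodC ltxx.
  apply: cdiff_div; first by rewrite subr_eq0.
    exact: cdiffB (H z) (cdiff_cst _ _).
  exact: cdiffB (cdiff_id _) (cdiff_cst _ _).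
move=> z; case: eqVneq => [->|za]; first by rewrite fa subrr mul0r.
by rewrite fa subr0 mulrC divfK // subr_eq0.
Qed.

End Regularity.

(** * Boundedness, orders of zeros, identity theorem, primitives *)

Section EntireFunctions.
Variable R : realType.
Local Notation C := R[i].
Implicit Types (f g h k u : C -> C) (z w a b p q s t : C) (r d e M : R).

Definition hull p q s z := exists x y v : R, [/\ 0 <= x, 0 <= y, 0 <= v, x + y + v = 1 &
  z = x%:C * p + y%:C * q + v%:C * s].

(** A barycentric coordinate of at least 1/2 puts the point into the corresponding corner triangle;
    if there is none, it lies in the middle one. *)
Lemma hull_sub p q s z : hull p q s z ->
  [\/ hull p (mid p q) (mid p s) z, hull (mid p q) q (mid q s) z,
      hull (mid p s) (mid q s) s z | hull (mid q s) (mid p s) (mid p q) z].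
Proof.
case=> x [y [v [x0 y0 v0 E ->]]].
have c2 (k l : R) : (k * 2 - l)%:C = k%:C * 2 - l%:C :> C.
  by rewrite rmorphB rmorphM /= rmorph_nat.
have d2 (k : R) : (k * 2)%:C = k%:C * 2 :> C by rewrite rmorphM /= rmorph_nat.
have e2 (k l : R) : (l - k * 2)%:C = l%:C - k%:C * 2 :> C.
  by rewrite rmorphB rmorphM /= rmorph_nat.
have EC : x%:C + y%:C + v%:C = 1 :> C by rewrite -!rmorphD E rmorph1.
have vE : v%:C = 1 - x%:C - y%:C :> C by rewrite -EC; ring.
have [hx|hx] := lerP (1 / 2) x.
  apply: Or41; exists (x * 2 - 1), (y * 2), (v * 2).
  split; [lra | lra | lra | lra | by rewrite c2 !d2 rmorph1 vE /mid; field].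
have [hy|hy] := lerP (1 / 2) y.
  apply: Or42; exists (x * 2), (y * 2 - 1), (v * 2).
  split; [lra | lra | lra | lra | by rewrite c2 !d2 rmorph1 vE /mid; field].
have [hv|hv] := lerP (1 / 2) v.
  apply: Or43; exists (x * 2), (y * 2), (v * 2 - 1).
  split; [lra | lra | lra | lra | by rewrite c2 !d2 rmorph1 vE /mid; field].
apply: Or44; exists (1 - x * 2), (1 - y * 2), (1 - v * 2).
split; [lra | lra | lra | lra | by rewrite !e2 rmorph1 vE /mid; field].
Qed.

Lemma hull_dist p q s z w M : hull p q s w ->
  cmod (p - z) <= M -> cmod (q - z) <= M -> cmod (s - z) <= M -> cmod (w - z) <= M.
Proof.
case=> x [y [v [x0 y0 v0 E ->]]] hp hq hs.
have -> : x%:C * p + y%:C * q + v%:C * s - z =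
   x%:C * (p - z) + y%:C * (q - z) + v%:C * (s - z).
  have : x%:C + y%:C + v%:C = 1 :> C by rewrite -!rmorphD E rmorph1.
  by move=> EC; rewrite -[z in LHS]mul1r -EC; ring.
apply: le_trans (cmodD _ _) _; apply: le_trans (lerD (cmodD _ _) (lexx _)) _.
rewrite !cmodM !cmodR !ger0_norm //.
by have -> : M = x * M + y * M + v * M :> R; [rewrite -!mulrDl E mul1r |
  rewrite !lerD // ler_wpM2l].
Qed.

Lemma bounded_on_disc f r : (forall z, cmod z <= r -> ccont f z) ->
  exists M, forall z, cmod z <= r -> cmod (f z) <= M.
Proof.
have [r0 H|r0 H] := lerP r 0; last first.
  pose P p q s := exists M, forall z, hull p q s z -> cmod z <= r -> cmod (f z) <= M.
  have HP p q s : P p q s.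
    apply: (@triangle_bisection _ (fun=> True) P) => //.
    - move=> {}p {}q {}s _ _ _ [M1 h1] [M2 h2] [M3 h3] [M4 h4].
      exists (Num.max (Num.max M1 M2) (Num.max M3 M4)) => z /hull_sub[] hz zr.
      + by rewrite !le_max h1.
      + by rewrite !le_max h2 // orbT.
      + by rewrite !le_max h3 // !orbT.
      + by rewrite !le_max h4 // !orbT.
    - move=> z _.
      have [d d0 Hd] : exists2 d, 0 < d & exists M, forall w, cmod (w - z) < d ->
          cmod w <= r -> cmod (f w) <= M.
        have [zr|zr] := lerP (cmod z) r.
          have [d d0 Hd] := H z zr 1 ltr01; exists d => //; exists (cmod (f z) + 1).
          move=> w /Hd ? _; have := cmodD (f w - f z) (f z); rewrite subrK; lra.
        exists (cmod z - r); first lra.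
        by exists 0 => w wz wr; have := cmod_leB z w; rewrite cmodC; lra.
      exists (d / 6) => [|p1 q1 s1 _ _ _ hz hL]; first lra.
      have [M HM] := Hd; exists M => w wh wr; apply: HM => //.
      apply: (@le_lt_trans _ _ (5 * tper p1 q1 s1)); last by have := tper_ge0 p1 q1 s1; lra.
      apply: (hull_dist wh); move: hz; rewrite /tper.
      + have := cmod_ge0 (q1 - p1); have := cmod_ge0 (s1 - q1); have := cmod_ge0 (p1 - s1).
        lra.
      + have := cmod_dist q1 p1 z; have := cmod_ge0 (s1 - q1); have := cmod_ge0 (p1 - s1).
        lra.
      + have := cmod_dist s1 p1 z; rewrite (cmodC s1 p1).
        have := cmod_ge0 (s1 - q1); have := cmod_ge0 (q1 - p1); lra.
  (* A right triangle with legs [4 * r] that contains the square circumscribed about the disc. *)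
  have [M HM] := HP (- r -i* r) (3 * r -i* r) (- r +i* (3 * r)).
  exists M => z zr; apply: HM => //.
  have hx := le_trans (Re_le_cmod z) zr; have hy := le_trans (Im_le_cmod z) zr.
  move: hx hy; rewrite !ler_norml => /andP[x1 x2] /andP[y1 y2].
  pose y := (complex.Re z + r) / (4 * r); pose v := (complex.Im z + r) / (4 * r).
  have rE : r != 0 by rewrite gt_eqF.
  exists (1 - y - v), y, v; split.
  - have : y <= 1 / 2 by rewrite ler_pdivrMr ?mulr_gt0 //; lra.
    have : v <= 1 / 2 by rewrite ler_pdivrMr ?mulr_gt0 //; lra.
    lra.
  - by rewrite divr_ge0 //; lra.
  - by rewrite divr_ge0 //; lra.
  - by ring.
  - by apply: eqC; rewrite !(ReD, ImD, ReM, ImM) /= /y /v; field.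
exists (cmod (f 0)) => z zr; rewrite (_ : z = 0) //.
by apply: cmod_small => e e0; lra.
Qed.

Lemma entire_bounded f r : entire f -> exists M, forall z, cmod z <= r -> cmod (f z) <= M.
Proof. by move=> H; apply: bounded_on_disc => z _; exact/cdiff_cont/H. Qed.

Lemma entire_shift f c : entire f -> entire (fun z => f (z + c)).
Proof. by move=> H z; exact/cdiff_shift/H. Qed.

Lemma cont_neq0 f a : ccont f a -> f a != 0 ->
  exists2 d, 0 < d & forall z, cmod (z - a) < d -> f z != 0.
Proof.
move=> H fa; have [|d d0 Hd] := H (cmod (f a)); first by rewrite cmod_gt0.
exists d => // z /Hd h; apply/eqP => E; move: h; rewrite E sub0r cmodN ltxx.
by [].
Qed.

(** If every power of [z - a] divided [f], bounded by [M] on the disc of radius [3 * r] about [a],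
    the maximum principle on the ring from [2 * r] to [3 * r] would bound the [n]-th cofactor by
    [M / (2 * r) ^+ n]. With [cmod (z - a) <= r] this gives [cmod (f z) <= M / 2 ^+ n] for all
    [n]. *)
Lemma entire_order f a : entire f -> ~ (forall z, f z = 0) ->
  exists (p : nat) u, [/\ entire u, u a != 0 & forall z, f z = (z - a) ^+ p * u z].
Proof.
move=> Hf nf; apply: contrapT => H; apply: nf => z.
have div n : exists2 u, entire u & forall w, f w = (w - a) ^+ n * u w.
  elim: n => [|n [u Hu E]]; first by exists f => // w; rewrite expr0 mul1r.
  have [ua|ua] := eqVneq (u a) 0; last by exfalso; apply: H; exists n, u.
  have [v Hv E'] := entire_factor Hu ua; exists v => // w.
  by rewrite E E' exprSr mulrA.
pose r := cmod (z - a) + 1.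
have r1 : 1 <= r by rewrite /r; have := cmod_ge0 (z - a); lra.
have [M HM] := entire_bounded (3 * r) (entire_shift a Hf).
have M0 : 0 <= M by apply: le_trans (HM 0 _); rewrite ?cmod_ge0 // cmod0; lra.
apply: cmod_small => e e0; have [n hn] := geom_small M e0.
apply: le_trans (ltW hn).
have [u Hu E] := div n.
have p0 (x : R) : 0 < x -> 0 < x ^+ n by move=> ?; exact: exprn_gt0.
have ub : cmod (u z) <= M / (2 * r) ^+ n.
  have := @ring_max _ (fun w => u (w + a)) (2 * r) (3 * r) (M / (2 * r) ^+ n) ltac:(lra)
    ltac:(lra) _ _ (z - a) ltac:(rewrite /r; have := cmod_ge0 (z - a); lra).
  rewrite subrK; apply => [w _|w /andP[w1 w2]]; first exact/cdiff_shift/Hu.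
  rewrite ler_pdivlMr; last by apply: p0; lra.
  apply: le_trans (HM w w2); rewrite E addrK cmodM cmodX mulrC.
  by rewrite ler_wpM2r ?cmod_ge0 // lerXn2r ?nnegrE ?cmod_ge0 //; lra.
rewrite E cmodM cmodX.
apply: (@le_trans _ _ (r ^+ n * (M / (2 * r) ^+ n))).
  apply: ler_pM; rewrite ?exprn_ge0 ?cmod_ge0 //.
  by rewrite lerXn2r ?nnegrE ?cmod_ge0 // /r; have := cmod_ge0 (z - a); lra.
rewrite exprMn; have h1 : r ^+ n != 0 by rewrite gt_eqF // p0 //; lra.
have h2 : 2 ^+ n != 0 :> R by rewrite gt_eqF // p0.
by rewrite (_ : _ * _ = M / 2 ^+ n) //; field; rewrite h1 h2.
Qed.

Lemma entire_local0 f a d : entire f -> 0 < d ->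
  (forall z, cmod (z - a) < d -> f z = 0) -> forall z, f z = 0.
Proof.
move=> Hf d0 H; apply: contrapT => nf.
have [p [u [Hu ua E]]] := entire_order a Hf nf.
have [d1 d10 Hd1] := cont_neq0 (cdiff_cont (Hu a)) ua.
have [|z za] := @cmod_ex_point _ a (Num.min d d1); first by rewrite lt_min d0.
rewrite lt_min => /andP[/H zd /Hd1 uz]; move/eqP: zd.
by rewrite E mulf_eq0 (negPf uz) orbF expf_eq0 subr_eq0 (negPf za) andbF.
Qed.

Lemma entire_integral f g : entire f -> entire g -> (forall z, f z * g z = 0) ->
  (forall z, f z = 0) \/ (forall z, g z = 0).
Proof.
move=> Hf Hg H; have [?|nf] := pselect (forall z, f z = 0); [by left | right].
have [a fa] : exists a, f a != 0.
  by apply: contrapT => h; apply: nf => z; apply: contrapT => /eqP ?; apply: h; exists z.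
have [d d0 Hd] := cont_neq0 (cdiff_cont (Hf a)) fa.
apply: (entire_local0 Hg d0 (a := a)) => z /Hd fz; move/eqP: (H z).
by rewrite mulf_eq0 (negPf fz) => /eqP.
Qed.

(** Bisection is used on a segment: the property concerns only the side from [p] to [q], is
    inherited from its two halves, and is applied to the degenerate triangle [0, z, 0]. *)
Lemma zero_deriv_const f r : (forall z, cmod z < r -> has_cderiv f z 0) ->
  forall z, cmod z < r -> f z = f 0.
Proof.
move=> H z zr; apply/eqP; rewrite -subr_eq0; apply/eqP/cmod_small => e0 e0_gt0.
have t0 : 0 <= cmod z := cmod_ge0 z.
pose e := e0 / (2 * cmod z + 1).
have e_gt0 : 0 < e by rewrite divr_gt0 //; lra.
suff : cmod (f z - f 0) <= e * tper 0 z 0.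
  move/le_trans; apply; rewrite /tper subrr cmod0 subr0 sub0r cmodN addr0.
  by rewrite /e mulrAC ler_pdivrMr ?ler_wpM2l //; lra.
pose P p q s := cmod (f q - f p) <= e * tper p q s.
apply: (@triangle_bisection _ (fun w => cmod (w - 0) <= cmod z) P).
- exact: mconv_ball.
- exact: cclosed_ball.
- rewrite /P => p q s _ _ _; have [-> -> _ _] := tper_sub p q s.
  by move=> h1 h2 _ _; have := cmod_dist (f q) (f (mid p q)) (f p); lra.
- move=> w; rewrite subr0 => wz.
  have /has_cderivP/(_ (e / 9))[|d d0 Hd] := H w (le_lt_trans wz zr); first lra.
  exists (d / 6) => [|p q s _ _ _ h1 h2]; first lra.
  have h3 : cmod (q - w) <= 5 * tper p q s.
    have := cmod_dist q p w; move: h1; rewrite /tper.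
    by have := cmod_ge0 (s - q); have := cmod_ge0 (p - s); lra.
  have L0 := tper_ge0 p q s.
  have := Hd p ltac:(lra); have := Hd q ltac:(lra); rewrite !mul0r !subr0.
  have := cmod_dist (f q) (f w) (f p); rewrite (cmodC (f w) (f p)) /P.
  nra.
- by rewrite subrr cmod0.
- by rewrite subr0.
- by rewrite subrr cmod0.
Qed.

(** Near a point where [g] does not vanish, [f / g] has derivative 0; the identity theorem extends
    the relation. Differential equations can thus be integrated without treating poles. *)
Lemma wronskian_zero f g : entire f -> entire g -> ~ (forall z, g z = 0) ->
  (forall z, cder f z * g z - f z * cder g z = 0) -> exists c, forall z, f z = c * g z.
Proof.
move=> Hf Hg ng H.
have [a ga] : exists a, g a != 0.
  by apply: contrapT => h; apply: ng => z; apply: contrapT => /eqP ?; apply: h; exists z.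
have [d d0 Hd] := cont_neq0 (cdiff_cont (Hg a)) ga.
exists (f a / g a) => z; apply/eqP; rewrite -subr_eq0; apply/eqP; move: z.
apply: (entire_local0 (a := a) (d := d)) => // [z|z zd].
  by apply: cdiffB (Hf z) _; exact: cdiffM (cdiff_cst _ _) (Hg z).
have := @zero_deriv_const (fun w => f (w + a) / g (w + a)) d.
move=> /(_ _ (z - a) zd); rewrite subrK add0r => <-; first by rewrite divfK ?subrr // Hd.
move=> w wd; have gw : g (w + a) != 0 by apply: Hd; rewrite addrK.
have := has_cderivM (has_cderiv_shift (cderP (Hf (w + a))))
  (has_cderivV gw (has_cderiv_shift (cderP (Hg (w + a))))).
rewrite (_ : _ + _ = 0) //.
have -> : cder f (w + a) / g (w + a) + f (w + a) * (- cder g (w + a) / g (w + a) ^+ 2) =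
  (cder f (w + a) * g (w + a) - f (w + a) * cder g (w + a)) / g (w + a) ^+ 2 by field.
by rewrite H mul0r.
Qed.

Lemma lipschitz_disc u r r' : 0 < r -> r < r' -> (forall z, cmod z <= r' -> cdiff u z) ->
  exists2 L, 0 <= L & forall z w, cmod z <= r -> cmod w <= r ->
    cmod (u z - u w) <= L * cmod (z - w).
Proof.
move=> r0 rr H.
have [M HM] : exists M, forall z, cmod z <= r' -> cmod (u z) <= M.
  by apply: bounded_on_disc => z /H/cdiff_cont.
have M0 : 0 <= M by apply: le_trans (HM 0 _); rewrite ?cmod_ge0 // cmod0; lra.
pose s := r' - r; have s0 : 0 < s by rewrite subr_gt0.
exists (4 * M / s); first by rewrite divr_ge0 ?mulr_ge0 // ltW.
move=> z w zr wr; have [zw|zw] := lerP (cmod (z - w)) s.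
  apply: lipschitz_center => // v vw.
    by apply: H; have := cmodD (v - w) w; rewrite subrK; move: vw; rewrite /s; lra.
  by apply: HM; have := cmodD (v - w) w; rewrite subrK; move: vw; rewrite /s; lra.
apply: le_trans (cmodB _ _) _; rewrite mulrAC ler_pdivlMr //.
have := HM z ltac:(lra); have := HM w ltac:(lra).
have := cmod_ge0 (u z); have := cmod_ge0 (u w); nra.
Qed.

Lemma msum_cauchy u (L r : R) n a b : 0 <= L -> cmod a <= r -> cmod b <= r ->
  (forall z w, cmod z <= r -> cmod w <= r -> cmod (u z - u w) <= L * cmod (z - w)) ->
  cmod (msum n.+1 u a b - msum n u a b) <= L * cmod (b - a) ^+ 2 / 2 ^+ n.
Proof.
move=> L0 + + H; elim: n a b => [|n IH] a b ar br.
  have cr z w : cmod z <= r -> cmod w <= r -> cmod (mid z w) <= r.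
    by move=> zr wr; have := @mconv_ball _ 0 r z w; rewrite !subr0; exact.
  have -> : msum 1 u a b - msum 0 u a b =
    ((u (mid a (mid a b)) - u (mid a b)) + (u (mid (mid a b) b) - u (mid a b))) * ((b - a) / 2).
    by rewrite /= /mid; field.
  rewrite cmodM cmod_half.
  have := H _ _ (cr _ _ ar (cr _ _ ar br)) (cr _ _ ar br).
  have := H _ _ (cr _ _ (cr _ _ ar br) br) (cr _ _ ar br).
  have -> : mid a (mid a b) - mid a b = (a - b) / 2 / 2 by rewrite /mid; field.
  have -> : mid (mid a b) b - mid a b = (b - a) / 2 / 2 by rewrite /mid; field.
  rewrite !cmod_half (cmodC a b) expr0 divr1 => H1 H2.
  have := cmodD (u (mid a (mid a b)) - u (mid a b)) (u (mid (mid a b) b) - u (mid a b)).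
  have y0 := cmod_ge0 (b - a); set y := cmod (b - a) in H1 H2 y0 *.
  set x := cmod (_ + _) => hx; have : x <= L * y / 2 by lra.
  have : 0 <= L * y * y by rewrite !mulr_ge0.
  rewrite expr2; nra.
have mr : cmod (mid a b) <= r.
  by have := @mconv_ball _ 0 r a b; rewrite !subr0; apply.
have -> : msum n.+2 u a b - msum n.+1 u a b =
  (msum n.+1 u a (mid a b) - msum n u a (mid a b)) +
  (msum n.+1 u (mid a b) b - msum n u (mid a b) b) by rewrite /=; ring.
apply: le_trans (cmodD _ _) _.
have := IH _ _ ar mr; have := IH _ _ mr br.
have -> : b - mid a b = (b - a) / 2 by rewrite /mid; field.
have -> : mid a b - a = (b - a) / 2 by rewrite /mid; field.
rewrite cmod_half.
have -> : L * (cmod (b - a) / 2) ^+ 2 / 2 ^+ n = L * cmod (b - a) ^+ 2 / 2 ^+ n.+1 / 2.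
  by rewrite [2 ^+ n.+1]exprS; field; rewrite gt_eqF // exprn_gt0.
lra.
Qed.

Lemma vanishing_cst z : vanishing (fun=> z) -> z = 0.
Proof. by move=> H; apply: cmod_small => e /H[n h]; exact: h n (leqnn _). Qed.

Lemma vanishingN (u : nat -> C) : vanishing u -> vanishing (fun n => - u n).
Proof. by move=> H e /H[n h]; exists n => m /h; rewrite cmodN. Qed.

Lemma eq_vanishing (u v : nat -> C) : (forall n, u n = v n) -> vanishing u -> vanishing v.
Proof. by move=> E H e /H[n h]; exists n => m /h; rewrite E. Qed.

(** [H z] is the limit of the midpoint sums over the segment from 0 to [z]. Goursat's theorem on the
    triangle [0, z, w] turns [H w - H z] into a sum over the segment from [z] to [w]. *)
Lemma primitive u r r' : 0 < r -> r < r' -> (forall z, cmod z <= r' -> cdiff u z) ->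
  exists2 H, H 0 = 0 & forall z, cmod z < r -> has_cderiv H z (u z).
Proof.
move=> r0 rr du; have [L L0 HL] := lipschitz_disc r0 rr du.
have z0r : cmod (0 : C) <= r by rewrite cmod0 ltW.
have lim z : cmod z <= r -> exists l, vanishing (fun n => msum n u 0 z - l).
  move=> zr.
  have [n|l Hl] := @complex_lim_geom _ (fun n => msum n u 0 z) (L * cmod (z - 0) ^+ 2).
    exact: msum_cauchy HL.
  exists l => e e0; have [n0 hn0] := geom_small (4 * (L * cmod (z - 0) ^+ 2)) e0.
  exists n0 => n nn0; apply: le_trans (Hl n) _; apply: le_trans (ltW hn0).
  apply: ler_wpM2l; first by rewrite !mulr_ge0 ?cmod_ge0.
  by rewrite lef_pV2 ?posrE ?exprn_gt0 // ler_weXn2l // ler1n.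
pose H z := xget 0 (fun l => vanishing (fun n => msum n u 0 z - l)).
have HP z : cmod z <= r -> vanishing (fun n => msum n u 0 z - H z).
  move=> /lim[l hl].
  exact: (@xgetI _ 0 (fun l => vanishing (fun n => msum n u 0 z - l)) l hl).
exists H => [|z zr].
  have := vanishingN (HP 0 z0r) => h; apply: vanishing_cst.
  apply: eq_vanishing h => n; rewrite opprB.
  have := msumN n u 0 0 => /eqP; rewrite -subr_eq0 opprK -mulr2n mulrn_eq0 /= => /eqP ->.
  by rewrite subr0.
have est w : cmod w <= r -> cmod (H w - H z - u z * (w - z)) <= L * cmod (w - z) * cmod (w - z).
  move=> wr; have zr' := ltW zr.
  have vt : vanishing (fun n => tsum n u 0 z w).
    apply: (@goursat _ (fun x => cmod (x - 0) <= r)); rewrite ?subr0 //.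
    - exact: mconv_ball.
    - exact: cclosed_ball.
    - by move=> x; rewrite subr0 => xr; apply: du; lra.
  have v1 := vanishingD vt (vanishingD (HP w wr) (vanishingN (HP z zr'))).
  apply/ler_addgt0Pr => e /v1[n /(_ n (leqnn _))].
  rewrite /tsum (msumN n u 0 w).
  have -> : msum n u 0 z + msum n u z w - msum n u 0 w
    + (msum n u 0 w - H w - (msum n u 0 z - H z)) = msum n u z w - (H w - H z) by ring.
  have : cmod (msum n u z w - u z * (w - z)) <= L * cmod (w - z) * cmod (w - z).
    have -> : u z * (w - z) = msum n (fun x => u z + 0 * x) z w.
      by rewrite msum_affine mul0r mul0r addr0.
    rewrite -msumB; apply: (@msum_bound _ (fun x => cmod (x - 0) <= r /\
        cmod (x - z) <= cmod (w - z))).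
    - by apply: mconvI; exact: mconv_ball.
    - by rewrite subr0 subrr cmod0 cmod_ge0.
    - by rewrite subr0.
    - move=> x; rewrite subr0 mul0r addr0 => -[xr xz].
      by apply: le_trans (HL _ _ xr zr') _; rewrite ler_wpM2l.
  have := cmodB (msum n u z w - u z * (w - z)) (msum n u z w - (H w - H z)).
  rewrite (_ : _ - _ - (_ - _) = H w - H z - u z * (w - z)); last by ring.
  lra.
apply/has_cderivP => e e0.
exists (Num.min (r - cmod z) (e / (L + 1))).
  by rewrite lt_min subr_gt0 zr divr_gt0 // ltr_pwDr.
move=> w; rewrite lt_min => /andP[w1]; rewrite ltr_pdivlMr ?ltr_pwDr // => w2.
apply: le_trans (est w _) _.
  by have := cmodD (w - z) z; rewrite subrK; lra.
rewrite ler_wpM2r ?cmod_ge0 //; have := cmod_ge0 (w - z); nra.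
Qed.

End EntireFunctions.

(** * Lower bounds and logarithmic derivatives of zero-free functions *)

Section ZeroFree.
Variable R : realType.
Local Notation C := R[i].
Implicit Types (f g h k u : C -> C) (z w a b : C) (r d e M : R).

(** [cmod (1 + x) ^+ 2 = 1 + X] with [X = 2 * Re x + cmod x ^+ 2], and [ln (1 + X)] lies between
    [X - X ^+ 2 / (1 + X)] and [X]. This linearisation stands in for a complex logarithm. *)
Lemma ln_cmod1D (x : C) : cmod x <= 1 / 4 ->
  `|ln (cmod (1 + x)) - complex.Re x| <= 5 * cmod x ^+ 2.
Proof.
move=> x4; have y0 := cmod_ge0 x.
have h1 : 3 / 4 <= cmod (1 + x).
  by have := cmod_leB 1 (- x); rewrite opprK cmod1 cmodN; lra.
pose X := 2 * complex.Re x + cmod x ^+ 2.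
have E : cmod (1 + x) ^+ 2 = 1 + X.
  by rewrite /X !cmod_sqr ReD ImD /= add0r; ring.
have X1 : 9 / 16 <= 1 + X by rewrite -E; nra.
have Xp : 0 < 1 + X by lra.
have lnE : ln (cmod (1 + x)) = ln (1 + X) / 2.
  by rewrite -E lnXn ?mulr2n; [field | lra].
have U : ln (1 + X) <= X by apply: le_ln1Dx; lra.
have V : X - X ^+ 2 / (1 + X) <= ln (1 + X).
  rewrite -[ln _]opprK -lnV ?posrE // lerNr.
  have -> : (1 + X)^-1 = 1 + (- X / (1 + X)) by field; rewrite gt_eqF.
  apply: le_trans (le_ln1Dx _) _; first by rewrite mulNr ltrN2 ltr_pdivrMr //; lra.
  by rewrite le_eqVlt; apply/orP; left; apply/eqP; field; rewrite gt_eqF.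
have hR := Re_le_cmod x; move: hR; rewrite ler_norml => /andP[r1 r2].
set y := cmod x in x4 y0 r1 r2 *.
have X2 : X ^+ 2 <= 81 / 16 * y ^+ 2.
  rewrite -subr_ge0.
  have -> : 81 / 16 * y ^+ 2 - X ^+ 2 = (9 / 4 * y - X) * (9 / 4 * y + X) by field.
  by apply: mulr_ge0; rewrite /X -/y; nra.
have X3 : X ^+ 2 / (1 + X) <= 9 * y ^+ 2.
  by rewrite ler_pdivrMr //; have := sqr_ge0 y; nra.
have XE : X = 2 * complex.Re x + y ^+ 2 by [].
clearbody X; rewrite lnE ler_norml; have := sqr_ge0 y => ?.
by apply/andP; split; lra.
Qed.

(** The real function [ln |h| - Re H], regarded as complex valued, has complex derivative 0
    everywhere, since the first-order terms of [ln |h|] and [Re H] agree. *)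
Lemma ln_cmod_primitive h H r : (forall z, cmod z < r -> cdiff h z) ->
  (forall z, cmod z < r -> h z != 0) -> H 0 = 0 ->
  (forall z, cmod z < r -> has_cderiv H z (cder h z / h z)) ->
  forall z, cmod z < r -> ln (cmod (h z)) = ln (cmod (h 0)) + complex.Re (H z).
Proof.
move=> dh h0 H0 dH z zr.
pose psi w : C := (ln (cmod (h w)) - complex.Re (H w))%:C.
have := @zero_deriv_const _ psi r _ z zr; rewrite /psi H0 /= subr0 => E.
suff /E/complexI : forall z0, cmod z0 < r -> has_cderiv psi z0 0 by lra.
move=> w wr; apply/has_cderivP => e e0.
have hw0 := h0 w wr; set l := cder h w / h w.
have c0 : 0 < cmod (h w) by rewrite cmod_gt0.
have /has_cderivP/(_ (e / 4))[|d1 d10 Hd1] := dH w wr; first lra.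
have m1 : 0 < Num.min (e / 4) 1 by rewrite lt_min ltr01 andbT; lra.
have e1 : 0 < Num.min (e / 4) 1 * cmod (h w) by rewrite mulr_gt0.
have [d2 d20 Hd2] := (has_cderivP _ _ _).1 (cderP (dh w wr)) _ e1.
pose K := cmod l + 1; have K0 : 0 < K by rewrite /K; have := cmod_ge0 l; lra.
exists (Num.min (Num.min d1 d2) (Num.min (1 / (4 * K)) (e / (10 * K ^+ 2)))).
  by rewrite !lt_min d10 d20 !divr_gt0 ?mulr_gt0 ?exprn_gt0.
move=> v; rewrite !lt_min => /andP[/andP[/Hd1 g1 /Hd2 g2]] /andP[g3 g4].
move: g3 g4; rewrite !ltr_pdivlMr ?mulr_gt0 ?exprn_gt0 // => g3 g4.
have D0 := cmod_ge0 (v - w); set D := cmod (v - w) in g1 g2 g3 g4 D0 *.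
pose x := (h v - h w) / h w.
have hv : h v = h w * (1 + x) by rewrite /x; field.
have xl : cmod (x - l * (v - w)) <= Num.min (e / 4) 1 * D.
  have -> : x - l * (v - w) = (h v - h w - cder h w * (v - w)) / h w.
    by rewrite /x /l; field.
  by rewrite cmod_div ler_pdivrMr // mulrAC.
have xl1 : cmod (x - l * (v - w)) <= e / 4 * D.
  by apply: le_trans xl _; rewrite ler_wpM2r // ge_min lexx.
have xl2 : cmod (x - l * (v - w)) <= D.
  by apply: le_trans xl _; rewrite -[X in _ <= X]mul1r ler_wpM2r // ge_min lexx orbT.
have xK : cmod x <= K * D.
  have := cmodD (x - l * (v - w)) (l * (v - w)); rewrite subrK cmodM -/D /K; lra.
have x4 : cmod x <= 1 / 4 by lra.
have L1 := ln_cmod1D x4.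
have x2 : 5 * cmod x ^+ 2 <= e / 2 * D.
  have : cmod x ^+ 2 <= K * D * (K * D) by rewrite expr2 ler_pM ?cmod_ge0.
  have : D * (10 * K ^+ 2) * D <= e * D by rewrite ler_wpM2r // ltW.
  rewrite !expr2; nra.
have x10 : 0 < cmod (1 + x).
  by have := cmod_leB 1 (- x); rewrite opprK cmod1 cmodN; lra.
rewrite mul0r subr0 /psi -rmorphB cmodR hv cmodM lnM ?posrE //.
have -> : ln (cmod (h w)) + ln (cmod (1 + x)) - complex.Re (H v)
    - (ln (cmod (h w)) - complex.Re (H w)) =
   (ln (cmod (1 + x)) - complex.Re x) + complex.Re (x - l * (v - w))
    - complex.Re (H v - H w - l * (v - w)).
  by rewrite !(ReD, ReN); ring.
apply: le_trans (ler_normB _ _) _.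
have := ler_normD (ln (cmod (1 + x)) - complex.Re x) (complex.Re (x - l * (v - w))).
have := Re_le_cmod (x - l * (v - w)); have := Re_le_cmod (H v - H w - l * (v - w)).
rewrite -/l in g1; lra.
Qed.

(* Borel-Caratheodory via the Schwarz lemma applied to [H / (2 A - H)]. *)
Lemma borel_caratheodory H A r0 r1 : 0 < A -> 0 < r0 < r1 ->
  (forall z, cmod z <= r1 -> cdiff H z) -> H 0 = 0 ->
  (forall z, cmod z <= r1 -> complex.Re (H z) <= A) ->
  forall z, cmod z <= r0 -> cmod (H z) <= 4 * A * r0 / (r1 - r0).
Proof.
move=> A0 /andP[r00 r01] dH H0 HA z zr.
pose D w : C := (2 * A)%:C - H w.
have ReD w : complex.Re (D w) = 2 * A - complex.Re (H w) by rewrite /D ReD ReN.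
have ImD w : complex.Im (D w) = - complex.Im (H w) by rewrite /D ImD ImN /= add0r.
have D0 w : cmod w <= r1 -> D w != 0.
  by move=> /HA h; apply/eqP => E; have := ReD w; rewrite E /=; lra.
(* A value with real part at most [A] is at least as close to 0 as to [2 * A]. *)
have HD w : cmod w <= r1 -> cmod (H w) <= cmod (D w).
  move=> /HA h; rewrite -(ler_pXn2r (n := 2)) ?nnegrE ?cmod_ge0 //.
  rewrite !cmod_sqr ReD ImD sqrrN lerD2r -subr_ge0.
  have -> : (2 * A - complex.Re (H w)) ^+ 2 - complex.Re (H w) ^+ 2 =
    4 * A * (A - complex.Re (H w)) by ring.
  by rewrite !mulr_ge0 ?subr_ge0 // ltW.
(* Schwarz's lemma gives [cmod (H z) * r' <= r0 * (2 * A + cmod (H z))]; since [r' - r0] is half of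
   [r1 - r0], solving for [cmod (H z)] produces the constant 4. *)
pose r' := (r0 + r1) / 2.
have := @schwarz_ring _ (fun w => H w / D w) r' r1 1.
move=> /(_ ltac:(rewrite /r'; lra) _ _ _ z ltac:(lra)) G.
have {}G : cmod (H z / D z) <= 1 / r' * cmod z.
  apply: G => [w wr||w /andP[_ wr]].
  - apply: cdiff_div; [exact: D0 | exact: dH | ].
    by apply: cdiffB (cdiff_cst _ _) _; exact: dH.
  - by rewrite H0 mul0r.
  - by rewrite cmod_div ler_pdivrMr ?cmod_gt0 ?D0 // mul1r HD.
have r'0 : 0 < r' by rewrite /r'; lra.
have Dz : 0 < cmod (D z) by rewrite cmod_gt0 D0 //; lra.
move: G; rewrite mul1r [_^-1 * _]mulrC cmod_div ler_pdivrMr // mulrAC ler_pdivlMr // => G.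
have {}G : cmod (H z) * r' <= r0 * cmod (D z).
  have : cmod z * cmod (D z) <= r0 * cmod (D z) by rewrite ler_wpM2r // ltW.
  exact: le_trans.
have : cmod (D z) <= 2 * A + cmod (H z).
  by apply: le_trans (cmodB _ _) _; rewrite cmodR ger0_norm //; lra.
move=> G2; rewrite ler_pdivlMr; last lra.
have h : r0 * cmod (D z) <= r0 * (2 * A + cmod (H z)) by rewrite ler_wpM2l // ltW.
have : cmod (H z) * r' <= r0 * (2 * A + cmod (H z)) by exact: le_trans h.
rewrite /r'; lra.
Qed.

(** For the primitive [H] of [h' / h] that vanishes at 0, [Re H = ln |h| - ln |h 0|] is at most [A];
    the [+ 1] keeps [A] positive. Borel-Caratheodory bounds [H] on a smaller disc: its real part
    gives the lower bound, and Cauchy's estimate for [H' = h' / h] the second claim. *)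
Lemma zero_free_bounds h B r0 r1 r2 : entire h -> 0 < r0 < r1 -> r1 < r2 ->
  (forall z, cmod z <= r2 -> h z != 0) ->
  (forall z, cmod z <= r2 -> cmod (h z) <= expR B) ->
  let A := B - ln (cmod (h 0)) + 1 in
  (forall z, cmod z <= r0 ->
     ln (cmod (h 0)) - 4 * A * r0 / (r1 - r0) <= ln (cmod (h z))) /\
  (forall r z, r < r0 -> cmod z <= r ->
     cmod (cder h z / h z) <= 16 * A * r0 / ((r1 - r0) * (r0 - r))).
Proof.
move=> Hh /andP[r00 r01] r12 h0 hB A.
pose r3 := (r1 + r2) / 2.
have [H H0 dH] := @primitive _ (fun z => cder h z / h z) r3 r2
  ltac:(rewrite /r3; lra) ltac:(rewrite /r3; lra)
  ltac:(by move=> z /h0 hz; apply: cdiff_div => //; exact: entire_cder).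
have lnE := @ln_cmod_primitive h H r3 (fun z _ => Hh z)
   (fun z zr => h0 z ltac:(move: zr; rewrite /r3; lra)) H0 dH.
have lnB z : cmod z <= r2 -> ln (cmod (h z)) <= B.
  move=> zr; rewrite -[B]expRK ler_ln ?posrE ?expR_gt0 ?cmod_gt0 ?h0 //.
  exact: hB.
have A1 : 1 <= A by have := lnB 0; rewrite cmod0 /A => /(_ ltac:(lra)); lra.
have HA z : cmod z <= r0 -> cmod (H z) <= 4 * A * r0 / (r1 - r0).
  apply: borel_caratheodory => //; [lra | lra | |].
  - by move=> w wr; eexists; apply: dH; rewrite /r3; lra.
  - move=> w wr; have := lnB w ltac:(lra); have := lnE w ltac:(rewrite /r3; lra).
    by rewrite /A; lra.
split=> [z zr|r z rr zr].
  have := lnE z ltac:(rewrite /r3; lra); have := HA z zr.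
  by have := Re_le_cmod (H z); rewrite ler_norml => /andP[]; lra.
have E : cder H z = cder h z / h z by apply: cderE; apply: dH; rewrite /r3; lra.
have := @cder_bound _ H z (r0 - r) (4 * A * r0 / (r1 - r0)) ltac:(lra).
rewrite E; have -> : 4 * (4 * A * r0 / (r1 - r0)) / (r0 - r) =
    16 * A * r0 / ((r1 - r0) * (r0 - r)).
  by field; rewrite !subr_eq0 !gt_eqF.
have tri w : cmod (w - z) <= r0 - r -> cmod w <= r0.
  by move=> wz; have := cmodD (w - z) z; rewrite subrK; lra.
apply=> w /tri wr; last exact: HA.
by eexists; apply: dH; rewrite /r3; lra.
Qed.

End ZeroFree.

(** * Blaschke factors, counting of zeros, bounds for quotients and logarithmic derivatives *)

Section Blaschke.
Variable R : realType.
Local Notation C := R[i].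
Implicit Types (f g h k u : C -> C) (z w a b : C) (r t d e M : R) (zs : seq C).

Definition zprod zs z : C := \prod_(w <- zs) (z - w).

(** The denominators of Blaschke factors: a zero [w] other than 0 is replaced by its mirror image
    [r ^+ 2 / cj w]. On the circle of radius [r] the modulus equals that of [zprod zs]. *)
Definition bprod r zs z : C := \prod_(w <- zs) (((r ^+ 2)%:C - cj w * z) / r%:C).

Lemma entire_zprod zs : entire (zprod zs).
Proof. by move=> z; apply: cdiff_prod => w; exact: cdiffB (cdiff_id _) (cdiff_cst _ _). Qed.

Lemma entire_bprod r zs : entire (bprod r zs).
Proof.
move=> z; apply: cdiff_prod => w; apply: cdiffM (cdiff_cst _ _).
apply: cdiffB (cdiff_cst _ _) _; exact: cdiffM (cdiff_cst _ _) (cdiff_id _).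
Qed.

(** An inequality on the whole exterior, and not only on the circle, because [ring_max] needs a
    bound on a ring. It rests on the factorised difference of squares below. *)
Lemma blaschke_factor_le r z w : 0 < r -> cmod w <= r <= cmod z ->
  cmod (((r ^+ 2)%:C - cj w * z) / r%:C) <= cmod (z - w).
Proof.
move=> r0 /andP[wr rz]; rewrite cmod_div cmodR gtr0_norm // ler_pdivrMr //.
rewrite -(ler_pXn2r (n := 2)) ?nnegrE ?mulr_ge0 ?cmod_ge0 // ?(ltW r0) // exprMn.
rewrite -subr_ge0.
have -> : cmod (z - w) ^+ 2 * r ^+ 2 - cmod ((r ^+ 2)%:C - cj w * z) ^+ 2 =
  (cmod z ^+ 2 - r ^+ 2) * (r ^+ 2 - cmod w ^+ 2).
  by rewrite !cmod_sqr !(ReD, ImD, ReN, ImN, ReM, ImM) /=; ring.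
by rewrite mulr_ge0 // subr_ge0 lerXn2r ?nnegrE ?cmod_ge0 // ltW.
Qed.

Lemma bprod_le r zs z : 0 < r -> (forall w, w \in zs -> cmod w <= r) -> r <= cmod z ->
  cmod (bprod r zs z) <= cmod (zprod zs z).
Proof.
move=> r0 H rz; rewrite !cmod_prod big_seq [leRHS]big_seq; apply: ler_prod => w.
by move=> /H wr; rewrite cmod_ge0 blaschke_factor_le // wr.
Qed.

Lemma cmod_bprod0 r zs : 0 < r -> cmod (bprod r zs 0) = r ^+ size zs.
Proof.
move=> r0; rewrite cmod_prod.
rewrite (eq_bigr (fun=> r)) => [|w _]; first by rewrite big_const_seq count_predT iter_mulr_1.
by rewrite mulr0 subr0 rmorphXn /= expr2 mulfK -?cmod_eq0 cmodR gtr0_norm ?gt_eqF.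
Qed.

Lemma bprod_neq0 r zs z : 0 < r -> (forall w, w \in zs -> cmod w < r) -> cmod z < r ->
  bprod r zs z != 0.
Proof.
move=> r0 H zr; rewrite prodf_seq_neq0; apply/allP => w /H wr /=.
rewrite mulf_neq0 ?invr_neq0 // -?cmod_eq0 ?cmodR ?gtr0_norm ?gt_eqF //.
apply: lt_le_trans (cmod_leB _ _); rewrite cmodR cmodM cmod_cj gtr0_norm ?exprn_gt0 //.
by rewrite subr_gt0 expr2; have := cmod_ge0 w; have := cmod_ge0 z; nra.
Qed.

Lemma ln1D_ge (x : R) : 0 <= x -> x / (1 + x) <= ln (1 + x).
Proof.
move=> x0; have x1 : 0 < 1 + x by lra.
rewrite -[ln _]opprK -lnV ?posrE // lerNr.
rewrite [X in ln X](_ : _ = 1 + (- (x / (1 + x)))); last by field; rewrite gt_eqF.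
by apply: le_ln1Dx; rewrite ltrN2 ltr_pdivrMr //; lra.
Qed.

(** Jensen's inequality by the maximum principle: replacing [zprod zs] by [bprod r zs] does not
    enlarge [h] beyond radius [r], but at the origin each zero gains at least the factor
    [r / r0]. *)
Lemma zeros_count h u zs B r0 r r1 : entire h -> entire u -> h 0 != 0 ->
  0 < r0 < r -> r < r1 ->
  (forall z, h z = zprod zs z * u z) -> (forall w, w \in zs -> cmod w <= r0) ->
  (forall z, cmod z <= r1 -> cmod (h z) <= expR B) ->
  (size zs)%:R * ln (r / r0) <= B - ln (cmod (h 0)).
Proof.
move=> Hh Hu h0 /andP[r00 r0r] rr1 E zr hB.
have rp : 0 < r by lra.
have zr' w : w \in zs -> cmod w <= r by move/zr => ?; lra.
have b0 : cmod (u 0 * bprod r zs 0) <= expR B.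
  apply: (@ring_max _ (fun z => u z * bprod r zs z) r r1) => //; first lra.
  - by move=> z _; exact: cdiffM (Hu z) (entire_bprod _ _ z).
  - move=> z /andP[z1 z2]; apply: le_trans (hB z z2).
    by rewrite E !cmodM mulrC ler_wpM2r ?cmod_ge0 // bprod_le.
  - by rewrite cmod0; lra.
have h0E : cmod (h 0) <= cmod (u 0) * r0 ^+ size zs.
  rewrite E cmodM mulrC ler_wpM2l ?cmod_ge0 // cmod_prod.
  rewrite -(iter_mulr_1 (size zs) r0) -(count_predT zs) -big_const_seq big_seq [leRHS]big_seq.
  apply: ler_prod => w /zr wr.
  by rewrite cmod_ge0 sub0r cmodN wr.
rewrite cmodM cmod_bprod0 // in b0.
have key : cmod (h 0) * (r / r0) ^+ size zs <= expR B.
  apply: le_trans b0; rewrite expr_div_n mulrA ler_pdivrMr ?exprn_gt0 //.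
  by rewrite mulrAC ler_wpM2r // exprn_ge0 // ltW.
have c0 : 0 < cmod (h 0) by rewrite cmod_gt0.
have q0 : 0 < r / r0 by rewrite divr_gt0.
have : ln (cmod (h 0) * (r / r0) ^+ size zs) <= ln (expR B).
  by rewrite ler_ln ?posrE ?expR_gt0 ?mulr_gt0 ?exprn_gt0.
rewrite expRK lnM ?posrE ?exprn_gt0 // lnXn // -mulr_natl; lra.
Qed.

(** Zeros are split off one at a time; [zeros_count] bounds how often this can happen. *)
Lemma zeros_list h B r0 r r1 : entire h -> h 0 != 0 -> 0 < r0 < r -> r < r1 ->
  (forall z, cmod z <= r1 -> cmod (h z) <= expR B) ->
  exists zs u, [/\ entire u, forall z, h z = zprod zs z * u z,
    forall w, w \in zs -> cmod w <= r0 & forall z, cmod z <= r0 -> u z != 0].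
Proof.
move=> Hh h0 r0r rr1 hB; apply: contrapT => H.
have L n : exists zs u, [/\ size zs = n, entire u, forall z, h z = zprod zs z * u z &
    forall w, w \in zs -> cmod w <= r0].
  elim: n => [|n [zs [u [sz Hu E zr]]]].
    by exists [::], h; split=> // z; rewrite /zprod big_nil mul1r.
  have [a ar ua] : exists2 a, cmod a <= r0 & u a = 0.
    apply: contrapT => na; apply: H; exists zs, u; split=> // z zr0.
    by apply/eqP => uz; apply: na; exists z.
  have [v Hv E'] := entire_factor Hu ua.
  exists (a :: zs), v; split=> [|//|z|w].
  - by rewrite /= sz.
  - by rewrite E E' /zprod big_cons; ring.
  - by rewrite inE => /orP[/eqP ->//|/zr].
have /andP[r00 rr] := r0r.
have l0 : 0 < ln (r / r0) by apply: ln_gt0; rewrite ltr_pdivlMr // mul1r.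
have := archi_boundP (normr_ge0 ((B - ln (cmod (h 0))) / ln (r / r0))).
set n := Num.bound _ => hn.
have [zs [u [sz Hu E zr]]] := L n.
have := zeros_count Hh Hu h0 r0r rr1 E zr hB; rewrite sz -ler_pdivlMr //.
by have := ler_norm ((B - ln (cmod (h 0))) / ln (r / r0)); lra.
Qed.

(** The zero-free substitute [h1] inherits the upper bounds of [h] from outside radius [r] and is no
    smaller at the origin, so [zero_free_bounds] applies to it with constants expressed by [h]. *)
Lemma blaschke h B r0 r r1 : entire h -> h 0 != 0 -> 0 < r0 < r -> r < r1 ->
  (forall z, cmod z <= r1 -> cmod (h z) <= expR B) ->
  exists zs h1, [/\ entire h1,
    forall z, h z * bprod r zs z = zprod zs z * h1 z,
    forall w, w \in zs -> cmod w <= r0 & forall z, cmod z <= r0 -> h1 z != 0] /\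
    [/\ (size zs)%:R * ln (r / r0) <= B - ln (cmod (h 0)),
    forall z, r <= cmod z -> cmod (h1 z) <= cmod (h z) & cmod (h 0) <= cmod (h1 0)].
Proof.
move=> Hh h0 r0r rr1 hB; have /andP[r00 rr] := r0r; have rp : 0 < r by lra.
have [zs [u [Hu E zr u0]]] := zeros_list Hh h0 r0r rr1 hB.
have zr' w : w \in zs -> cmod w <= r by move/zr => ?; lra.
exists zs, (fun z => u z * bprod r zs z); split; split=> //.
- by move=> z; exact: cdiffM (Hu z) (entire_bprod _ _ z).
- by move=> z; rewrite E; ring.
- move=> z zr0; rewrite mulf_neq0 ?u0 // bprod_neq0 //; last lra.
  by move=> w /zr wr; lra.
- exact: zeros_count Hh Hu h0 r0r rr1 E zr hB.
- by move=> z rz; rewrite E !cmodM mulrC ler_wpM2r ?cmod_ge0 // bprod_le.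
- rewrite E !cmodM mulrC ler_wpM2l ?cmod_ge0 // cmod_bprod0 // cmod_prod.
  rewrite -(iter_mulr_1 (size zs) r) -(count_predT zs) -big_const_seq big_seq [leRHS]big_seq.
  apply: ler_prod => w /zr' wr.
  by rewrite cmod_ge0 sub0r cmodN wr.
Qed.

(** Although [h] may vanish, its zero-free substitute [h1] is bounded below, and [h1 * f] still
    satisfies the bound of [h * f], because [|h1| <= |h|] on the outer ring. *)
Lemma quotient_bound h f S r t : entire h -> entire f -> h 0 != 0 -> 0 < r -> 0 < t ->
  (forall z, cmod z <= r + 4 * t -> cmod (h z) <= expR S) ->
  (forall z, cmod z <= r + 4 * t -> cmod (h z * f z) <= expR S) ->
  forall z, cmod z <= r ->
    cmod (f z) <= expR ((S - ln (cmod (h 0)) + 1) * (1 + 4 * r / t)).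
Proof.
move=> Hh Hf h0 r0 t0 hS hfS z zr.
have [zs [h1 [[Hh1 E zsr h10] [_ h1h h1c]]]] :=
  @blaschke h S (r + 2 * t) (r + 3 * t) (r + 4 * t) Hh h0 ltac:(lra) ltac:(lra) hS.
have h1S w : cmod w <= r + 4 * t -> cmod (h1 w) <= expR S.
  apply: (@ring_max _ h1 (r + 3 * t)); [lra | lra | by move=> v _; exact: Hh1 |].
  by move=> v /andP[/h1h v1 v2]; apply: le_trans v1 (hS v v2).
have h1f w : cmod w <= r + 4 * t -> cmod (h1 w * f w) <= expR S.
  apply: (@ring_max _ (fun w => h1 w * f w) (r + 3 * t)); [lra | lra | |].
    by move=> v _; exact: cdiffM (Hh1 v) (Hf v).
  move=> v /andP[/h1h v1 v2]; apply: le_trans (hfS v v2).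
  by rewrite !cmodM ler_wpM2r ?cmod_ge0.
have := @zero_free_bounds _ h1 S r (r + t) (r + 2 * t) Hh1 ltac:(lra) ltac:(lra) h10
  (fun w wr => h1S w ltac:(lra)).
move=> [+ _] => /(_ z zr).
have hz0 : 0 < cmod (h1 z) by rewrite cmod_gt0 h10 //; lra.
have c0 : 0 < cmod (h 0) by rewrite cmod_gt0.
have c1 : ln (cmod (h 0)) <= ln (cmod (h1 0)) by rewrite ler_ln ?posrE //; lra.
have rt : 0 <= 4 * r / t by rewrite divr_ge0 ?mulr_ge0 // ltW.
rewrite (_ : r + t - r = t); last by ring.
have -> : 4 * (S - ln (cmod (h1 0)) + 1) * r / t = (S - ln (cmod (h1 0)) + 1) * (4 * r / t).
  by field; rewrite gt_eqF.
move=> low.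
have [fz|fz] := eqVneq (f z) 0; first by rewrite fz cmod0 expR_ge0.
have fz0 : 0 < cmod (f z) by rewrite cmod_gt0.
rewrite -[X in X <= _]lnK ?posrE // ler_expR.
have : ln (cmod (h1 z * f z)) <= ln (expR S).
  by rewrite ler_ln ?posrE ?expR_gt0 ?cmodM ?mulr_gt0 // -cmodM h1f //; lra.
rewrite expRK cmodM lnM ?posrE //.
set x := ln (cmod (h 0)) in c1 *; set y := ln (cmod (h1 0)) in c1 low *.
set q := 4 * r / t in rt low *; move=> up.
have : (S - y + 1) * q <= (S - x + 1) * q by rewrite ler_wpM2r //; lra.
lra.
Qed.

Definition ld f z := cder f z / f z.

Lemma ldM f g z : cdiff f z -> cdiff g z -> f z != 0 -> g z != 0 ->
  ld (fun w => f w * g w) z = ld f z + ld g z.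
Proof.
move=> df dg f0 g0; rewrite /ld (cderE (has_cderivM (cderP df) (cderP dg))).
by field; rewrite f0 g0.
Qed.

Lemma ld_prod (F : C -> C -> C) zs z : (forall w, cdiff (F w) z) ->
  (forall w, w \in zs -> F w z != 0) ->
  ld (fun v => \prod_(w <- zs) F w v) z = \sum_(w <- zs) ld (F w) z.
Proof.
move=> dF; elim: zs => [|a zs IH] H.
  have -> : (fun v => \prod_(w <- [::]) F w v) = fun=> 1.
    by apply/funext => v; rewrite big_nil.
  by rewrite big_nil /ld (cderE (has_cderiv_cst _ _)) mul0r.
have -> : (fun v => \prod_(w <- a :: zs) F w v) = fun v => F a v * \prod_(w <- zs) F w v.
  by apply/funext => v; rewrite big_cons.
rewrite ldM ?big_cons ?IH //.
- by move=> w wzs; apply: H; rewrite inE wzs orbT.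
- exact: cdiff_prod.
- by apply: H; rewrite inE eqxx.
- by rewrite prodf_seq_neq0; apply/allP => w wzs; rewrite H // inE wzs orbT.
Qed.

(** Since [h * bprod = zprod * h1], the logarithmic derivative is that of [h1], plus one pole term
    for each zero, minus the reflected terms. Each of the latter is at most [(4 * t)^-1], which
    costs 2 of the 34; the other 32 come from [zero_free_bounds] and [r + t <= 2 * r]. The count of
    zeros uses [ln ((r + 4 * t) / (r + 3 * t)) >= t / (5 * r)]. *)
Lemma log_deriv_bound h B r t : entire h -> h 0 != 0 -> 0 < t <= r ->
  (forall z, cmod z <= r + 5 * t -> cmod (h z) <= expR B) ->
  let A := B - ln (cmod (h 0)) + 1 in
  exists zs, (size zs)%:R <= 5 * r * A / t /\
    forall z, cmod z <= r -> (forall w, w \in zs -> z != w) -> h z != 0 /\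
      cmod (ld h z) <= 34 * A * r / t ^+ 2 + \sum_(w <- zs) (cmod (z - w))^-1.
Proof.
move=> Hh h0 /andP[t0 tr] hB A.
have r0 : 0 < r by lra.
have [zs [h1 [[Hh1 E zsr h10] [sz h1h h1c]]]] :=
  @blaschke h B (r + 3 * t) (r + 4 * t) (r + 5 * t) Hh h0 ltac:(lra) ltac:(lra) hB.
have h1B w : cmod w <= r + 5 * t -> cmod (h1 w) <= expR B.
  apply: (@ring_max _ h1 (r + 4 * t)); [lra | lra | by move=> v _; exact: Hh1 |].
  by move=> v /andP[/h1h v1 v2]; apply: le_trans v1 (hB v v2).
have := @zero_free_bounds _ h1 B (r + t) (r + 2 * t) (r + 3 * t) Hh1 ltac:(lra) ltac:(lra)
  h10 (fun w wr => h1B w ltac:(lra)).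
move=> [_ Hld].
have c0 : 0 < cmod (h 0) by rewrite cmod_gt0.
have c1 : ln (cmod (h 0)) <= ln (cmod (h1 0)) by rewrite ler_ln ?posrE //; lra.
have A1 : 1 <= A.
  have : ln (cmod (h 0)) <= ln (expR B).
    rewrite ler_ln ?posrE ?expR_gt0 //; apply: hB; rewrite cmod0; lra.
  by rewrite expRK /A; lra.
have szA : (size zs)%:R <= 5 * r * A / t.
  have q : t / (5 * r) <= ln ((r + 4 * t) / (r + 3 * t)).
    have -> : (r + 4 * t) / (r + 3 * t) = 1 + t / (r + 3 * t).
      by field; rewrite gt_eqF //; lra.
    apply: le_trans (ln1D_ge _); last by rewrite divr_ge0 //; lra.
    have -> : t / (r + 3 * t) / (1 + t / (r + 3 * t)) = t / (r + 4 * t).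
      have -> : 1 + t / (r + 3 * t) = (r + 4 * t) / (r + 3 * t).
        by field; rewrite gt_eqF //; lra.
      by field; rewrite !gt_eqF //; lra.
    by rewrite ler_wpM2l ?(ltW t0) // lef_pV2 ?posrE //; lra.
  have : (size zs)%:R * (t / (5 * r)) <= A.
    apply: le_trans (_ : (size zs)%:R * ln ((r + 4 * t) / (r + 3 * t)) <= _).
      by rewrite ler_wpM2l.
    by rewrite /A; lra.
  have -> : 5 * r * A / t = A / (t / (5 * r)) by field; rewrite !gt_eqF.
  by rewrite ler_pdivlMr // divr_gt0 // mulr_gt0.
exists zs; split=> // z zr zw.
have hz : h z != 0.
  apply/eqP => E0; have := E z; rewrite E0 mul0r => /esym/eqP.
  rewrite mulf_eq0 (negPf (h10 z _)) ?orbF; last lra.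
  by rewrite prodf_seq_eq0 => /hasP[w /zw]; rewrite /= subr_eq0 => /negPf ->.
split=> //.
have nb w : w \in zs -> ((r + 4 * t) ^+ 2)%:C - cj w * z != 0.
  move=> /zsr wr; rewrite -cmod_gt0; apply: lt_le_trans (cmod_leB _ _).
  rewrite cmodR cmodM cmod_cj gtr0_norm ?exprn_gt0 //; last lra.
  by rewrite subr_gt0 expr2; have := cmod_ge0 w; have := cmod_ge0 z; nra.
have r4C : ((r + 4 * t)%:C : C) != 0 by rewrite -cmod_eq0 cmodR gtr0_norm ?gt_eqF //; lra.
have ldE : ld h z + \sum_(w <- zs) ld (fun v => ((((r + 4 * t) ^+ 2)%:C - cj w * v) / (r + 4 * t)%:C)) z
   = \sum_(w <- zs) ld (fun v => v - w) z + ld h1 z.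
  have h1z : h1 z != 0 by apply: h10; lra.
  rewrite -!ld_prod.
  - rewrite -!ldM; first 1 last.
    + exact: entire_zprod.
    + exact: Hh1.
    + by rewrite prodf_seq_neq0; apply/allP => w /zw; rewrite subr_eq0.
    + exact: h1z.
    + exact: Hh.
    + exact: entire_bprod.
    + exact: hz.
    + rewrite prodf_seq_neq0; apply/allP => w /nb ?.
      by rewrite mulf_neq0 // invr_neq0.
    by congr ld; apply/funext => v; exact: E.
  - by move=> w; exact: cdiffB (cdiff_id _) (cdiff_cst _ _).
  - by move=> w /zw; rewrite subr_eq0.
  - move=> w; apply: cdiffM (cdiff_cst _ _); apply: cdiffB (cdiff_cst _ _) _.
    exact: cdiffM (cdiff_cst _ _) (cdiff_id _).
  - by move=> w /nb ?; rewrite mulf_neq0 // invr_neq0.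
have {}ldE : ld h z = ld h1 z + \sum_(w <- zs) (ld (fun v => v - w) z -
   ld (fun v => ((((r + 4 * t) ^+ 2)%:C - cj w * v) / (r + 4 * t)%:C)) z).
  by rewrite sumrB addrA (addrC (ld h1 z)) -ldE addrK.
have l1 w : ld (fun v => v - w) z = (z - w)^-1.
  rewrite /ld (cderE (has_cderivB (has_cderiv_id z) (has_cderiv_cst w z))).
  by rewrite subr0 mul1r.
have l2 w : w \in zs ->
    cmod (ld (fun v => ((((r + 4 * t) ^+ 2)%:C - cj w * v) / (r + 4 * t)%:C)) z) <= (4 * t)^-1.
  move=> wzs; have wr := zsr w wzs; have nbw := nb w wzs.
  rewrite /ld (cderE (has_cderivM (has_cderivB (has_cderiv_cst _ z)
    (has_cderivZ (cj w) (has_cderiv_id z))) (has_cderiv_cst _ z))).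
  have gen (P Q c v : C) : P != 0 -> Q - c * v != 0 ->
      ((0 - c * 1) / P + (Q - c * v) * 0) / ((Q - c * v) / P) = - c / (Q - c * v).
    by move=> p0 q0; field; rewrite p0 q0.
  rewrite gen //.
  rewrite cmod_div cmodN cmod_cj ler_pdivrMr ?cmod_gt0 // mulrC ler_pdivlMr; last lra.
  apply: le_trans (cmod_leB _ _); rewrite cmodR cmodM cmod_cj gtr0_norm ?exprn_gt0 //; last lra.
  have := cmod_ge0 w; have := cmod_ge0 z; rewrite expr2; nra.
have l3 : cmod (ld h1 z) <= 32 * A * r / t ^+ 2.
  have := Hld r z ltac:(lra) zr; rewrite -/(ld h1 z) => /le_trans; apply.
  have -> : (r + 2 * t - (r + t)) * (r + t - r) = t ^+ 2 by ring.
  rewrite ler_wpM2r ?invr_ge0 ?sqr_ge0 //.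
  have : 0 <= B - ln (cmod (h1 0)) + 1.
    have : ln (cmod (h1 0)) <= ln (expR B).
      rewrite ler_ln ?posrE ?expR_gt0 ?cmod_gt0 ?h10 ?cmod0 //; last lra.
      by apply: h1B; rewrite cmod0; lra.
    by rewrite expRK; lra.
  have : B - ln (cmod (h1 0)) + 1 <= A by rewrite /A; lra.
  nra.
rewrite ldE; apply: le_trans (cmodD _ _) _.
have -> : 34 * A * r / t ^+ 2 = 32 * A * r / t ^+ 2 + 2 * A * r / t ^+ 2.
  by field; rewrite gt_eqF.
rewrite -addrA; apply: lerD => //.
apply: le_trans (cmod_sum _ _) _.
apply: (@le_trans _ _ (\sum_(w <- zs) ((cmod (z - w))^-1 + (4 * t)^-1))).
  rewrite big_seq [leRHS]big_seq; apply: ler_sum => w wzs.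
  by apply: le_trans (cmodB _ _) _; rewrite l1 cmodV lerD2l l2.
rewrite big_split /= addrC lerD2r big_const_seq count_predT iter_addr_0.
rewrite -[_ *+ size zs]mulr_natl ler_pdivrMr ?mulr_gt0 //.
have -> : 2 * A * r / t ^+ 2 * (4 * t) = 8 * (r * A / t) by field; rewrite gt_eqF.
have : 0 <= r * A / t by rewrite divr_ge0 ?mulr_ge0 // ?ltW //; lra.
by move: szA; rewrite -!mulrA; lra.
Qed.

End Blaschke.

(** * Choice of radii: Borel's growth lemma and rings free of zeros *)

Section Growth.
Variable R : realType.
Local Notation C := R[i].
Implicit Types (f g : C -> C) (z w a b : C) (r s t d e M : R) (zs : seq C).

(** Borel's lemma. If the claim failed at all radii, moving from [r] to [r * (1 + (Y r)^-1)] would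
    double [Y] each time, while the steps decrease geometrically; [Y] would be unbounded below
    radius [3 * r0]. *)
Lemma growth_radius (Y : R -> R) :
  (forall r s, 1 <= r -> r <= s -> Y r <= Y s) ->
  (forall c, exists2 r, 1 <= r & c <= Y r) ->
  forall c, exists r, [/\ 1 <= r, c <= Y r & Y (r * (1 + (Y r)^-1)) <= 2 * Y r].
Proof.
move=> mono unb c; apply: contrapT => H.
(* With [Y] at least [3 * 2 ^+ j] and [r <= 3 * r0], the [j]-th step is at most [r0 / 2 ^+ j], so
   the steps sum to at most [2 * r0]. *)
have [r0 r01 Yr0] := unb (Num.max c 3).
have Y3 : 3 <= Y r0 by move: Yr0; rewrite ge_max => /andP[].
have Yc : c <= Y r0 by move: Yr0; rewrite ge_max => /andP[].
have p2 n : 0 < 2 ^+ n :> R by rewrite exprn_gt0.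
have seqr j : exists r, [/\ r0 <= r, r <= r0 * (3 - 2 / 2 ^+ j) & 2 ^+ j * Y r0 <= Y r].
  elim: j => [|j [r [rr0 rj Yj]]].
    by exists r0; rewrite expr0 divr1 mul1r; split=> //; nra.
  have r1 : 1 <= r by lra.
  have Yrr := mono _ _ r01 rr0.
  have Yp : 0 < Y r by lra.
  have big : 2 * Y r < Y (r * (1 + (Y r)^-1)).
    by rewrite ltNge; apply/negP => h; apply: H; exists r; split=> //; lra.
  have i0 : 0 < (Y r)^-1 by rewrite invr_gt0.
  exists (r * (1 + (Y r)^-1)); split; first by nra.
  - have h1 : r * (Y r)^-1 <= r0 / 2 ^+ j.
      rewrite ler_pdivrMr // mulrAC ler_pdivlMr //.
      have h3 : r * 3 <= r0 * 3 * 3.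
        have : 0 <= r0 * (2 / 2 ^+ j) by rewrite !mulr_ge0 ?invr_ge0 ?(ltW (p2 j)) //; lra.
        nra.
      have h4 := ler_wpM2l (ltac:(lra) : 0 <= r0) Yj; apply: le_trans h4.
      apply: le_trans (_ : r0 * 3 * 2 ^+ j <= _).
        by rewrite ler_wpM2r ?(ltW (p2 j)) //; lra.
      rewrite -mulrA ler_wpM2l //; [lra | rewrite mulrC ler_wpM2l // ltW //].
    have -> : 2 / 2 ^+ j.+1 = 1 / 2 ^+ j :> R by rewrite exprS; field; rewrite gt_eqF.
    rewrite mulrDr mulr1.
    have -> : r0 * (3 - 1 / 2 ^+ j) = r0 * (3 - 2 / 2 ^+ j) + r0 / 2 ^+ j.
      by field; rewrite gt_eqF.
    exact: lerD.
  - by rewrite exprS; lra.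
have [j hj] := geom_small (Y (r0 * 3)) ltr01.
have [r [rr0 rj Yj]] := seqr j.
have r3 : r <= r0 * 3.
  have : 0 <= r0 * (2 / 2 ^+ j) by rewrite !mulr_ge0 ?invr_ge0 ?(ltW (p2 j)) //; lra.
  lra.
have := mono _ _ (le_trans r01 rr0) r3.
move: hj; rewrite ltr_pdivrMr // mul1r; have := p2 j; nra.
Qed.

(** Pigeonhole: among [(size zs).+1] adjacent rings, one contains no modulus of a listed point in
    its interior. Of its width [4 * s] only the middle half is kept, which leaves the distance
    [s]. *)
Lemma avoid_moduli zs r t : 0 < t ->
  let s := t / (4 * (size zs).+1%:R) in
  exists q, [/\ r <= q - s, q + s <= r + t &
    forall z w, q - s <= cmod z <= q + s -> w \in zs -> s <= cmod (z - w)].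
Proof.
move=> t0 s; set m := size zs; pose D := t / m.+1%:R.
have mp : 0 < m.+1%:R :> R by rewrite ltr0n.
have D0 : 0 < D by rewrite divr_gt0.
have sE : s = D / 4 by rewrite /s /D -/m; field; rewrite gt_eqF.
pose q (j : 'I_m.+1) := r + j%:R * D + D / 2.
pose bad j w := `|cmod w - q j| < D / 2.
have [j Hj] : exists j, ~~ has (bad j) zs.
  apply: contrapT => H.
  have allbad j : has (bad j) zs.
    by apply: contrapT => /negP h; apply: H; exists j.
  have fm j : (find (bad j) zs < m)%N by rewrite -has_find.
  pose phi j := Ordinal (fm j).
  have phi_inj : injective phi.
    move=> i j [E]; have := nth_find 0 (allbad i); have := nth_find 0 (allbad j).
    rewrite E /bad; set w := nth _ _ _ => h1 h2.
    have : `|q i - q j| < D.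
      rewrite (_ : q i - q j = (cmod w - q j) - (cmod w - q i)); last by ring.
      by apply: le_lt_trans (ler_normB _ _) _; lra.
    rewrite /q (_ : _ - _ = (i%:R - j%:R) * D); last by ring.
    rewrite normrM (gtr0_norm D0) -[X in _ < X]mul1r ltr_pM2r // => h.
    move: h; rewrite ltr_norml => /andP[a1 a2].
    apply/val_inj/eqP; rewrite eqn_leq; apply/andP.
    by split; rewrite -ltnS -(ltr_nat R) -natr1; lra.
  by have := leq_card phi phi_inj; rewrite !card_ord ltnn.
have jm : j%:R + 1 <= m.+1%:R :> R by rewrite natr1 ler_nat.
have DE : D * m.+1%:R = t by rewrite /D divfK // gt_eqF.
have j0 : 0 <= j%:R * D by rewrite mulr_ge0 // ltW.
exists (q j); rewrite sE; split.
- by rewrite /q; lra.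
- have : (j%:R + 1) * D <= t by rewrite -DE mulrC ler_wpM2l // ltW.
  by rewrite /q; lra.
- move=> z w /andP[z1 z2] /(hasPn Hj); rewrite /bad -leNgt => h.
  have := cmod_leB z w; have := cmod_leB w z; rewrite (cmodC w z).
  by move: h; rewrite ler_normr => /orP[]; lra.
Qed.

(** The zeros of all members are put into one list, so that a single ring avoids them all and the
    pole terms are at most their number divided by the width. [Q] absorbs both [(r + t) / t] and
    [t^-1]; the constant is [154 = 34 + 5 * 4 * 6]. *)
Lemma ring_log_deriv (I : finType) (h : I -> C -> C) B A Q r t :
  (forall i, entire (h i)) -> (forall i, h i 0 != 0) -> 0 < t <= r ->
  (forall i z, cmod z <= r + 6 * t -> cmod (h i z) <= expR B) ->
  1 <= A -> (forall i, B - ln (cmod (h i 0)) + 1 <= A) ->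
  1 <= Q -> r + t <= Q * t -> t^-1 <= Q ->
  exists q1 q2, [/\ r <= q1, q1 < q2, q2 <= r + t & forall i z, q1 <= cmod z <= q2 ->
    h i z != 0 /\ cmod (ld (h i) z) <= 154 * #|I|.+1%:R * (Q ^+ 3 * A ^+ 2)].
Proof.
move=> Hh h0 /andP[t0 tr] hB A1 hA Q1 rQ tQ.
have rt : 0 < r + t by lra.
have LD i : exists zs, (size zs)%:R <= 5 * (Q * A) /\ forall z, cmod z <= r + t ->
    (forall w, w \in zs -> z != w) -> h i z != 0 /\
    cmod (ld (h i) z) <= 34 * (Q ^+ 2 * A) + \sum_(w <- zs) (cmod (z - w))^-1.
  have [|zs [sz H]] := @log_deriv_bound _ (h i) B (r + t) t (Hh i) (h0 i) ltac:(lra).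
    by move=> z zr; apply: hB; lra.
  set Ai := B - _ + 1 in sz H.
  have rtQ : (r + t) / t <= Q by rewrite ler_pdivrMr.
  have rt0 : 0 <= (r + t) / t by rewrite divr_ge0 // ltW.
  have AiA : Ai <= A := hA i.
  have h1 : (r + t) / t * Ai <= Q * A.
    apply: le_trans (_ : (r + t) / t * A <= _); first by rewrite ler_wpM2l.
    by rewrite ler_wpM2r //; lra.
  exists zs; split=> [|z zr zw].
    apply: le_trans sz _; rewrite (_ : _ / t = 5 * ((r + t) / t * Ai)); last first.
      by field; rewrite gt_eqF.
    by rewrite ler_wpM2l.
  have [hz Hz] := H z zr zw; split=> //; apply: le_trans Hz _; rewrite lerD2r.
  rewrite (_ : _ / _ = 34 * ((r + t) / t * Ai * t^-1)); last by field; rewrite gt_eqF.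
  rewrite ler_wpM2l // (_ : Q ^+ 2 * A = Q * A * Q); last by ring.
  have ti : 0 <= t^-1 by rewrite invr_ge0 ltW.
  apply: le_trans (_ : Q * A * t^-1 <= _); first by rewrite ler_wpM2r.
  by rewrite ler_wpM2l // mulr_ge0 //; lra.
pose zs i := xget [::] (fun s : seq C => (size s)%:R <= 5 * (Q * A) /\ forall z,
    cmod z <= r + t -> (forall w, w \in s -> z != w) -> h i z != 0 /\
    cmod (ld (h i) z) <= 34 * (Q ^+ 2 * A) + \sum_(w <- s) (cmod (z - w))^-1).
have zsP i : (size (zs i))%:R <= 5 * (Q * A) /\ forall z,
    cmod z <= r + t -> (forall w, w \in zs i -> z != w) -> h i z != 0 /\
    cmod (ld (h i) z) <= 34 * (Q ^+ 2 * A) + \sum_(w <- zs i) (cmod (z - w))^-1.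
  exact: (xgetPex [::] (LD i)).
pose all := flatten [seq zs i | i <- enum I].
have QA1 : 1 <= Q * A by nra.
have szall : (size all).+1%:R <= 6 * #|I|.+1%:R * (Q * A).
  rewrite -[(size all).+1%:R]natr1 -[#|I|.+1%:R]natr1.
  rewrite size_flatten /shape sumnE 2!big_map natr_sum.
  apply: le_trans (_ : \sum_(i <- enum I) (5 * (Q * A)) + 1 <= _).
    by rewrite lerD2r; apply: ler_sum => i _; have [] := zsP i.
  rewrite big_const_seq count_predT iter_addr_0 -cardE -[_ *+ #|I|]mulr_natl.
  have : 0 <= #|I|%:R * (Q * A) by rewrite mulr_ge0 //; lra.
  lra.
have [q [q1 q2 Hq]] := @avoid_moduli all r t t0.
set s := t / _ in q1 q2 Hq.
have sp : 0 < 4 * (size all).+1%:R :> R by rewrite mulr_gt0 // ltr0n.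
have s0 : 0 < s by rewrite divr_gt0.
exists (q - s), (q + s); split=> //; first lra.
move=> i z zq; have [zi Hz] := zsP i.
have inall w : w \in zs i -> w \in all.
  by move=> wi; apply/flatten_mapP; exists i => //; rewrite mem_enum.
have [| |hz ldz] := Hz z.
- by case/andP: zq => _ /le_trans; apply.
- move=> w /inall wa; apply/eqP => E; have := Hq z w zq wa.
  by rewrite E subrr cmod0; lra.
split=> //; apply: le_trans ldz _.
have sum_le : \sum_(w <- zs i) (cmod (z - w))^-1 <= 5 * (Q * A) * s^-1.
  apply: le_trans (_ : \sum_(w <- zs i) s^-1 <= _).
    rewrite big_seq [leRHS]big_seq; apply: ler_sum => w /inall wa.
    have := Hq z w zq wa => h1; rewrite lef_pV2 ?posrE //; lra.
  rewrite big_const_seq count_predT iter_addr_0 -[_ *+ size _]mulr_natl.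
  by rewrite ler_wpM2r // invr_ge0 ltW.
have si : s^-1 <= 4 * (6 * #|I|.+1%:R * (Q * A)) * Q.
  rewrite /s invf_div; apply: ler_pM; rewrite ?invr_ge0 ?(ltW sp) ?(ltW t0) //.
  by rewrite ler_wpM2l.
have N1 : 1 <= #|I|.+1%:R :> R by rewrite ler1n.
have : 5 * (Q * A) * s^-1 <= 5 * (Q * A) * (4 * (6 * #|I|.+1%:R * (Q * A)) * Q).
  by rewrite ler_wpM2l // mulr_ge0 //; lra.
have -> : 5 * (Q * A) * (4 * (6 * #|I|.+1%:R * (Q * A)) * Q) =
  120 * #|I|.+1%:R * (Q ^+ 3 * A ^+ 2) by ring.
have : Q ^+ 2 * A <= #|I|.+1%:R * (Q ^+ 3 * A ^+ 2).
  have -> : #|I|.+1%:R * (Q ^+ 3 * A ^+ 2) = #|I|.+1%:R * (Q * A) * (Q ^+ 2 * A) by ring.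
  rewrite -[X in X <= _]mul1r ler_wpM2r //; last nra.
  by rewrite mulr_ge0 ?sqr_ge0 //; lra.
lra.
Qed.

End Growth.

(** * Boundedness from an inequality with logarithmic derivatives *)

Section GrowthContradiction.
Variable R : realType.
Local Notation C := R[i].
Implicit Types (f g : C -> C) (z w a b : C) (r s t d e M : R).

Definition max_modulus f g r : R :=
  sup [set x | exists2 z, cmod z <= r & x = cmod (f z) + cmod (g z)]%classic.

Lemma max_modulus_has_sup f g r : entire f -> entire g -> 0 <= r ->
  has_sup [set x | exists2 z, cmod z <= r & x = cmod (f z) + cmod (g z)]%classic.
Proof.
move=> Hf Hg r0; split; first by exists (cmod (f 0) + cmod (g 0)), 0; rewrite ?cmod0.
have [M HM] := entire_bounded r Hf; have [N HN] := entire_bounded r Hg.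
by exists (M + N) => _ [z zr ->]; rewrite lerD ?HM ?HN.
Qed.

Lemma le_max_modulus f g r z : entire f -> entire g -> cmod z <= r ->
  cmod (f z) + cmod (g z) <= max_modulus f g r.
Proof.
move=> Hf Hg zr; apply: sup_upper_bound; last by exists z.
exact: max_modulus_has_sup Hf Hg (le_trans (cmod_ge0 z) zr).
Qed.

Lemma max_modulus_le f g r M : 0 <= r ->
  (forall z, cmod z <= r -> cmod (f z) + cmod (g z) <= M) -> max_modulus f g r <= M.
Proof.
move=> r0 H; apply: ge_sup => [|_ [z zr ->]]; last exact: H.
by exists (cmod (f 0) + cmod (g 0)), 0; rewrite ?cmod0.
Qed.

(** The cubic term of the exponential series already exceeds the quadratic; its denominator 6
    explains the threshold. *)
Lemma cubic_lt_expR (K y : R) : 0 <= K -> 6 * (K + 4) + 1 <= y -> K * y ^+ 2 + 4 < expR y.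
Proof.
move=> K0 hy; have yp : 0 < y by lra.
have := expR_ge1Dxn 2 (ltW yp).
have -> : (3`!)%:R = 6 :> R by [].
have : y ^+ 2 * (6 * (K + 4) + 1) <= y ^+ 3 by rewrite [y ^+ 3]exprSr ler_wpM2l ?sqr_ge0.
have : 1 <= y ^+ 2 by rewrite exprn_ege1 //; lra.
nra.
Qed.

Lemma power_bound_expR (K L y x : R) (p : nat) : 1 <= K -> 0 <= L -> 1 <= y -> 0 <= x ->
  x <= L * expR (2 * y) ^+ 5 ->
  K * (1 + x) ^+ p <= expR ((ln (K * (1 + L) ^+ p) + 10 * p%:R) * y).
Proof.
move=> K1 L0 y1 x0 hx; set T := expR (2 * y) in hx *.
have T1 : 1 <= T by have := expR_ge1Dx (2 * y); rewrite /T; lra.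
have T5 : 1 <= T ^+ 5 by rewrite exprn_ege1.
have K4 : 1 <= K * (1 + L) ^+ p.
  have : 1 <= (1 + L) ^+ p by rewrite exprn_ege1 //; lra.
  by nra.
apply: (@le_trans _ _ (K * ((1 + L) * T ^+ 5) ^+ p)).
  apply: ler_wpM2l; first by lra.
  by rewrite lerXn2r ?nnegrE; nra.
rewrite exprMn mulrA -exprM.
have -> : (ln (K * (1 + L) ^+ p) + 10 * p%:R) * y =
    ln (K * (1 + L) ^+ p) * y + (5 * p)%:R * (2 * y) by rewrite natrM; ring.
rewrite expRD expRM_natl -/T; apply: ler_wpM2r.
  by rewrite exprn_ge0 //; lra.
rewrite -[X in X <= _]lnK ?posrE ?ler_expR; last lra.
have := ln_ge0 K4; nra.
Qed.

(** The weight [1 + |f| + |g|] makes [E], [E f] and [E g] bounded on the ring, hence inside it.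
    [quotient_bound] with step [t / 2] uses radii up to [r + 2 * t], within the inner radius
    [q1]. *)
Lemma ring_quotient_bound f g (E : C -> C) S r t q1 q2 :
  entire f -> entire g -> entire E -> E 0 != 0 -> 0 < r -> 0 < t ->
  r + 2 * t <= q1 -> q1 < q2 ->
  (forall z, q1 <= cmod z <= q2 ->
     cmod (E z) * (1 + cmod (f z) + cmod (g z)) <= expR S) ->
  forall z, cmod z <= r -> cmod (f z) + cmod (g z) <=
    2 * expR ((S - ln (cmod (E 0)) + 1) * (1 + 8 * (r / t))).
Proof.
move=> Hf Hg HE E0 rp tp r2q1 q12 EB z zr.
have Eb w : cmod w <= r + 4 * (t / 2) -> cmod (E w) <= expR S.
  move=> wr; apply: (@ring_max _ E q1 q2) => //; [lra | by move=> v _; exact: HE | | lra].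
  move=> v /EB; apply: le_trans; rewrite -[X in X <= _]mulr1 ler_wpM2l ?cmod_ge0 //.
  have := cmod_ge0 (f v); have := cmod_ge0 (g v); lra.
have Eu (u : C -> C) : entire u -> (forall v, cmod (u v) <= 1 + cmod (f v) + cmod (g v)) ->
    forall w, cmod w <= r + 4 * (t / 2) -> cmod (E w * u w) <= expR S.
  move=> Hu hu w wr; apply: (@ring_max _ (fun z => E z * u z) q1 q2) => //.
  - by lra.
  - by move=> v _; exact: cdiffM (HE v) (Hu v).
  - by move=> v /EB; apply: le_trans; rewrite cmodM ler_wpM2l ?cmod_ge0.
  - by lra.
have t20 : 0 < t / 2 by lra.
have := quotient_bound HE Hf E0 rp t20 Eb (Eu f Hf _) zr.
have := quotient_bound HE Hg E0 rp t20 Eb (Eu g Hg _) zr.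
have -> : 4 * r / (t / 2) = 8 * (r / t) by field; rewrite gt_eqF.
move=> h1 h2; rewrite mulr2n mulrDl !mul1r; apply: lerD.
  by apply: h2 => v; have := cmod_ge0 (g v); lra.
by apply: h1 => v; have := cmod_ge0 (f v); lra.
Qed.

Lemma log_deriv_sum_bound (m N K y T : R) : 0 <= m <= N -> 0 <= y <= T ->
  m * (154 * N * ((13 * y) ^+ 3 * (K * T) ^+ 2)) <=
  N * (154 * N * (13 ^+ 3 * K ^+ 2)) * T ^+ 5.
Proof.
move=> /andP[m0 mN] /andP[y0 yT].
have E (c d : R) : N * (c * N * (d ^+ 3 * K ^+ 2)) * T ^+ 5 =
    N * (c * N * ((d * T) ^+ 3 * (K * T) ^+ 2)) by ring.
rewrite E.
have KT := sqr_ge0 (K * T); have N0 := le_trans m0 mN; have T0 := le_trans y0 yT.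
have c0 (x : R) : 0 <= x -> 0 <= 154 * N * ((13 * x) ^+ 3 * (K * T) ^+ 2).
  move=> x0; apply: mulr_ge0; first exact: mulr_ge0.
  by rewrite mulr_ge0 // exprn_ge0 // mulr_ge0.
apply: ler_pM => //; first exact: c0.
apply: ler_wpM2l; first exact: mulr_ge0.
by rewrite ler_wpM2r // lerXn2r ?nnegrE ?mulr_ge0 // ler_wpM2l.
Qed.

Lemma h_bound_expR (K T y : R) (q : nat) : 1 <= K -> 1 <= y ->
  K * (expR T / (10 * y)^-1) ^+ q <= expR (ln K + q%:R * (T + 10 * y)).
Proof.
move=> K1 y1; rewrite expRD lnK ?posrE; last lra.
rewrite ler_wpM2l //; first lra.
rewrite expRM_natl invrK lerXn2r ?nnegrE ?expR_ge0 ?mulr_ge0 ?expR_ge0 //; first lra.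
rewrite expRD ler_wpM2l ?expR_ge0 //.
by have := expR_ge1Dx (10 * y); lra.
Qed.

Section Contradiction.
Variables (I : finType) (h : I -> C -> C) (f g E : C -> C) (K : R) (p q : nat).
Hypotheses (Hf : entire f) (Hg : entire g) (HE : entire E) (Hh : forall i, entire (h i)).
Hypotheses (h0 : forall i, h i 0 != 0) (E0 : E 0 != 0) (K1 : 1 <= K).
Hypothesis hgrow : forall i z d M, 0 < d <= 1 -> 1 <= M ->
  (forall w, cmod (w - z) <= d -> cmod (f w) + cmod (g w) <= M) ->
  cmod (h i z) <= K * (M / d) ^+ q.
Hypothesis Eineq : forall z, (forall i, h i z != 0) ->
  cmod (E z) * (1 + cmod (f z) + cmod (g z)) <=
  K * (1 + \sum_i cmod (ld (h i) z)) ^+ p.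

(* The logarithmic derivatives are at most a power of [exp y] on some circle just outside
   [|z| <= r], hence so are [E], [E f] and [E g] inside it; [f = (E f) / E] is then bounded by
   dividing out the zeros of [E] with Blaschke factors. *)
Lemma growth_step : exists2 K', 0 <= K' & forall r y, 1 <= r -> 1 <= y ->
  (forall z, cmod z <= r * (1 + y^-1) -> cmod (f z) + cmod (g z) <= expR (expR (2 * y))) ->
  forall z, cmod z <= r -> cmod (f z) + cmod (g z) <= 2 * expR (K' * y ^+ 2).
Proof.
have K1' := K1.
pose lam := \sum_i `|ln (cmod (h i 0))| + `|ln (cmod (E 0))|.
have lam_h i : - ln (cmod (h i 0)) <= lam.
  apply: le_trans (ler_norm _) _; rewrite normrN /lam (bigD1 i) //= -addrA lerDl.
  by rewrite addr_ge0 // sumr_ge0.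
have lam_E : - ln (cmod (E 0)) <= lam.
  by apply: le_trans (ler_norm _) _; rewrite normrN lerDr sumr_ge0.
have lam0 : 0 <= lam by rewrite addr_ge0 // sumr_ge0.
move: lam lam_h lam_E lam0 => lam lam_h lam_E lam0.
have lnK0 : 0 <= ln K by exact: ln_ge0.
have q0 : 0 <= q%:R :> R by [].
have p0 : 0 <= p%:R :> R by [].
have [K2 K2E] : exists x, x = ln K + 11 * q%:R + lam + 1 by eexists.
have K21 : 1 <= K2 by rewrite K2E; lra.
pose K3 : R := #|I|.+1%:R * (154 * #|I|.+1%:R * (13 ^+ 3 * K2 ^+ 2)).
have K30 : 0 <= K3.
  apply: mulr_ge0; first exact: ler0n.
  apply: mulr_ge0; first by apply: mulr_ge0; exact: ler0n.
  by apply: mulr_ge0; [apply: exprn_ge0; exact: ler0n | exact: sqr_ge0].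
pose K5 := ln (K * (1 + K3) ^+ p) + 10 * p%:R.
have K50 : 0 <= K5.
  have h1 : 1 <= (1 + K3) ^+ p by rewrite exprn_ege1 // lerDl.
  have : 0 <= ln (K * (1 + K3) ^+ p) by apply: ln_ge0; have := ler_pM ler01 ler01 K1' h1; rewrite mulr1.
  by rewrite /K5; lra.
(* The exponent [1 + 8 * (r / t) = 1 + 80 * y] is at most [81 * y]; [lam] pays for the values at the
   origin. *)
exists ((K5 + lam + 1) * 81); first by rewrite mulr_ge0 //; lra.
move=> r y r1 y1 fgB.
have yp : 0 < y by lra.
pose Th := expR (2 * y).
have Thy : y <= Th by have := expR_ge1Dx (2 * y); rewrite /Th; lra.
have Th1 : 1 <= Th by lra.
(* Ten steps fill the gap up to [r * (1 + y^-1)]: two between the disc and the ring, six for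
   [ring_log_deriv], and at most one for the radius [(10 * y)^-1] used in [hgrow]. *)
have [t tE] : exists t, t = r / (10 * y) by eexists.
have tp : 0 < t by rewrite tE divr_gt0 //; lra.
have rt : r = 10 * y * t by rewrite tE; field; rewrite gt_eqF.
have tr : t <= r by rewrite rt; nra.
have dt : (10 * y)^-1 <= t.
  rewrite tE -[X in X <= _]mul1r ler_wpM2r // invr_ge0; lra.
have hB i z : cmod z <= r + 2 * t + 6 * t -> cmod (h i z) <= expR (ln K + q%:R * (Th + 10 * y)).
  move=> zr; apply: le_trans (h_bound_expR Th q K1' y1).
  apply: hgrow.
  - by rewrite invr_gt0 invf_le1; lra.
  - by rewrite -expR0 ler_expR; lra.
  - move=> w wz; apply: fgB.
    have -> : r * (1 + y^-1) = r + 10 * t by rewrite tE; field; rewrite gt_eqF.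
    by have := cmodD (w - z) z; rewrite subrK; lra.
have A1 : 1 <= K2 * Th by nra.
have hA i : ln K + q%:R * (Th + 10 * y) - ln (cmod (h i 0)) + 1 <= K2 * Th.
  have := lam_h i; rewrite K2E.
  have : q%:R * y <= q%:R * Th by rewrite ler_wpM2l.
  have : ln K * 1 <= ln K * Th by rewrite ler_wpM2l.
  have : lam * 1 <= lam * Th by rewrite ler_wpM2l.
  lra.
have tp' : 0 < t <= r + 2 * t by lra.
(* [r] is [10 * y * t], and the three extra steps are absorbed by [y >= 1]. *)
have rQ : r + 2 * t + t <= (13 * y) * t by rewrite rt; nra.
have tQ : t^-1 <= 13 * y.
  rewrite tE invf_div ler_pdivrMr; last lra.
  nra.
have [q1 [q2 [r2q1 q12 q2r Hq]]] :=
  ring_log_deriv Hh h0 tp' hB A1 hA (ltac:(lra) : 1 <= 13 * y) rQ tQ.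
have EB z : q1 <= cmod z <= q2 -> cmod (E z) * (1 + cmod (f z) + cmod (g z)) <= expR (K5 * y).
  move=> zq; apply: le_trans (Eineq (fun i => proj1 (Hq i z zq))) _.
  apply: power_bound_expR => //.
    by rewrite sumr_ge0 // => i _; exact: cmod_ge0.
  apply: le_trans (@log_deriv_sum_bound #|I|%:R #|I|.+1%:R K2 y Th _ _).
  - rewrite mulr_natl -sumr_const; apply: ler_sum => i _.
    by have [] := Hq i z zq.
  - by rewrite ler0n ler_nat leqnSn.
  - by rewrite (ltW yp).
have rp : 0 < r by lra.
move=> z zr; apply: le_trans (ring_quotient_bound Hf Hg HE E0 rp tp r2q1 q12 EB zr) _.
rewrite ler_wpM2l // ler_expR.
have -> : 8 * (r / t) = 80 * y by rewrite rt; field; rewrite gt_eqF.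
have -> : (K5 + lam + 1) * 81 * y ^+ 2 = (K5 + lam + 1) * y * (81 * y) by ring.
have e1 : K5 * y - ln (cmod (E 0)) + 1 <= (K5 + lam + 1) * y.
  have : (lam + 1) * 1 <= (lam + 1) * y by rewrite ler_wpM2l //; lra.
  by lra.
apply: (@le_trans _ _ ((K5 + lam + 1) * y * (1 + 80 * y))).
  by rewrite ler_wpM2r //; lra.
by rewrite ler_wpM2l ?mulr_ge0 //; lra.
Qed.

(** Borel's lemma is applied to [Y = ln T]: on passing to the larger radius [T] at most squares,
    which is the hypothesis of [growth_step] with [y = Y r]. *)
Lemma growth_contradiction0 : ~ (forall M, exists z, M < cmod (f z) + cmod (g z)).
Proof.
move=> unb; have [K' K'0 step] := growth_step.
pose T r := ln (3 + max_modulus f g r).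
have mm0 r : 0 <= r -> 0 <= max_modulus f g r.
  move=> r0; apply: le_trans (le_max_modulus (z := 0) Hf Hg _); rewrite ?cmod0 //.
  by rewrite addr_ge0 // cmod_ge0.
have mmono r s : 0 <= r -> r <= s -> max_modulus f g r <= max_modulus f g s.
  by move=> r0 rs; apply: max_modulus_le => // z zr; apply: le_max_modulus => //; lra.
have Tmono r s : 0 <= r -> r <= s -> T r <= T s.
  move=> r0 rs; rewrite ler_ln ?posrE ?lerD2l ?mmono //.
    by have := mm0 r r0; lra.
  by have := mm0 s (le_trans r0 rs); lra.
have T1 r : 0 <= r -> 0 < T r.
  by move=> r0; apply: ln_gt0; have := mm0 r r0; lra.
pose Y r := ln (T r).
have Ymono r s : 1 <= r -> r <= s -> Y r <= Y s.
  by move=> r1 rs; rewrite ler_ln ?posrE ?T1 ?Tmono //; lra.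
have Yunb c : exists2 r, 1 <= r & c <= Y r.
  have [z hz] := unb (expR (expR c)).
  have m1 : 0 <= Num.max 1 (cmod z) by rewrite le_max ler01.
  exists (Num.max 1 (cmod z)); first by rewrite le_max lexx.
  rewrite -[c]expRK ler_ln ?posrE ?expR_gt0 ?T1 //.
  rewrite -[expR c]expRK ler_ln ?posrE ?expR_gt0 //; last by have := mm0 _ m1; lra.
  have := @le_max_modulus f g (Num.max 1 (cmod z)) z Hf Hg.
  by rewrite le_max lexx orbT => /(_ isT); lra.
have [r [r1 Yr YR]] := growth_radius Ymono Yunb (6 * (K' + 4) + 1).
have r0 : 0 <= r by lra.
have [y yE] : exists y, y = Y r by exists (Y r).
rewrite -yE in Yr YR.
have y1 : 1 <= y by lra.
have Tr : T r = expR y by rewrite yE lnK ?posrE // T1.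
have mmB : max_modulus f g r <= 2 * expR (K' * y ^+ 2).
  apply: max_modulus_le => //; apply: step => // z zr.
  have R0 : 0 <= r * (1 + y^-1) by rewrite mulr_ge0 // addr_ge0 // invr_ge0; lra.
  apply: le_trans (le_max_modulus Hf Hg zr) _.
  have : T (r * (1 + y^-1)) <= expR (2 * y).
    by rewrite -[X in X <= _](lnK (T1 _ R0)) ler_expR.
  rewrite -ler_expR /T lnK ?posrE; last by have := mm0 _ R0; lra.
  lra.
(* [T r] equals [expR y], but [growth_step] bounds it by [K' * y ^+ 2 + 4]. *)
have := cubic_lt_expR K'0 Yr; rewrite ltNge => /negP; apply.
have e1 : 1 <= expR (K' * y ^+ 2).
  by rewrite -expR0 ler_expR mulr_ge0 // sqr_ge0.
rewrite -Tr /T -[leRHS]expRK ler_ln ?posrE ?expR_gt0 //; last first.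
  by have := mm0 r r0; lra.
by rewrite expRD; have := expR_ge1Dx (4 : R); nra.
Qed.

End Contradiction.

End GrowthContradiction.

(** * Liouville's theorem, the growth theorem without normalisation, Picard's little theorem *)

Section Picard.
Variable R : realType.
Local Notation C := R[i].
Implicit Types (f g : C -> C) (z w a b : C) (r s t d e M : R).

Lemma liouville f M : entire f -> (forall z, cmod (f z) <= M) -> forall z, f z = f 0.
Proof.
move=> Hf fM z; apply/eqP; rewrite -subr_eq0; apply/eqP/cmod_small => e e0.
have M0 : 0 <= M := le_trans (cmod_ge0 (f 0)) (fM 0).
pose s := cmod z + 4 * M * cmod z / e + 1.
have x0 : 0 <= 4 * M * cmod z by rewrite !mulr_ge0 // cmod_ge0.
have y0 : 0 <= 4 * M * cmod z / e by rewrite divr_ge0 // ltW.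
have z0 := cmod_ge0 z.
have s0 : 0 < s by rewrite /s; lra.
have := @lipschitz_center _ f 0 s M s0 (fun z _ => Hf z) (fun z _ => fM z) z.
rewrite subr0 => /(_ ltac:(rewrite /s; lra)) /le_trans; apply.
rewrite mulrAC ler_pdivrMr // -ler_pdivrMl // mulrC /s; lra.
Qed.

Lemma entire_cder0 f : entire f -> (forall z, cder f z = 0) -> forall z, f z = f 0.
Proof.
move=> Hf H z; apply: (@zero_deriv_const _ f (cmod z + 1)); last by lra.
by move=> w _; rewrite -(H w); exact: cderP.
Qed.

Lemma not_zeroP f : ~ (forall z, f z = 0) -> exists z, f z != 0.
Proof.
by move=> nf; apply: contrapT => h; apply: nf => z; apply: contrapT => /eqP ?; apply: h; exists z.
Qed.

Lemma entire_prod_nonzero (I : eqType) (s : seq I) (h : I -> C -> C) :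
  (forall i, entire (h i)) -> (forall i, i \in s -> ~ (forall z, h i z = 0)) ->
  exists z, forall i, i \in s -> h i z != 0.
Proof.
move=> Hh; elim: s => [|i s IH] H; first by exists 0.
have [|z0 hz0] := IH; first by move=> j js; apply: H; rewrite inE js orbT.
have Hp : entire (fun z => \prod_(j <- s) h j z) by move=> z; apply: cdiff_prod => j; exact: Hh.
have np : ~ (forall z, \prod_(j <- s) h j z = 0).
  by move=> /(_ z0)/eqP; rewrite prodf_seq_eq0 => /hasP[j /hz0 /negPf ->].
have [z] : exists z, h i z * \prod_(j <- s) h j z != 0.
  apply: (@not_zeroP (fun z => h i z * \prod_(j <- s) h j z)).
  by move=> /(entire_integral (Hh i) Hp)[|//]; apply: H; rewrite inE eqxx.
rewrite mulf_eq0 negb_or prodf_seq_neq0 => /andP[hi /allP hs].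
by exists z => j; rewrite inE => /orP[/eqP ->//|/hs].
Qed.

Lemma cder_shift f c z : cdiff f (z + c) -> cder (fun w => f (w + c)) z = cder f (z + c).
Proof. by move=> /cderP/has_cderiv_shift/cderE. Qed.

(** The hypotheses are invariant under translation, so the origin can be moved to a point where
    neither [E] nor any [h i] vanishes; [option I] lists them all. *)
Lemma growth_contradiction (I : finType) (h : I -> C -> C) f g (E : C -> C)
    (K : R) (p q : nat) :
  entire f -> entire g -> entire E -> (forall i, entire (h i)) ->
  (forall i, ~ (forall z, h i z = 0)) -> ~ (forall z, E z = 0) -> 1 <= K ->
  (forall i z d M, 0 < d <= 1 -> 1 <= M ->
     (forall w, cmod (w - z) <= d -> cmod (f w) + cmod (g w) <= M) ->
     cmod (h i z) <= K * (M / d) ^+ q) ->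
  (forall z, (forall i, h i z != 0) ->
     cmod (E z) * (1 + cmod (f z) + cmod (g z)) <=
     K * (1 + \sum_i cmod (ld (h i) z)) ^+ p) ->
  exists M, forall z, cmod (f z) + cmod (g z) <= M.
Proof.
move=> Hf Hg HE Hh nh nE K1 hgrow Eineq.
pose hE (i : option I) := if i is Some j then h j else E.
have [c Hc] : exists c, forall i, i \in enum {: option I} -> hE i c != 0.
  apply: entire_prod_nonzero => [[i|]|[i|] _]; [exact: Hh | exact: HE | exact: nh | exact: nE].
have hc i : h i c != 0 by apply: (Hc (Some i)); rewrite mem_enum.
have Ec : E c != 0 by apply: (Hc None); rewrite mem_enum.
apply: contrapT => H.
apply: (@growth_contradiction0 _ I (fun i z => h i (z + c)) (fun z => f (z + c))
  (fun z => g (z + c)) (fun z => E (z + c)) K p q) => //.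
- exact: entire_shift.
- exact: entire_shift.
- exact: entire_shift.
- by move=> i; exact: entire_shift.
- by move=> i; rewrite add0r.
- by rewrite add0r.
- move=> i z d M d1 M1 fM; apply: (hgrow i (z + c) d M) => // w wz.
  by have := fM (w - c); rewrite subrK; apply; rewrite -addrA -opprD (addrC c).
- move=> z hz; apply: le_trans (Eineq (z + c) hz) _.
  rewrite le_eqVlt; apply/orP; left; apply/eqP; congr (_ * (_ + _) ^+ _).
  by apply: eq_bigr => i _; rewrite /ld cder_shift //; exact: Hh.
- move=> M; apply: contrapT => nM; apply: H; exists M => z.
  rewrite leNgt; apply/negP => hz; apply: nM; exists (z - c).
  by rewrite subrK.
Qed.

(** A point closer to [a] has distance at least [cmod (a - b) / 2] from [b]. So only the nearest of
    several points can make a factor small; the other factors grow like [1 + cmod w]. *)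
Lemma far_point a b w : a != b -> cmod (w - a) <= cmod (w - b) ->
  1 + cmod w <= (1 + 2 * (1 + cmod b) / cmod (a - b)) * cmod (w - b).
Proof.
move=> ab h; have c0 : 0 < cmod (a - b) by rewrite cmod_gt0 subr_eq0.
have h1 : cmod (a - b) <= 2 * cmod (w - b).
  by have := cmod_dist a w b; rewrite (cmodC a w); lra.
have h2 : 1 + cmod b <= 2 * (1 + cmod b) / cmod (a - b) * cmod (w - b).
  rewrite mulrAC ler_pdivlMr //; have := cmod_ge0 b; nra.
have := cmodD (w - b) b; rewrite subrK; lra.
Qed.

Lemma cder_subc f z a : cdiff f z -> cder (fun w => f w - a) z = cder f z.
Proof.
by move=> df; rewrite (cderE (has_cderivB (cderP df) (has_cderiv_cst a z))) subr0.
Qed.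

(** The growth theorem is applied to [g' / ((g - a) * (g - b))], with [g] in both roles. The factor
    of the nearer omitted value joins [g'] in a logarithmic derivative; the other one compensates
    [1 + |g|] by [far_point]. *)
Lemma little_picard g a b : entire g -> a != b ->
  (forall z, g z != a) -> (forall z, g z != b) -> forall z, g z = g 0.
Proof.
move=> Hg ab ga gb; apply: contrapT => ng.
have da z : g z - a != 0 by rewrite subr_eq0.
have db z : g z - b != 0 by rewrite subr_eq0.
pose E z := cder g z / ((g z - a) * (g z - b)).
have HE : entire E.
  move=> z; apply: cdiff_div; [by rewrite mulf_neq0 | exact: entire_cder |].
  by apply: cdiffM; apply: cdiffB (Hg z) (cdiff_cst _ _).
have nE : ~ (forall z, E z = 0).
  move=> H; apply: ng; apply: entire_cder0 => // z; move/eqP: (H z).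
  by rewrite mulf_eq0 invr_eq0 mulf_eq0 (negPf (da z)) (negPf (db z)) !orbF => /eqP.
pose Ca := 1 + 2 * (1 + cmod a) / cmod (b - a).
pose Cb := 1 + 2 * (1 + cmod b) / cmod (a - b).
have Ca1 : 1 <= Ca by rewrite lerDl divr_ge0 ?mulr_ge0 ?addr_ge0 ?cmod_ge0.
have Cb1 : 1 <= Cb by rewrite lerDl divr_ge0 ?mulr_ge0 ?addr_ge0 ?cmod_ge0.
have a0 := cmod_ge0 a; have b0 := cmod_ge0 b.
pose K := 2 * (Ca + Cb) + 1 + cmod a + cmod b.
have [M HM] : exists M, forall z, cmod (g z) + cmod (g z) <= M.
  apply: (@growth_contradiction bool (fun i z => g z - if i then a else b) g g E K 1 1) => //.
  - by move=> i z; exact: cdiffB (Hg z) (cdiff_cst _ _).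
  - by move=> [] H; [have := da 0 | have := db 0]; rewrite H eqxx.
  - by rewrite /K; lra.
  - move=> i z d M /andP[d0 d1] M1 gM; have := gM z; rewrite subrr cmod0 => /(_ (ltW d0)) gz.
    have Md : M <= M / d by rewrite ler_pdivlMr //; nra.
    have := cmodB (g z) (if i then a else b); rewrite expr1.
    have : cmod (if i then a else b) <= cmod a + cmod b by case: i; lra.
    have : K * M <= K * (M / d) by rewrite ler_wpM2l // /K; lra.
    have := cmod_ge0 (g z); rewrite /K; nra.
  - move=> z _; rewrite expr1 /index_enum big_bool /= /ld !cder_subc; try exact: Hg.
    rewrite !cmod_div !cmodM.
    have A0 : 0 < cmod (g z - a) by rewrite cmod_gt0.
    have B0 : 0 < cmod (g z - b) by rewrite cmod_gt0.
    have D0 := cmod_ge0 (cder g z).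
    set A := cmod (g z - a) in A0 *; set B := cmod (g z - b) in B0 *; set D := cmod (cder g z) in D0 *.
    have DA0 : 0 <= D / A by rewrite divr_ge0 // ltW.
    have DB0 : 0 <= D / B by rewrite divr_ge0 // ltW.
    have K0 : 0 <= K by rewrite /K; lra.
    have gz0 := cmod_ge0 (g z).
    have [AB|BA] := lerP A B.
      have := far_point ab AB; rewrite -/B -/Cb => h.
      have -> : D / (A * B) = D / A / B by field; rewrite !gt_eqF.
      have h2 : (1 + cmod (g z) + cmod (g z)) <= 2 * Cb * B by lra.
      have : D / A / B * (1 + cmod (g z) + cmod (g z)) <= D / A / B * (2 * Cb * B).
        by rewrite ler_wpM2l // divr_ge0 // ltW.
      have -> : D / A / B * (2 * Cb * B) = 2 * Cb * (D / A) by field; rewrite !gt_eqF.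
      have : 2 * Cb * (D / A) <= K * (D / A) by rewrite ler_wpM2r // /K; lra.
      have := mulr_ge0 K0 DB0; rewrite !mulrDr mulr1; lra.
    have := far_point (ltac:(by rewrite eq_sym) : b != a) (ltW BA); rewrite -/A -/Ca => h.
    have -> : D / (A * B) = D / B / A by field; rewrite !gt_eqF.
    have h2 : (1 + cmod (g z) + cmod (g z)) <= 2 * Ca * A by lra.
    have : D / B / A * (1 + cmod (g z) + cmod (g z)) <= D / B / A * (2 * Ca * A).
      by rewrite ler_wpM2l // divr_ge0 // ltW.
    have -> : D / B / A * (2 * Ca * A) = 2 * Ca * (D / B) by field; rewrite !gt_eqF.
    have : 2 * Ca * (D / B) <= K * (D / B) by rewrite ler_wpM2r // /K; lra.
    have := mulr_ge0 K0 DA0; rewrite !mulrDr mulr1; lra.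
apply: ng; apply: (@liouville g M) => // z.
by have := HM z; have := cmod_ge0 (g z); lra.
Qed.

End Picard.

Ltac cdiff_solve := lazymatch goal with
  | |- cdiff (fun=> ?c) _ => exact: cdiff_cst
  | |- cdiff (fun w => - (@?f w)) _ => apply (@cdiffN _ f); cdiff_solve
  | |- cdiff (fun w => @?f w + @?g w) _ => apply (@cdiffD _ f g); cdiff_solve
  | |- cdiff (fun w => @?f w * @?g w) _ => apply (@cdiffM _ f g); cdiff_solve
  | |- cdiff (fun w => @?f w ^+ ?n) _ => apply (@cdiffX _ f _ n); cdiff_solve
  | H : cdiff ?f ?z |- cdiff (fun w => ?f w) ?z => exact H
  | H : cdiff ?f ?z |- cdiff ?f ?z => exact H
  | |- _ => idtac
  end.

(** * Orders of vanishing at shared points *)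

Section LocalAnalysis.
Variable R : realType.
Local Notation C := R[i].
Implicit Types (f g u v e A B U V : C -> C) (z w a b : C) (d M : R).

(** A local quotient has to be differentiable only at the zero [z0] itself: nearby [D] has no other
    zero, so there its values are forced to be [N / D]. *)
Lemma entire_quotient (N D : C -> C) : entire N -> entire D -> ~ (forall z, D z = 0) ->
  (forall z0, D z0 = 0 -> exists e d, [/\ cdiff e z0, 0 < d &
     forall z, cmod (z - z0) < d -> N z = D z * e z]) ->
  exists2 E, entire E & forall z, N z = D z * E z.
Proof.
move=> HN HD nD loc.
pose good z0 (e : C -> C) := cdiff e z0 /\
  exists2 d, 0 < d & forall z, cmod (z - z0) < d -> N z = D z * e z.
pose ee z0 := xget (fun=> 0) (good z0).
have eeP z0 : D z0 = 0 -> good z0 (ee z0).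
  move=> /loc[e [d [de d0 He]]].
  by apply: (@xgetI _ (fun=> 0) (good z0) e); split=> //; exists d.
pose E z := if D z == 0 then ee z z else N z / D z.
exists E => z; last first.
  rewrite /E; case: eqVneq => [Dz|Dz]; last by rewrite mulrC divfK.
  by have [_ [d d0 ->]] := eeP z Dz; rewrite ?subrr ?cmod0 // Dz !mul0r.
have [Dz|Dz] := eqVneq (D z) 0.
  have [de [d d0 He]] := eeP z Dz.
  have [m [u [Hu uz Du]]] := entire_order z HD nD.
  have [d1 d10 Hd1] := cont_neq0 (cdiff_cont (Hu z)) uz.
  have dd : 0 < Num.min d d1 by rewrite lt_min d0.
  apply: (cdiff_near dd) de => w; rewrite lt_min => /andP[/He Nw /Hd1 uw].
  rewrite /E; case: eqVneq => [Dw|Dw]; last by rewrite Nw mulrC mulKf.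
  move/eqP: Dw; rewrite Du mulf_eq0 (negPf uw) orbF expf_eq0 subr_eq0.
  by move=> /andP[_ /eqP ->].
have [d d0 Hd] := cont_neq0 (cdiff_cont (HD z)) Dz.
apply: (cdiff_near d0) (cdiff_div Dz (HN z) (HD z)) => w /Hd Dw.
by rewrite /E (negPf Dw).
Qed.

(* The numerator of [A''/A' - B''/B' - 2 (A'/A - B'/B)] over the denominator [A' B' A B]. *)
Definition xi A B z := A z * B z * (cder (cder A) z * cder B z - cder (cder B) z * cder A z)
  - 2 * (cder A z * B z - A z * cder B z) * cder A z * cder B z.

(** The extra factor [z - z0] avoids the exponent [p - 1], truncated at [p = 0], and gives the right
    side the same form again. *)
Lemma cder_factor A U z0 p z : entire U -> (forall w, A w = (w - z0) ^+ p * U w) ->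
  (z - z0) * cder A z = (z - z0) ^+ p * (p%:R * U z + (z - z0) * cder U z).
Proof.
move=> HU E; have -> : A = fun w => (w - z0) ^+ p * U w by apply/funext.
rewrite (cderE (has_cderivM (has_cderivX p (has_cderivB (has_cderiv_id z)
  (has_cderiv_cst z0 z))) (cderP (HU z)))).
by case: p {E} => [|p] /=; rewrite ?exprS; ring.
Qed.

(** [cder_factor] used twice, the second time for [(w - z0) * cder A w], which has the same exponent
    [p]. *)
Lemma cder2_factor A U z0 p z : entire A -> entire U ->
  (forall w, A w = (w - z0) ^+ p * U w) ->
  (z - z0) ^+ 2 * cder (cder A) z = (z - z0) ^+ p *
   ((p%:R - 1) * (p%:R * U z + (z - z0) * cder U z) +
    (z - z0) * ((p%:R + 1) * cder U z + (z - z0) * cder (cder U) z)).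
Proof.
move=> HA HU E.
have HU' := entire_cder HU; have HA' := entire_cder HA.
have HV : entire (fun w => p%:R * U w + (w - z0) * cder U w).
  move=> w; apply: cdiffD; first exact: cdiffM (cdiff_cst _ _) (HU w).
  by apply: cdiffM (HU' w); exact: cdiffB (cdiff_id _) (cdiff_cst _ _).
have dV : cder (fun w => p%:R * U w + (w - z0) * cder U w) z =
    (p%:R + 1) * cder U z + (z - z0) * cder (cder U) z.
  rewrite (cderE (has_cderivD (has_cderivZ p%:R (cderP (HU z)))
    (has_cderivM (has_cderivB (has_cderiv_id z) (has_cderiv_cst z0 z)) (cderP (HU' z))))).
  by ring.
have Eq w := cder_factor w HU E.
have := @cder_factor (fun w => (w - z0) * cder A w) _ z0 p z HV Eq.
rewrite (cderE (has_cderivM (has_cderivB (has_cderiv_id z) (has_cderiv_cst z0 z))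
  (cderP (HA' z)))) dV => H.
have -> : (z - z0) ^+ 2 * cder (cder A) z =
   (z - z0) * ((1 - 0) * cder A z + (z - z0) * cder (cder A) z) - (z - z0) * cder A z.
  by ring.
by rewrite H Eq; move: (cder U z) (cder (cder U) z) => *; ring.
Qed.

(* In terms of [t = z - z0], [Xi ^ 2 / (A B) ^ 3 = t ^ (p + p' - 6) X ^ 2 / (U V) ^ 3] for an
   explicit [X], and [X] is divisible by [t ^ 2] if [p = p' = 1] and by [t] if [p = p' = 2]. *)
Lemma xi_local A B U V z0 p p' : entire A -> entire B -> entire U -> entire V ->
  (forall z, A z = (z - z0) ^+ p * U z) -> (forall z, B z = (z - z0) ^+ p' * V z) ->
  U z0 != 0 -> V z0 != 0 ->
  [\/ p = 1%N /\ p' = 1%N, p = 2 /\ p' = 2 | (2 < p)%N /\ (2 < p')%N] ->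
  exists e d, [/\ cdiff e z0, 0 < d & forall z, cmod (z - z0) < d -> z != z0 ->
    xi A B z ^+ 2 = (A z * B z) ^+ 3 * e z].
Proof.
move=> HA HB HU HV EA EB U0 V0 cases.
have HU1 := entire_cder HU; have HV1 := entire_cder HV.
have HU2 := entire_cder HU1; have HV2 := entire_cder HV1.
pose t z := z - z0.
have Ht : entire t by move=> z; exact: cdiffB (cdiff_id _) (cdiff_cst _ _).
pose a1 z := p%:R * U z + t z * cder U z.
pose a2 z := (p%:R - 1) * a1 z + t z * ((p%:R + 1) * cder U z + t z * cder (cder U) z).
pose b1 z := p'%:R * V z + t z * cder V z.
pose b2 z := (p'%:R - 1) * b1 z + t z * ((p'%:R + 1) * cder V z + t z * cder (cder V) z).
pose X z := U z * V z * (a2 z * b1 z - b2 z * a1 z) -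
  2 * (a1 z * V z - U z * b1 z) * a1 z * b1 z.
have cts z : [/\ cdiff U z, cdiff V z, cdiff (cder U) z & cdiff (cder V) z] /\
    [/\ cdiff (cder (cder U)) z, cdiff (cder (cder V)) z & cdiff t z].
  by do 2!split.
have HX : entire X.
  move=> z; have [[cU cV cU1 cV1] [cU2 cV2 ct]] := cts z.
  have ca1 : cdiff a1 z by rewrite /a1; cdiff_solve.
  have cb1 : cdiff b1 z by rewrite /b1; cdiff_solve.
  have ca2 : cdiff a2 z by rewrite /a2; cdiff_solve.
  have cb2 : cdiff b2 z by rewrite /b2; cdiff_solve.
  by change (cdiff X z); rewrite /X; cdiff_solve.
have [W HW WE] : exists2 W, entire W & forall z, t z != 0 ->
    t z ^+ p * t z ^+ p' * X z ^+ 2 = t z ^+ 6 * W z.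
  case: cases => [[p1 p1']|[p2 p2']|[p3 p3']].
  (* For equal orders the leading terms of [a1 * V - U * b1] cancel and leave [t * w]. The function
     [X2] is [X / t ^+ 2]; in the next case [X1] is [X / t]. *)
  - pose w z := cder U z * V z - U z * cder V z.
    pose X2 z := U z * V z * (cder (cder U) z * V z - cder (cder V) z * U z +
        t z * (cder (cder U) z * cder V z - cder (cder V) z * cder U z)) -
      2 * w z * (U z * cder V z + cder U z * V z + t z * cder U z * cder V z).
    exists (fun z => X2 z ^+ 2).
      move=> z; have [[cU cV cU1 cV1] [cU2 cV2 ct]] := cts z.
      by change (cdiff (fun z => X2 z ^+ 2) z); rewrite /X2 /w; cdiff_solve.
    move=> z _; rewrite /X /a2 /b2 /a1 /b1 /X2 /w p1 p1' !expr1.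
    move: (t z) (U z) (V z) (cder U z) (cder V z) (cder (cder U) z) (cder (cder V) z).
    by move=> *; ring.
  - pose w z := cder U z * V z - U z * cder V z.
    pose X1 z := U z * V z * (6 * w z +
        2 * t z * (cder (cder U) z * V z - cder (cder V) z * U z) +
        t z ^+ 2 * (cder (cder U) z * cder V z - cder (cder V) z * cder U z)) -
      2 * w z * a1 z * b1 z.
    exists (fun z => X1 z ^+ 2).
      move=> z; have [[cU cV cU1 cV1] [cU2 cV2 ct]] := cts z.
      by change (cdiff (fun z => X1 z ^+ 2) z); rewrite /X1 /w /a1 /b1; cdiff_solve.
    move=> z _; rewrite /X /a2 /b2 /X1 /w /a1 /b1 p2 p2'.
    move: (t z) (U z) (V z) (cder U z) (cder V z) (cder (cder U) z) (cder (cder V) z).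
    by move=> *; ring.
  - exists (fun z => t z ^+ (p - 3) * t z ^+ (p' - 3) * X z ^+ 2).
      by move=> z; apply: cdiffM (cdiffX _ (HX z)); apply: cdiffM; exact/cdiffX/Ht.
    move=> z _; rewrite -{1}(subnK p3) -{1}(subnK p3') !exprD; ring.
have [d1 d10 Hd1] := cont_neq0 (cdiff_cont (HU z0)) U0.
have [d2 d20 Hd2] := cont_neq0 (cdiff_cont (HV z0)) V0.
exists (fun z => W z / (U z * V z) ^+ 3), (Num.min d1 d2); split.
- apply: cdiff_div; [by rewrite expf_neq0 // mulf_neq0 | exact: HW |].
  by apply: cdiffX; exact: cdiffM (HU z0) (HV z0).
- by rewrite lt_min d10.
move=> z; rewrite lt_min => /andP[/Hd1 Uz /Hd2 Vz] zz0.
have tz : t z != 0 by rewrite subr_eq0.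
have eA1 : cder A z = t z ^+ p * a1 z / t z.
  by rewrite -(cder_factor z HU EA) -/(t z) mulrC mulKf.
have eB1 : cder B z = t z ^+ p' * b1 z / t z.
  by rewrite -(cder_factor z HV EB) -/(t z) mulrC mulKf.
have t2 : t z ^+ 2 != 0 by rewrite expf_neq0.
have eA2 : cder (cder A) z = t z ^+ p * a2 z / t z ^+ 2.
  by rewrite -(cder2_factor z HA HU EA) -/(t z) mulrC mulKf.
have eB2 : cder (cder B) z = t z ^+ p' * b2 z / t z ^+ 2.
  by rewrite -(cder2_factor z HB HV EB) -/(t z) mulrC mulKf.
have xiE : xi A B z = (t z ^+ p) ^+ 2 * (t z ^+ p') ^+ 2 * X z / t z ^+ 3.
  rewrite /xi eA1 eB1 eA2 eB2 EA EB -/(t z) /X.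
  move: (t z ^+ p) (t z ^+ p') => P P'; move: (t z) tz => T T0.
  by field.
have WzE : W z = t z ^+ p * t z ^+ p' * X z ^+ 2 / t z ^+ 6.
  by rewrite WE // mulrC mulKf // expf_neq0.
rewrite xiE WzE EA EB -/(t z).
move: (t z ^+ p) (t z ^+ p') => P P'; move: (t z) tz => T T0.
by field; rewrite T0 Uz Vz.
Qed.

End LocalAnalysis.

(** * Multiplicities, the radical of a polynomial, and the comparison of degrees *)

Section PolynomialPart.
Variable R : realType.
Local Notation C := R[i].
Implicit Types (f g u h : C -> C) (z w b : C).

(** For [j > p], cancelling [(z - z0) ^+ p] by integrality would make [u] a multiple of
    [(z - z0) ^+ (j - p)], against [u z0 != 0]. *)
Lemma order_mult f b z0 p u : entire f -> entire u -> u z0 != 0 ->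
  (forall z, f z - b = (z - z0) ^+ p * u z) ->
  forall j, mult_ge f b z0 j <-> (j <= p)%N.
Proof.
move=> Hf Hu u0 E j; split=> [[h [Hh Eh]]|jp]; last first.
  exists (fun z => (z - z0) ^+ (p - j) * u z); split=> [z|z].
    by apply: cdiffM (Hu z); apply: cdiffX; exact: cdiffB (cdiff_id _) (cdiff_cst _ _).
  by rewrite E mulrA -exprD subnKC.
rewrite leqNgt; apply/negP => pj.
have Ht : entire (fun z => (z - z0) ^+ p).
  by move=> z; apply: cdiffX; exact: cdiffB (cdiff_id _) (cdiff_cst _ _).
have Hk : entire (fun z => u z - (z - z0) ^+ (j - p) * h z).
  move=> z; apply: cdiffB (Hu z) _; apply: cdiffM (Hh z); apply: cdiffX.
  exact: cdiffB (cdiff_id _) (cdiff_cst _ _).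
have [z||H] := entire_integral Ht Hk.
- by rewrite mulrBr -E mulrA -exprD subnKC ?(ltnW pj) // Eh subrr.
- move=> /(_ (z0 + 1))/eqP; rewrite expf_eq0 (_ : z0 + 1 - z0 = 1); last by ring.
  by rewrite oner_eq0 andbF.
- have := H z0; rewrite subrr expr0n subn_eq0 leqNgt pj /= mul0r subr0 => /eqP.
  by rewrite (negPf u0).
Qed.

Lemma mult_ge_val f b z j : (0 < j)%N -> mult_ge f b z j -> f z = b.
Proof.
move=> j0 [h [_ /(_ z)]]; rewrite subrr expr0n (gtn_eqF j0) mul0r => /eqP.
by rewrite subr_eq0 => /eqP.
Qed.

Lemma radical_dvdp (s rs : seq C) : {subset rs <= s} ->
  \prod_(r <- rs) ('X - r%:P) %| \prod_(b <- s) ('X - b%:P) * (\prod_(r <- rs) ('X - r%:P))^`().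
Proof.
elim: rs => [|r rs IH] sub; first by rewrite big_nil dvd1p.
have rs_s : r \in s by apply: sub; rewrite inE eqxx.
rewrite big_cons derivM derivXsubC mul1r mulrDr dvdp_add //.
  by rewrite dvdp_mul // dvdp_XsubCl root_prod_XsubC.
rewrite mulrCA dvdp_mul2l ?polyXsubC_eq0 //.
by apply: IH => x xs; apply: sub; rewrite inE xs orbT.
Qed.

(** [P' / P] has only simple poles, at the roots of [P]. Used for [P = Q'], it makes [q * Q'' / Q']
    a polynomial. *)
Lemma radical_deriv_dvdp (P : {poly C}) (s : seq C) : P != 0 ->
  (forall z, (z \in s) = root P z) -> P %| \prod_(b <- s) ('X - b%:P) * P^`().
Proof.
move=> P0 sP; have [rs Prs] := closed_field_poly_normal P.
have l0 : lead_coef P != 0 by rewrite lead_coef_eq0.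
rewrite Prs derivZ -scalerAr dvdpZl // dvdpZr //.
apply: radical_dvdp => r rrs; rewrite sP Prs rootZ //.
by rewrite root_prod_XsubC.
Qed.

Lemma horner_prod_XsubC (I : Type) (r : seq I) (F : I -> C) (w : C) :
  (\prod_(i <- r) ('X - (F i)%:P)).[w] = \prod_(i <- r) (w - F i).
Proof. by rewrite horner_prod; apply: eq_bigr => i _; rewrite hornerXsubC. Qed.

Lemma prodr_ge1 (I : Type) (r : seq I) (F : I -> R) : (forall i, 1 <= F i) ->
  1 <= \prod_(i <- r) F i.
Proof.
move=> H; elim/big_rec: _ => // i x _ x1.
by rewrite -[1]mulr1 ler_pM.
Qed.

(** Let [a i] be the root nearest to [w] and [x = 1 + cmod w]. By [far_point] the other [n - 1]
    factors are each at least [x / c]. On the left one factor [cmod (w - a i)] is kept and the other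
    bounded by a multiple of [x], which leaves the power [2 * size s + 2] of [x]; the condition on
    [n] makes it at most [n - 1]. *)
Lemma nearest_root_bound n (a : 'I_n -> C) (s : seq C) : injective a ->
  (2 * size s + 2 < n)%N -> exists2 K, 0 <= K & forall w, exists i,
    cmod (\prod_(b <- s) (w - b)) ^+ 2 * (1 + cmod w) * cmod (w - a i) ^+ 2
    <= K * cmod (\prod_(i < n) (w - a i)).
Proof.
move=> inj sn; have n0 : (0 < n)%N by apply: leq_ltn_trans sn.
pose c := 1 + \sum_(i < n) \sum_(l < n) 2 * (1 + cmod (a l)) / cmod (a i - a l).
have t0 i l : 0 <= 2 * (1 + cmod (a l)) / cmod (a i - a l).
  by rewrite divr_ge0 ?mulr_ge0 ?addr_ge0 ?cmod_ge0.
have cb i l : 1 + 2 * (1 + cmod (a l)) / cmod (a i - a l) <= c.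
  rewrite lerD2l (bigD1 i) //= (bigD1 l) //= -addrA lerDl.
  by rewrite addr_ge0 // sumr_ge0 // => j _; rewrite sumr_ge0.
have c1 : 1 <= c by rewrite lerDl sumr_ge0 // => i _; rewrite sumr_ge0.
have c0 : 0 < c by apply: lt_le_trans c1.
pose D := \prod_(b <- s) (1 + cmod b).
have D1 : 1 <= D by apply: prodr_ge1 => b; rewrite lerDl cmod_ge0.
pose e := 1 + \sum_(l < n) cmod (a l).
have eb l : 1 + cmod (a l) <= e.
  by rewrite lerD2l (bigD1 l) //= lerDl sumr_ge0 // => j _; rewrite cmod_ge0.
have e1 : 1 <= e by rewrite lerDl sumr_ge0 // => i _; rewrite cmod_ge0.
exists (D ^+ 2 * e * c ^+ n.-1).
  by rewrite !mulr_ge0 ?exprn_ge0 ?sqr_ge0 //; lra.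
move=> w; pose i := [arg min_(i < Ordinal n0) cmod (w - a i)]%O; exists i.
have imin l : cmod (w - a i) <= cmod (w - a l) by rewrite /i; case: arg_minP => // j _; apply.
pose x := 1 + cmod w; have x1 : 1 <= x by rewrite lerDl cmod_ge0.
have wb b : cmod (w - b) <= (1 + cmod b) * x.
  have := cmodB w b; rewrite /x; have := cmod_ge0 b; have := cmod_ge0 w; nra.
have h1 : cmod (\prod_(b <- s) (w - b)) <= D * x ^+ size s.
  rewrite cmod_prod; apply: le_trans (_ : \prod_(b <- s) ((1 + cmod b) * x) <= _).
    by apply: ler_prod => b _; rewrite cmod_ge0 wb.
  by rewrite big_split /= big_const_seq count_predT iter_mulr_1.
have h2 : cmod (w - a i) * x ^+ n.-1 <= c ^+ n.-1 * cmod (\prod_(l < n) (w - a l)).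
  rewrite cmod_prod (bigD1 i) //= mulrCA ler_wpM2l ?cmod_ge0 //.
  have cn : #|[pred l : 'I_n | l != i]| = n.-1.
    by have := cardC1 i; rewrite card_ord => <-; apply: eq_card => l; rewrite !inE.
  have -> : x ^+ n.-1 = \prod_(l < n | l != i) x by rewrite prodr_const cn.
  have -> : c ^+ n.-1 = \prod_(l < n | l != i) c by rewrite prodr_const cn.
  rewrite -big_split /=; apply: ler_prod => l li.
  rewrite (le_trans ler01 x1) /=.
  have al : a i != a l by apply/eqP => /inj E; rewrite E eqxx in li.
  apply: le_trans (far_point al (imin l)) _.
  by rewrite ler_wpM2r ?cmod_ge0.
have h3 : cmod (w - a i) <= e * x.
  by apply: le_trans (wb _) _; rewrite ler_wpM2r //; lra.
have h4 : x ^+ (2 * size s + 2) <= x ^+ n.-1.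
  by rewrite ler_weXn2l // -ltnS prednK.
set P := cmod (\prod_(b <- s) _) in h1 *; set y := cmod (w - a i) in h2 h3 *.
have y0 : 0 <= y := cmod_ge0 _.
have P0 : 0 <= P := cmod_ge0 _.
have h5 : P ^+ 2 <= D ^+ 2 * x ^+ (2 * size s).
  rewrite (mulnC 2) exprM -exprMn lerXn2r ?nnegrE // mulr_ge0 ?exprn_ge0 //; lra.
have De : 0 <= D ^+ 2 * e by rewrite mulr_ge0 ?sqr_ge0 //; lra.
apply: (@le_trans _ _ (D ^+ 2 * e * (y * x ^+ n.-1))); last first.
  by rewrite -[leRHS]mulrA; exact: ler_wpM2l De _ _ h2.
apply: (@le_trans _ _ (D ^+ 2 * e * (y * x ^+ (2 * size s + 2)))); last first.
  by rewrite ler_wpM2l // ler_wpM2l.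
apply: (@le_trans _ _ (D ^+ 2 * x ^+ (2 * size s) * x * (y * (e * x)))).
  rewrite -/x expr2; apply: ler_pM => //; rewrite ?mulr_ge0 ?sqr_ge0 //; try lra.
    by rewrite ler_wpM2r //; lra.
  by rewrite ler_wpM2l.
rewrite exprD; set X := x ^+ (2 * size s).
by rewrite le_eqVlt; apply/orP; left; apply/eqP; ring.
Qed.

End PolynomialPart.

(** * The auxiliary function of the shared set and its vanishing *)

Section SharedSet.
Variable R : realType.
Local Notation C := R[i].
Implicit Types (u : C -> C) (z w b : C).

Definition nonconstant u := ~ exists b, forall z, u z = b.

Lemma entire_horner (P : {poly C}) u : entire u -> entire (fun z => P.[u z]).
Proof. by move=> Hu z; exact/cdiff_horner/Hu. Qed.

Lemma horner_nonzero (P : {poly C}) u : P != 0 -> entire u -> nonconstant u ->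
  ~ (forall z, P.[u z] = 0).
Proof.
move=> P0 Hu nu H; have [rs Prs] := closed_field_poly_normal P.
have [z Hz] : exists z, forall r, r \in rs -> u z - r != 0.
  apply: (@entire_prod_nonzero _ _ rs (fun r z => u z - r)) => [r z|r _ E].
    exact: cdiffB (Hu z) (cdiff_cst _ _).
  by apply: nu; exists r => z; apply/eqP; rewrite -subr_eq0 E.
have := H z; rewrite Prs hornerZ horner_prod_XsubC => /eqP.
rewrite mulf_eq0 lead_coef_eq0 (negPf P0) prodf_seq_eq0 => /hasP[r /Hz].
by rewrite /= => /negPf ->.
Qed.

Lemma cder_horner (P : {poly C}) u z : entire u ->
  cder (fun w => P.[u w]) z = P^`().[u z] * cder u z.
Proof. by move=> Hu; exact/cderE/has_cderiv_horner/cderP/Hu. Qed.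

Lemma cder2_horner (P : {poly C}) u z : entire u ->
  cder (cder (fun w => P.[u w])) z =
  P^`()^`().[u z] * cder u z ^+ 2 + P^`().[u z] * cder (cder u) z.
Proof.
move=> Hu; have -> : cder (fun w => P.[u w]) = fun w => P^`().[u w] * cder u w.
  by apply/funext => w; exact: cder_horner.
rewrite (cderE (has_cderivM (has_cderiv_horner P^`() (cderP (Hu z)))
  (cderP (entire_cder Hu z)))).
by rewrite expr2 mulrA.
Qed.

Lemma cder_nonzero u : entire u -> nonconstant u -> ~ (forall z, cder u z = 0).
Proof. by move=> Hu nu /(entire_cder0 Hu) E; apply: nu; exists (u 0). Qed.

Lemma cder_horner_nonzero (P : {poly C}) u : P^`() != 0 -> entire u -> nonconstant u ->
  ~ (forall z, cder (fun w => P.[u w]) z = 0).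
Proof.
move=> P0 Hu nu H.
have Hd z : P^`().[u z] * cder u z = 0 by rewrite -cder_horner.
have [h|h] := entire_integral (entire_horner P^`() Hu) (entire_cder Hu) Hd.
  exact: (horner_nonzero P0 Hu nu h).
exact: (cder_nonzero Hu nu h).
Qed.

Section Setting.
Variables (n : nat) (a : 'I_n -> C).
Hypothesis inj : injective a.
Let Q : {poly C} := \prod_(i < n) ('X - (a i)%:P).
Let S := fun z : C => exists i : 'I_n, z = a i.

Lemma horner_rootpoly w : Q.[w] = \prod_(i < n) (w - a i).
Proof. exact: horner_prod_XsubC. Qed.

Lemma rootpoly_root w : Q.[w] = 0 <-> S w.
Proof.
rewrite horner_rootpoly; split=> [/eqP|[i ->]].
  by rewrite prodf_seq_eq0 => /hasP[i _ /=]; rewrite subr_eq0 => /eqP ->; exists i.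
by rewrite (bigD1 i) //= subrr mul0r.
Qed.

Lemma rootpoly_deriv_neq0 i : Q^`().[a i] != 0.
Proof.
rewrite /Q (bigD1 i) //= derivM derivXsubC mul1r hornerD hornerM hornerXsubC subrr mul0r addr0.
rewrite horner_prod; apply/prodf_neq0 => l li.
by rewrite hornerXsubC subr_eq0; apply: contra li => /eqP/inj ->.
Qed.

Lemma monic_rootpoly : Q \is monic.
Proof. exact: monic_prod_XsubC. Qed.

(** The roots being distinct, only one factor [u - a i] vanishes at [z0]; hence the order of [Q(u)]
    is the multiplicity that the sharing condition sees. *)
Lemma local_factor u z0 : entire u -> nonconstant u -> S (u z0) ->
  exists p U, [/\ entire U, U z0 != 0, (0 < p)%N, forall z, Q.[u z] = (z - z0) ^+ p * U z &
    forall j, (0 < j)%N -> (exists2 b, S b & mult_ge u b z0 j) <-> (j <= p)%N].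
Proof.
move=> Hu nu [i ui].
have Hd : entire (fun z => u z - a i) by move=> z; exact: cdiffB (Hu z) (cdiff_cst _ _).
have [|p [v [Hv v0 E]]] := entire_order z0 Hd.
  by move=> H; apply: nu; exists (a i) => z; apply/eqP; rewrite -subr_eq0 H.
exists p, (fun z => v z * \prod_(l < n | l != i) (u z - a l)); split.
- move=> z; apply: cdiffM (Hv z) _.
  apply: (@cdiff_near _ (fun z => \prod_(l <- [seq l <- index_enum 'I_n | l != i]) (u z - a l))
     _ z _ ltr01).
    by move=> w _; rewrite big_filter.
  by apply: cdiff_prod => l; exact: cdiffB (Hu z) (cdiff_cst _ _).
- rewrite mulf_neq0 //; apply/prodf_neq0 => l li.
  by rewrite ui subr_eq0; apply: contra li => /eqP/inj ->.
- rewrite lt0n; apply/eqP => p0; have := E z0; rewrite ui subrr p0 expr0 mul1r => /eqP.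
  by rewrite eq_sym (negPf v0).
- by move=> z; rewrite horner_rootpoly (bigD1 i) //= E mulrA.
- move=> j j0; have om := order_mult Hu Hv v0 E j; split=> [[b _ hb]|/om h]; last first.
    by exists (a i) => //; exists i.
  by apply/om; rewrite -ui (mult_ge_val j0 hb).
Qed.

Variables (s : seq C) (f g : C -> C).
Hypothesis sQ : forall z, (z \in s) = root Q^`() z.
Hypothesis sn : (2 * size s + 2 < n)%N.
Hypotheses (Hf : entire f) (Hg : entire g) (nf : nonconstant f) (ng : nonconstant g).
Hypothesis share : share_set_weight f g S 2.

Let q : {poly C} := \prod_(b <- s) ('X - b%:P).
Let A z := Q.[f z].
Let B z := Q.[g z].

Let HA : entire A. Proof. exact: entire_horner. Qed.
Let HB : entire B. Proof. exact: entire_horner. Qed.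

Let Q'0 : Q^`() != 0.
Proof.
have n0 : (0 < n)%N by apply: leq_ltn_trans sn.
have := rootpoly_deriv_neq0 (Ordinal n0).
by apply: contraNneq => ->; rewrite horner0.
Qed.

Let q0 : q != 0. Proof. exact/monic_neq0/monic_prod_XsubC. Qed.

Let r4_ex : exists r4 : {poly C}, q * Q^`()^`() = r4 * Q^`().
Proof. by have /dvdpP[r4 E] := radical_deriv_dvdp Q'0 sQ; exists r4. Qed.

Section WithQuotient.
Variable r4 : {poly C}.
Hypothesis r4E : q * Q^`()^`() = r4 * Q^`().

(** [be u] is [al u] times the logarithmic derivative of [(Q(u))'], written without denominators by
    means of [q * Q'' = r4 * Q']. *)
Let al u z := q.[u z] * cder u z.
Let be u z := r4.[u z] * cder u z ^+ 2 + q.[u z] * cder (cder u) z.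

(* [xi] with the common factors of [A'] and [A''] at the multiple zeros of [Q'] removed. *)
Let xi1 z := A z * B z * (be f z * al g z - be g z * al f z) -
  2 * (cder A z * B z - A z * cder B z) * al f z * al g z.

Let r4Ew w : q.[w] * Q^`()^`().[w] = r4.[w] * Q^`().[w].
Proof. by rewrite -!hornerM r4E. Qed.

Let al_cder2 u z : entire u ->
  al u z * cder (cder (fun w => Q.[u w])) z = cder (fun w => Q.[u w]) z * be u z.
Proof.
move=> Hu; rewrite cder2_horner // cder_horner // /al /be.
have := r4Ew (u z); move: (q.[_]) (r4.[_]) (Q^`().[_]) (Q^`()^`().[_]) => q' r' d1 d2 E.
have -> : q' * cder u z * (d2 * cder u z ^+ 2 + d1 * cder (cder u) z) =
  (q' * d2) * cder u z ^+ 3 + q' * d1 * cder u z * cder (cder u) z by ring.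
by rewrite E; ring.
Qed.

Let xi1E z : al f z * al g z * xi A B z = cder A z * cder B z * xi1 z.
Proof.
have Ef := al_cder2 z Hf; have Eg := al_cder2 z Hg.
rewrite -/A in Ef; rewrite -/B in Eg; rewrite /xi /xi1.
move: (al f z) (al g z) (be f z) (be g z) (cder (cder A) z) (cder (cder B) z) Ef Eg.
move=> af ag bf bg A2 B2 Ef Eg.
have -> : af * ag * (A z * B z * (A2 * cder B z - B2 * cder A z) -
    2 * (cder A z * B z - A z * cder B z) * cder A z * cder B z) =
  A z * B z * (af * A2 * ag * cder B z - ag * B2 * af * cder A z) -
    af * ag * (2 * (cder A z * B z - A z * cder B z) * cder A z * cder B z) by ring.
by rewrite Ef Eg; ring.
Qed.

Let Hal u : entire u -> entire (al u).
Proof. by move=> Hu z; exact: cdiffM (entire_horner q Hu z) (entire_cder Hu z). Qed.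

Let Hbe u : entire u -> entire (be u).
Proof.
move=> Hu z; apply: cdiffD.
  exact: cdiffM (entire_horner r4 Hu z) (cdiffX 2 (entire_cder Hu z)).
exact: cdiffM (entire_horner q Hu z) (entire_cder (entire_cder Hu) z).
Qed.

Let Hxi1 : entire xi1.
Proof.
move=> z; change (cdiff xi1 z).
have cA : cdiff A z := HA z; have cB : cdiff B z := HB z.
have cA1 : cdiff (cder A) z := entire_cder HA z.
have cB1 : cdiff (cder B) z := entire_cder HB z.
have caf : cdiff (al f) z := Hal Hf z; have cag : cdiff (al g) z := Hal Hg z.
have cbf : cdiff (be f) z := Hbe Hf z; have cbg : cdiff (be g) z := Hbe Hg z.
by rewrite /xi1; cdiff_solve.
Qed.

(** The roots of [Q] are simple, so near a shared point [Q'(u)] does not vanish and [xi1] is [xi]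
    times a differentiable factor. *)
Let kappa_near u z0 : entire u -> S (u z0) -> exists2 d, 0 < d &
  forall z, cmod (z - z0) < d -> Q^`().[u z] != 0.
Proof.
move=> Hu [i ui]; apply: (@cont_neq0 _ (fun z => Q^`().[u z])).
  exact/cdiff_cont/entire_horner.
by rewrite ui rootpoly_deriv_neq0.
Qed.

Let al_kappa u z : entire u -> Q^`().[u z] != 0 ->
  al u z = q.[u z] / Q^`().[u z] * cder (fun w => Q.[u w]) z.
Proof. by move=> Hu h; rewrite cder_horner // /al; field. Qed.

Let be_kappa u z : entire u -> Q^`().[u z] != 0 ->
  be u z = q.[u z] / Q^`().[u z] * cder (cder (fun w => Q.[u w])) z.
Proof.
move=> Hu h; rewrite cder2_horner // /be.
have := r4Ew (u z); move: (q.[_]) (r4.[_]) (Q^`().[_]) (Q^`()^`().[_]) h => q' r' d1 d2 h E.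
have -> : q' / d1 * (d2 * cder u z ^+ 2 + d1 * cder (cder u) z) =
  (q' * d2) / d1 * cder u z ^+ 2 + q' * cder (cder u) z by field.
by rewrite E; field.
Qed.

Let AB0 : ~ (forall z, (A z * B z) ^+ 3 = 0).
Proof.
have Q0 : Q != 0 := monic_neq0 monic_rootpoly.
move=> H; have [z|h|h] := entire_integral HA HB.
- by have := H z => /eqP; rewrite expf_eq0 => /andP[_ /eqP].
- exact: (horner_nonzero Q0 Hf nf h).
- exact: (horner_nonzero Q0 Hg ng h).
Qed.

Let shared_zero z : A z = 0 <-> B z = 0.
Proof.
have h := share z (j := 1) isT.
have key u : entire u -> S (u z) <-> exists2 b, S b & mult_ge u b z 1.
  move=> Hu; split=> [Sz|[b Sb /mult_ge_val E]]; last by rewrite E.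
  exists (u z) => //.
  have Hd : entire (fun w => u w - u z) by move=> w; exact: cdiffB (Hu w) (cdiff_cst _ _).
  have [v Hv Ev] := entire_factor Hd (subrr _); by exists v; split.
split=> /rootpoly_root.
  by move=> /(key f Hf)/h/(key g Hg)/rootpoly_root.
by move=> /(key g Hg)/h/(key f Hf)/rootpoly_root.
Qed.

Lemma quotient_exists : exists2 E, entire E & forall z, xi1 z ^+ 2 = (A z * B z) ^+ 3 * E z.
Proof.
apply: (@entire_quotient _ (fun z => xi1 z ^+ 2) (fun z => (A z * B z) ^+ 3)) => //.
- by move=> z; exact/cdiffX/Hxi1.
- by move=> z; apply: cdiffX; exact: cdiffM (HA z) (HB z).
move=> z0 /eqP; rewrite expf_eq0 /= mulf_eq0 => /orP AB.
have [A0 B0] : A z0 = 0 /\ B z0 = 0.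
  by case: AB => /eqP h; have h' := h; [move/shared_zero: h' | move/shared_zero: h'].
have Sf : S (f z0) by apply/rootpoly_root.
have Sg : S (g z0) by apply/rootpoly_root.
have [p [U [HU U0 p0 EU mU]]] := local_factor Hf nf Sf.
have [p' [V [HV V0 p0' EV mV]]] := local_factor Hg ng Sg.
(* Weight 2 compares multiplicities up to 3: the orders are equal or both at least 3, which are the
   three cases of [xi_local]. *)
have eqj j : (0 < j)%N -> (j <= 3)%N -> (j <= p)%N <-> (j <= p')%N.
  move=> j0 j3; have h := share z0 (j := j); rewrite j0 j3 in h.
  split=> hj; first by apply/(mV j j0)/h => //; exact/(mU j j0).
  by apply/(mU j j0)/h => //; exact/(mV j j0).
have cases : [\/ p = 1%N /\ p' = 1%N, p = 2 /\ p' = 2 | (2 < p)%N /\ (2 < p')%N].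
  have [p3|p3] := ltnP 2 p.
    by apply: Or33; split=> //; exact/(eqj 3 isT isT).
  have p3' : (p' <= 2)%N by rewrite leqNgt; apply/negP => /(eqj 3 isT isT); rewrite ltnNge p3.
  have [p2|p2] := ltnP 1 p.
    have p2' : (1 < p')%N by exact/(eqj 2 isT isT).
    by apply: Or32; split; apply/eqP; rewrite eqn_leq ?p3 ?p3'.
  have p2' : (p' <= 1)%N by rewrite leqNgt; apply/negP => /(eqj 2 isT isT); rewrite ltnNge p2.
  by apply: Or31; split; apply/eqP; rewrite eqn_leq ?p2 ?p2'.
have [e [d [de d0 He]]] := xi_local HA HB HU HV EU EV U0 V0 cases.
have [d1 d10 Hd1] := kappa_near Hf Sf; have [d2 d20 Hd2] := kappa_near Hg Sg.
pose k u z := q.[u z] / Q^`().[u z].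
exists (fun z => (k f z * k g z) ^+ 2 * e z), (Num.min d (Num.min d1 d2)); split.
- have ck u : entire u -> Q^`().[u z0] != 0 -> cdiff (k u) z0.
    by move=> Hu h; apply: cdiff_div => //; exact: entire_horner.
  apply: cdiffM de; apply: cdiffX; apply: cdiffM; apply: ck => //.
    by apply: Hd1; rewrite subrr cmod0.
  by apply: Hd2; rewrite subrr cmod0.
- by rewrite !lt_min d0 d10.
move=> z; rewrite !lt_min => /and3P[zd /Hd1 z1 /Hd2 z2].
(* [xi_local] says nothing at [z0] itself, where both sides vanish with [A] and [B]. *)
have [->|zz0] := eqVneq z z0.
  by rewrite /xi1 A0 B0 !(mulr0, mul0r, subr0, expr0n).
have -> : xi1 z = k f z * k g z * xi A B z.
  by rewrite /xi1 /xi !al_kappa // !be_kappa // -/A -/B -/(k f z) -/(k g z); ring.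
by rewrite exprMn He //; ring.
Qed.

Let I : finType := ('I_n * bool + bool * bool)%type.
Let fg (b : bool) := if b then f else g.
(** The functions whose logarithmic derivatives dominate [E]: [f - a i] and [g - a i], then [A] and
    [B] (second flag true), then their derivatives (second flag false). *)
Let h (x : I) : C -> C :=
  match x with
  | inl (i, b) => fun z => fg b z - a i
  | inr (b, true) => fun z => Q.[fg b z]
  | inr (b, false) => cder (fun z => Q.[fg b z])
  end.

Let Hfg (b : bool) : entire (fg b). Proof. by case: b. Qed.
Let nfg (b : bool) : nonconstant (fg b). Proof. by case: b. Qed.

Let h_entire x : entire (h x).
Proof.
case: x => [[i b]|[b []]]; rewrite /h.
- by move=> z; exact: cdiffB (Hfg b z) (cdiff_cst _ _).
- exact: entire_horner.
- exact/entire_cder/entire_horner.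
Qed.

Let h_nonzero x : ~ (forall z, h x z = 0).
Proof.
case: x => [[i b]|[b []]]; rewrite /h => H.
- by apply: (nfg (b := b)); exists (a i) => z; apply/eqP; rewrite -subr_eq0 H.
- exact: (horner_nonzero (monic_neq0 monic_rootpoly) (Hfg b) (@nfg b) H).
- exact: (cder_horner_nonzero Q'0 (Hfg b) (@nfg b) H).
Qed.

Let P := \prod_(i < n) (1 + cmod (a i)).

(** The degree of [Q] accounts for the exponent [n]; Cauchy's estimate for the derivatives of [A]
    and [B] adds one factor [d^-1] and the constant 4. *)
Let h_growth x z (d M : R) : 0 < d <= 1 -> 1 <= M ->
  (forall w, cmod (w - z) <= d -> cmod (f w) + cmod (g w) <= M) ->
  cmod (h x z) <= 4 * P * (M / d) ^+ n.+1.
Proof.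
move=> /andP[d0 d1] M1 fM.
have fgM (b : bool) w : cmod (w - z) <= d -> cmod (fg b w) <= M.
  by move=> /fM; have := cmod_ge0 (f w); have := cmod_ge0 (g w); case: b => /=; lra.
have zz : cmod (z - z) <= d by rewrite subrr cmod0 ltW.
have Md : M <= M / d by rewrite ler_pdivlMr //; nra.
have Md1 : 1 <= M / d by lra.
have P1 : 1 <= P by apply: prodr_ge1 => i; rewrite lerDl cmod_ge0.
have QM (b : bool) w : cmod (w - z) <= d -> cmod Q.[fg b w] <= P * M ^+ n.
  move=> wz; rewrite horner_rootpoly cmod_prod.
  apply: le_trans (_ : \prod_(i < n) ((1 + cmod (a i)) * M) <= _).
    apply: ler_prod => i _; rewrite cmod_ge0 /=.
    have := cmodB (fg b w) (a i); have := fgM b w wz; have := cmod_ge0 (a i); nra.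
  by rewrite big_split /= prodr_const card_ord.
have X0 : 0 <= (M / d) ^+ n.+1 by rewrite exprn_ge0 //; lra.
have Mn : M ^+ n <= (M / d) ^+ n by rewrite lerXn2r ?nnegrE //; lra.
have Mn0 : 0 <= (M / d) ^+ n by rewrite exprn_ge0 //; lra.
have MnS : (M / d) ^+ n <= (M / d) ^+ n.+1 by rewrite ler_weXn2l.
have P4 : P * (M / d) ^+ n.+1 <= 4 * P * (M / d) ^+ n.+1 by rewrite ler_wpM2r //; lra.
case: x => [[i b]|[b []]]; rewrite /h.
- apply: le_trans P4; apply: le_trans (cmodB _ _) _.
  have ai : 1 + cmod (a i) <= P.
    rewrite /P (bigD1 i) //= -[X in X <= _]mulr1 ler_wpM2l ?addr_ge0 ?cmod_ge0 //.
    by rewrite -big_filter; apply: prodr_ge1 => l; rewrite lerDl cmod_ge0.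
  have MX : M <= (M / d) ^+ n.+1.
    by apply: le_trans Md _; rewrite -[X in X <= _]expr1 ler_weXn2l.
  have := fgM b z zz; have := cmod_ge0 (a i); nra.
- apply: le_trans P4; apply: le_trans (QM b z zz) _.
  by rewrite ler_wpM2l ?(le_trans Mn MnS) //; lra.
- apply: le_trans (@cder_bound _ (fun z => Q.[fg b z]) z d (P * M ^+ n) d0 _ (QM b)) _.
    by move=> w _; exact: entire_horner.
  rewrite -!mulrA ler_wpM2l // ler_wpM2l //; first lra.
  have -> : (M / d) ^+ n.+1 = (M / d) ^+ n * M / d by rewrite exprSr mulrA.
  rewrite ler_wpM2r ?invr_ge0 ?(ltW d0) //.
  by apply: le_trans Mn _; nra.
Qed.

Let L z : R := 1 + \sum_x cmod (ld (h x) z).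

Let ld_le_L x z : cmod (ld (h x) z) <= L z.
Proof.
rewrite /L (bigD1 x) //=.
have : 0 <= \sum_(y | y != x) cmod (ld (h y) z) by rewrite sumr_ge0 // => y _; exact: cmod_ge0.
lra.
Qed.

(** The derivative of [fg b] is written as [fg b - a i] times its logarithmic derivative, with [a i]
    the root supplied by [nearest_root_bound]. *)
Let al_bound (K0 : R) (b : bool) z : 0 <= K0 ->
  (forall w, exists i,
    cmod (\prod_(b <- s) (w - b)) ^+ 2 * (1 + cmod w) * cmod (w - a i) ^+ 2
    <= K0 * cmod (\prod_(i < n) (w - a i))) ->
  (forall x, h x z != 0) ->
  cmod (al (fg b) z) ^+ 2 * (1 + cmod (fg b z)) <= K0 * L z ^+ 2 * cmod Q.[fg b z].
Proof.
move=> K00 HK hz; have [i Hi] := HK (fg b z).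
have lz := ld_le_L (inl (i, b)) z; have hi := hz (inl (i, b)).
rewrite /h /ld cder_subc in lz; last exact: Hfg.
rewrite /h in hi; rewrite -horner_rootpoly -horner_prod_XsubC -/q in Hi.
have c0 : 0 < cmod (fg b z - a i) by rewrite cmod_gt0.
have lE : cmod (cder (fg b) z) = cmod (cder (fg b) z / (fg b z - a i)) * cmod (fg b z - a i).
  by rewrite -cmodM divfK.
rewrite /al cmodM lE.
set l := cmod (_ / _) in lz *; set y := cmod (fg b z - a i) in Hi c0 *.
have l0 : 0 <= l := cmod_ge0 _.
have l2 : l ^+ 2 <= L z ^+ 2 by rewrite lerXn2r ?nnegrE // (le_trans l0 lz).
have -> : (cmod q.[fg b z] * (l * y)) ^+ 2 * (1 + cmod (fg b z)) =
  l ^+ 2 * (cmod q.[fg b z] ^+ 2 * (1 + cmod (fg b z)) * y ^+ 2) by ring.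
apply: le_trans (ler_wpM2l (sqr_ge0 l) Hi) _.
rewrite mulrCA -mulrA ler_wpM2l // ler_wpM2r ?cmod_ge0 //.
Qed.

(** [|E A B|] equals [|al f * al g * Phi| ^ 2]. Two uses of [al_bound] and [|Phi| <= 2 * L] give the
    power [L ^+ 6], and [(1 + |f|) * (1 + |g|)] dominates [1 + |f| + |g|]. If [E] were not zero, [f]
    would be bounded, hence constant by Liouville's theorem. *)
Lemma xi1_zero z : xi1 z = 0.
Proof.
have [E HE EE] := quotient_exists.
have [K0 K00 HK] := nearest_root_bound inj sn.
suff EZ : forall z, E z = 0.
  by have := EE z; rewrite EZ mulr0 => /eqP; rewrite expf_eq0 => /andP[_ /eqP].
apply: contrapT => nE.
have P1 : 1 <= P by apply: prodr_ge1 => i; rewrite lerDl cmod_ge0.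
pose K := 4 * P + 4 * K0 ^+ 2.
have K02 : 0 <= K0 ^+ 2 by rewrite sqr_ge0.
have [M HM] : exists M, forall z, cmod (f z) + cmod (g z) <= M.
  apply: (@growth_contradiction _ I h f g E K 6 n.+1) => //.
  - by rewrite /K; lra.
  - move=> x w d M d1 M1 fM; apply: le_trans (h_growth x d1 M1 fM) _.
    rewrite ler_wpM2r ?exprn_ge0 ?divr_ge0 //; [lra | by case/andP: d1 => /ltW | rewrite /K; lra].
  move=> w hw; rewrite -/(L w).
  have Af : A w != 0 := hw (inr (true, true)); have Bf : B w != 0 := hw (inr (false, true)).
  have A1 : cder A w != 0 := hw (inr (true, false)).
  have B1 : cder B w != 0 := hw (inr (false, false)).
  pose Phi := ld (cder A) w - ld (cder B) w - 2 * (ld A w - ld B w).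
  have xE : xi1 w = A w * B w * al f w * al g w * Phi.
    apply: (mulfI (mulf_neq0 A1 B1)); rewrite -xi1E /xi /Phi /ld.
    by field; rewrite Af Bf A1 B1.
  have L0 : 0 <= L w := le_trans (cmod_ge0 _) (ld_le_L (inr (true, true)) w).
  have PhiL : cmod Phi <= 2 * L w.
    have : cmod (ld A w) + cmod (ld (cder A) w) + (cmod (ld B w) + cmod (ld (cder B) w))
        <= L w - 1.
      rewrite /L [1 + _]addrC addrK big_sumType.
      have -> : \sum_(p : bool * bool) cmod (ld (h (inr p)) w) =
          \sum_(b : bool) \sum_(c : bool) cmod (ld (h (inr (b, c))) w).
        by rewrite pair_bigA; apply: eq_bigr => -[].
      rewrite !big_bool lerDr sumr_ge0 // => x _; exact: cmod_ge0.
    have := cmodB (ld (cder A) w - ld (cder B) w) (2 * (ld A w - ld B w)).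
    have := cmodB (ld (cder A) w) (ld (cder B) w).
    have := cmodB (ld A w) (ld B w).
    have := cmod_ge0 (ld (cder A) w); have := cmod_ge0 (ld (cder B) w).
    rewrite -/Phi cmodM cmod_nat; lra.
  have af := al_bound true K00 HK hw; have ag := al_bound false K00 HK hw.
  rewrite /= -/(A w) in af; rewrite /= -/(B w) in ag.
  have cA : 0 < cmod (A w) by rewrite cmod_gt0.
  have cB : 0 < cmod (B w) by rewrite cmod_gt0.
  have Ew : cmod (E w) * (cmod (A w) * cmod (B w)) =
      cmod (al f w) ^+ 2 * cmod (al g w) ^+ 2 * cmod Phi ^+ 2.
    rewrite -!cmodX -!cmodM; congr cmod.
    have ABn : (A w * B w) ^+ 2 != 0 by rewrite expf_neq0 // mulf_neq0.
    apply: (mulfI ABn); have := EE w; rewrite xE => EEw.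
    have -> : (A w * B w) ^+ 2 * (E w * (A w * B w)) = (A w * B w) ^+ 3 * E w by ring.
    by rewrite -EEw; ring.
  have f0 := cmod_ge0 (f w); have g0 := cmod_ge0 (g w).
  apply: (@le_trans _ _ (cmod (E w) * ((1 + cmod (f w)) * (1 + cmod (g w))))).
    by rewrite ler_wpM2l ?cmod_ge0 //; nra.
  rewrite -(ler_pM2r (mulr_gt0 cA cB)) mulrAC Ew.
  have -> : cmod (al f w) ^+ 2 * cmod (al g w) ^+ 2 * cmod Phi ^+ 2 *
     ((1 + cmod (f w)) * (1 + cmod (g w))) =
     (cmod (al f w) ^+ 2 * (1 + cmod (f w))) * (cmod (al g w) ^+ 2 * (1 + cmod (g w))) *
     cmod Phi ^+ 2 by ring.
  have nn u : 0 <= cmod (al u w) ^+ 2 * (1 + cmod (u w)).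
    by rewrite mulr_ge0 ?sqr_ge0 // addr_ge0 // cmod_ge0.
  apply: (@le_trans _ _ ((K0 * L w ^+ 2 * cmod (A w)) * (K0 * L w ^+ 2 * cmod (B w)) *
      (2 * L w) ^+ 2)).
    apply: ler_pM; [exact: mulr_ge0 (nn f) (nn g) | exact: sqr_ge0 |
      exact: ler_pM (nn f) (nn g) af ag |].
    by rewrite lerXn2r ?nnegrE ?cmod_ge0 // mulr_ge0.
  have -> : K0 * L w ^+ 2 * cmod (A w) * (K0 * L w ^+ 2 * cmod (B w)) * (2 * L w) ^+ 2 =
     4 * K0 ^+ 2 * L w ^+ 6 * (cmod (A w) * cmod (B w)) by ring.
  rewrite ler_wpM2r ?mulr_ge0 ?cmod_ge0 // ler_wpM2r ?exprn_ge0 // /K; lra.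
apply: nf; exists (f 0); apply: (@liouville _ f M) => // w.
by have := HM w; have := cmod_ge0 (g w); lra.
Qed.

Lemma xi_zero_quotient z : xi A B z = 0.
Proof.
have nal u : entire u -> nonconstant u -> ~ (forall z, al u z = 0).
  move=> Hu nu H.
  have [h1|h1] := entire_integral (entire_horner q Hu) (entire_cder Hu) H.
    exact: (horner_nonzero q0 Hu nu h1).
  exact: (cder_nonzero Hu nu h1).
have Hx : entire (xi A B).
  move=> w; change (cdiff (xi A B) w).
  have cA : cdiff A w := HA w; have cB : cdiff B w := HB w.
  have cA1 : cdiff (cder A) w := entire_cder HA w.
  have cB1 : cdiff (cder B) w := entire_cder HB w.
  have cA2 : cdiff (cder (cder A)) w := entire_cder (entire_cder HA) w.
  have cB2 : cdiff (cder (cder B)) w := entire_cder (entire_cder HB) w.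
  by rewrite /xi; cdiff_solve.
have Haa : entire (fun w => al f w * al g w).
  by move=> w; exact: cdiffM (Hal Hf w) (Hal Hg w).
have [w|H|//] := entire_integral Haa Hx; first by rewrite xi1E xi1_zero mulr0.
have [h1|h1] := entire_integral (Hal Hf) (Hal Hg) H.
  by exfalso; exact: (nal f Hf nf h1).
by exfalso; exact: (nal g Hg ng h1).
Qed.

End WithQuotient.

Lemma xi_zero z : xi A B z = 0.
Proof. by have [r4 r4E] := r4_ex; exact: xi_zero_quotient r4E z. Qed.

(** Up to the factor [A * B], [xi] is the Wronskian of [A' B^2] and [B' A^2], so
    [A' B^2 = c B' A^2], that is [(1/A)' = c (1/B)']. This in turn makes the Wronskian of [B - c A]
    and [A B] vanish, an integration carried out without poles. *)
Lemma moebius_relation : exists c d, c != 0 /\ forall z, B z - c * A z = d * (A z * B z).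
Proof.
have HA1 := entire_cder HA; have HB1 := entire_cder HB.
have Q0 : Q != 0 := monic_neq0 monic_rootpoly.
have A1n : ~ (forall z, cder A z = 0) := cder_horner_nonzero Q'0 Hf nf.
have B1n : ~ (forall z, cder B z = 0) := cder_horner_nonzero Q'0 Hg ng.
have An : ~ (forall z, A z = 0) := horner_nonzero Q0 Hf nf.
have Bn : ~ (forall z, B z = 0) := horner_nonzero Q0 Hg ng.
have HA2 : entire (fun z => A z ^+ 2) by move=> z; exact/cdiffX/HA.
have HB2 : entire (fun z => B z ^+ 2) by move=> z; exact/cdiffX/HB.
have sqn u : entire u -> ~ (forall z, u z = 0) -> ~ (forall z, u z ^+ 2 = 0).
  move=> Hu nu H; apply: nu => z; apply/eqP; have := H z => /eqP.
  by rewrite expf_eq0.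
have HN : entire (fun z => cder A z * B z ^+ 2) by move=> z; exact: cdiffM.
have HD : entire (fun z => cder B z * A z ^+ 2) by move=> z; exact: cdiffM.
have nD : ~ (forall z, cder B z * A z ^+ 2 = 0).
  by move=> /(entire_integral HB1 HA2)[//|]; exact: sqn.
have nN : ~ (forall z, cder A z * B z ^+ 2 = 0).
  by move=> /(entire_integral HA1 HB2)[//|]; exact: sqn.
have [z|c Hc] := wronskian_zero HN HD nD.
  rewrite (cderE (has_cderivM (cderP (HA1 z)) (has_cderivX 2 (cderP (HB z))))).
  rewrite (cderE (has_cderivM (cderP (HB1 z)) (has_cderivX 2 (cderP (HA z))))) /=.
  have := xi_zero z; rewrite /xi => X0.
  transitivity (A z * B z * 0); last by rewrite mulr0.
  by rewrite -X0; ring.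
have c0 : c != 0.
  by apply/eqP => E; apply: nN => z; rewrite Hc E mul0r.
have HcA : entire (fun z => B z - c * A z).
  by move=> z; apply: cdiffB (HB z) _; exact: cdiffM (cdiff_cst _ _) (HA z).
have HAB : entire (fun z => A z * B z) by move=> z; exact: cdiffM (HA z) (HB z).
have nAB : ~ (forall z, A z * B z = 0) by move=> /(entire_integral HA HB)[].
have [z|d Hd] := wronskian_zero HcA HAB nAB; last by exists c, d.
rewrite (cderE (has_cderivB (cderP (HB z)) (has_cderivZ c (cderP (HA z))))).
rewrite (cderE (has_cderivM (cderP (HA z)) (cderP (HB z)))).
transitivity (c * (cder B z * A z ^+ 2) - cder A z * B z ^+ 2); first by ring.
by rewrite Hc subrr.
Qed.

End Setting.

End SharedSet.

(** * Reduction to strong uniqueness or to Picard's theorem *)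

Section Conclusion.
Variable R : realType.
Local Notation C := R[i].
Implicit Types (u : C -> C) (z w b : C).

(** A polynomial with a single root [r] is a multiple of a power of ['X - r], and then its nonzero
    derivative can vanish only at [r]. *)
Lemma two_roots (P : {poly C}) b1 b2 : P^`() != 0 -> b1 != b2 ->
  root P^`() b1 -> root P^`() b2 -> exists r1 r2, [/\ r1 != r2, root P r1 & root P r2].
Proof.
move=> P'0 b12 rb1 rb2; have [rs Prs] := closed_field_poly_normal P.
have P0 : P != 0 by apply: contraNneq P'0 => ->; rewrite deriv0.
have l0 : lead_coef P != 0 by rewrite lead_coef_eq0.
have rP r : root P r = (r \in rs) by rewrite Prs rootZ // root_prod_XsubC.
case: rs Prs rP => [Pc|r rs Prs rP].
  by move: P'0; rewrite Pc big_nil derivZ -polyC1 derivC scaler0 eqxx.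
have [/allP all_r|/allPn[r' r'rs r'r]] := boolP (all (pred1 r) rs); last first.
  by exists r', r; split=> //; rewrite rP inE ?eqxx // r'rs orbT.
have PE : P = lead_coef P *: ('X - r%:P) ^+ (size rs).+1.
  rewrite {1}Prs big_cons exprS; congr (_ *: (_ * _)).
  rewrite big_seq (eq_bigr (fun=> 'X - r%:P)) => [|x /all_r/eqP ->//].
  by rewrite -big_seq big_const_seq count_predT iter_mulr_1.
have rb b : root P^`() b -> b = r.
  rewrite PE derivZ rootZ // deriv_exp derivXsubC mul1r rootE hornerMn mulrn_eq0 /=.
  by rewrite horner_exp hornerXsubC expf_eq0 subr_eq0 => /andP[_ /eqP].
by rewrite (rb _ rb1) (rb _ rb2) eqxx in b12.
Qed.

Lemma entire_not_pole u z : entire u -> ~ is_pole u z.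
Proof.
move=> Hu Hp; have [d d0 Hd] := cdiff_cont (Hu z) ltr01.
have [d' d'0 Hd'] := Hp (cmod (u z) + 1).
have [|w wz] := @cmod_ex_point _ z (Num.min d d'); first by rewrite lt_min d0.
rewrite lt_min => /andP[/Hd h1 wd'].
have := Hd' w; rewrite cmod_gt0 subr_eq0 wz wd' => /(_ isT).
have := cmodD (u w - u z) (u z); rewrite subrK; lra.
Qed.

Lemma entire_meromorphic u : entire u -> meromorphic u.
Proof.
by move=> Hu; split=> z; [exists 1 => // w _; exact: entire_not_pole | move=> _; exact: Hu].
Qed.

Lemma nonconstant_mero u : entire u -> nonconstant u -> mero_nonconstant u.
Proof.
by move=> Hu nu [b Hb]; apply: nu; exists b => z; apply: Hb; exact: entire_not_pole.
Qed.

End Conclusion.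

Theorem theorem2p1 (R : realType) (n : nat) (a : 'I_n -> R[i])
  (m1 m2 k : nat) (f : R[i] -> R[i]) (c : R[i]) :
  (1 <= n)%N ->
  injective a ->
  strong_uniqueness_poly (\prod_(i < n) ('X - (a i)%:P)) ->
  let Q := \prod_(i < n) ('X - (a i)%:P) in
  let S := fun z : R[i] => exists i : 'I_n, z = a i in
  num_distinct (fun z => mup z (Q - (Q.[0])%:P) == 1%N) m1 ->
  num_distinct (fun z => (2 <= mup z (Q - (Q.[0])%:P))%N) m2 ->
  num_distinct (fun z => root Q^`() z) k ->
  (maxn (2 * k + 2) (m1 + m2) < n)%N ->
  (2 < m1 + m2)%N ->
  (2 <= k)%N ->
  transcendental_entire f ->
  (hyper_order_entire f < 1%:E)%E ->
  c != 0 ->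
  share_set_weight f (fun z => f (z + c)) S 2 ->
  forall z, f z = f (z + c).
Proof.
move=> n1 inj SU Q S _ _ [s [us sQ ss]] nmax _ k2 [Hf tf] _ c0 share.
have sn : (2 * size s + 2 < n)%N by rewrite ss; apply: leq_ltn_trans (leq_maxl _ _) nmax.
pose g z := f (z + c).
have Hg : entire g := entire_shift c Hf.
have nf : nonconstant f.
  by move=> [b Hb]; apply: tf; exists b%:P => z; rewrite hornerC Hb.
have ng : nonconstant g.
  by move=> [b Hb]; apply: nf; exists b => z; rewrite -(Hb (z - c)) /g subrK.
have [c' [d [c'0 rel]]] := moebius_relation inj sQ sn Hf Hg nf ng share.
rewrite -/Q in rel.
(* For [d = 0] the relation reads [Q(g) = c' Q(f)], so strong uniqueness applies with
   [alpha = c'^-1]. *)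
have [d0|d0] := eqVneq d 0.
  have [_ _ su] := SU; move=> z.
  apply: (su f g c'^-1); rewrite ?invr_eq0 //; try exact: entire_not_pole.
  - exact: entire_meromorphic.
  - exact: entire_meromorphic.
  - exact: nonconstant_mero.
  - exact: nonconstant_mero.
  - move=> w _ _; have := rel w; rewrite d0 mul0r => /eqP; rewrite subr_eq0 => /eqP ->.
    by rewrite mulKf.
exfalso; apply: ng; exists (g 0).
(* The relation is [Q(g) = Q(f) * (d * Q(g) + c')]. At a zero of [P(g)] the bracket vanishes, hence
   [Q(g) = 0], although [Q(g) = - c' / d] is not 0. So [g] omits every root of [P]. *)
pose P := Q + (c' / d)%:P.
have Pg z : P.[g z] != 0.
  rewrite hornerD hornerC; apply/eqP => E.
  have Bz : Q.[g z] = - (c' / d) by apply/eqP; rewrite -subr_eq0 opprK E.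
  have := rel z; rewrite Bz => E1.
  have : c' / d = 0.
    apply/eqP; rewrite -oppr_eq0; apply/eqP.
    transitivity (d * (Q.[f z] * - (c' / d)) + c' * Q.[f z]); first by rewrite -E1; ring.
    by field.
  by move/eqP; rewrite mulf_eq0 invr_eq0 (negPf c'0) (negPf d0).
have P'E : P^`() = Q^`() by rewrite derivD derivC addr0.

have Q'0 : Q^`() != 0.
  apply: contraNneq (rootpoly_deriv_neq0 inj (Ordinal n1)) => h.
  by rewrite -/Q h horner0.
(* [P] and [Q] have the same derivative; its two distinct zeros force two distinct roots of [P]. *)
have [b1 [b2 [b12 b1s b2s]]] : exists b1 b2, [/\ b1 != b2, b1 \in s & b2 \in s].
  move: us ss k2 {sQ sn}; case: s => [|b1 [|b2 s]] us <- // _.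
  exists b1, b2; rewrite !inE !eqxx orbT; split=> //.
  by move: us; rewrite /= inE negb_or => /andP[/andP[]].
rewrite sQ -P'E in b1s; rewrite sQ -P'E in b2s; rewrite -P'E in Q'0.
have [r1 [r2 [r12 rt1 rt2]]] := two_roots Q'0 b12 b1s b2s.
apply: (little_picard Hg r12) => z.
  by apply: contraNneq (Pg z) => ->; rewrite -rootE.
by apply: contraNneq (Pg z) => ->; rewrite -rootE.
Qed.
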